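(* Let $x_1,x_2$ be two distinct points of $\mathbb{S}^2$. Then $$B_3(\mathbb{S}^2\setminus\{x_1,x_2\})/(B_3(\mathbb{S}^2\setminus\{x_1,x_2\}))^{(2)}\cong\mathbb{Z}^4\rtimes\mathbb{Z}^2,$$ where $\mathbb{Z}^4$ has a basis $\{\widetilde{\alpha_0},\widetilde{\beta_0},\widetilde{u},\widetilde{v}\}$, $\mathbb{Z}^2$ has a basis $\{\sigma,\rho_1\}$, and the action is given by: $$\begin{aligned} \sigma\cdot\widetilde{u}&=\widetilde{v},&\sigma\cdot\widetilde{v}&=-\widetilde{u}+\widetilde{v},\\ \sigma\cdot\widetilde{\alpha_0}&=\widetilde{\beta_0},&\sigma\cdot\widetilde{\beta_0}&=\widetilde{\beta_0}-\widetilde{\alpha_0},\\ \rho_1\cdot\widetilde{\alpha_0}&=\widetilde{\alpha_0},&\rho_1\cdot\widetilde{\beta_0}&=\widetilde{\beta_0},\\ \rho_1\cdot\widetilde{u}&=-\widetilde{\alpha_0}-\widetilde{u}+\widetilde{v},&\rho_1\cdot\widetilde{v}&=-\widetilde{\beta_0}-\widetilde{u}. \end{aligned}$$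
   Context: For a surface $M$, $F_m(M)=\{(y_1,\ldots,y_m)\in M^m: y_i\neq y_j\text{ if }i\neq j\}$, and $B_m(M)=\pi_1(F_m(M)/S_m)$ is the $m$-string braid group of $M$. Derived series: $G^{(0)}=G$, $G^{(i)}=[G^{(i-1)},G^{(i-1)}]$. In $N\rtimes Q$ the normal subgroup is $N$. $\mathbb{Z}^4$ and $\mathbb{Z}^2$ are free Abelian groups on the stated bases. *)

(* Defs.v *)
From HB Require Import structures.
From mathcomp Require Import all_boot all_order all_algebra perm.
From mathcomp Require Import all_classical all_reals all_analysis homotopy lra.

Set Implicit Arguments.
Unset Strict Implicit.
Unset Printing Implicit Defensive.

Import Order.TTheory GRing.Theory Num.Theory.
Import numFieldNormedType.Exports.

Local Open Scope classical_set_scope.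
Local Open Scope group_scope.
Local Open Scope quotient_scope.

Section Subgroups.
Variable G : groupType.
Implicit Types (A H K : set G) (x y z : G).

Definition is_subgroup H : Prop :=
  [/\ H 1, forall x y, H x -> H y -> H (x * y) & forall x, H x -> H x^-1].

Definition commutator_subgroup H K : set G :=
  smallest is_subgroup [set [~ x, y] | x in H & y in K].

Fixpoint derived_series (n : nat) : set G :=
  if n is m.+1 then
    commutator_subgroup (derived_series m) (derived_series m)
  else [set: G].

Record normal_subgroup := NormalSubgroup {
  normal_subgroup_set :> G -> Prop;
  normal_subgroupP : is_subgroup normal_subgroup_set;
  normal_subgroupJ : forall x y,
    normal_subgroup_set x -> normal_subgroup_set (x ^ y)
}.

Lemma smallest_subgroup A : is_subgroup (smallest is_subgroup A).
Proof.
split=> [H [[H1 _ _] _] //|x y Ax Ay H HA|x Ax H HA].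
  by case: (HA) => -[_ HM _] _; apply: HM; [exact: Ax|exact: Ay].
by case: (HA) => -[_ _ HV] _; apply: HV; exact: Ax.
Qed.

Lemma subgroup_conj H y : is_subgroup H -> is_subgroup [set x | H (x ^ y)].
Proof.
case=> H1 HM HV; split=> [|x z|x] /=; first by rewrite conj1g.
  by rewrite conjMg; exact: HM.
by rewrite conjVg; exact: HV.
Qed.

Lemma derived_subgroup n : is_subgroup (derived_series n).
Proof. by case: n => [|n]; [split|exact: smallest_subgroup]. Qed.

Lemma derived_normal_subproof n x y :
  derived_series n x -> derived_series n (x ^ y).
Proof.
elim: n x y => // n IHn x y /= Dx.
apply: (Dx [set x | commutator_subgroup _ _ (x ^ y)]); split.
  exact/subgroup_conj/smallest_subgroup.
move=> _ [a Da [b Db <-]] /=; rewrite conjRg => H [_]; apply.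
by exists (a ^ y); [exact: IHn|exists (b ^ y); [exact: IHn|]].
Qed.

Definition derived_normal n : normal_subgroup :=
  NormalSubgroup (derived_subgroup n) (@derived_normal_subproof n).

Section Quotient.
Variable N : normal_subgroup.

Lemma nsg1 : N 1. Proof. by case: (normal_subgroupP N). Qed.
Lemma nsgM x y : N x -> N y -> N (x * y).
Proof. by case: (normal_subgroupP N) => _ + _; apply. Qed.
Lemma nsgV x : N x -> N x^-1.
Proof. by case: (normal_subgroupP N) => _ _; apply. Qed.

Definition coset_rel : rel G := [rel x y | `[< N (x^-1 * y) >]].

Lemma coset_rel_refl : reflexive coset_rel.
Proof. by move=> x; apply/asboolP; rewrite mulVg; exact: nsg1. Qed.

Lemma coset_rel_sym : symmetric coset_rel.
Proof.
by move=> x y; apply/asboolP/asboolP => /nsgV; rewrite invgM invgK.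
Qed.

Lemma coset_rel_trans : transitive coset_rel.
Proof.
move=> y x z /asboolP Nxy /asboolP Nyz; apply/asboolP.
by have := nsgM Nxy Nyz; rewrite -mulgA mulVKg.
Qed.

Canonical coset_equiv :=
  EquivRel coset_rel coset_rel_refl coset_rel_sym coset_rel_trans.

Definition quotient_group := {eq_quot coset_rel}.
HB.instance Definition _ := Quotient.on quotient_group.
HB.instance Definition _ := Choice.on quotient_group.

Definition quotient_one : quotient_group := \pi_quotient_group 1.
Definition quotient_mul (a b : quotient_group) : quotient_group :=
  \pi_quotient_group (repr a * repr b).
Definition quotient_inv (a : quotient_group) : quotient_group :=
  \pi_quotient_group (repr a)^-1.

Lemma quotient_piP x y :
  \pi_quotient_group x = \pi_quotient_group y <-> N (x^-1 * y).
Proof. by split=> [/eqmodP/asboolP|Nxy]; last exact/eqmodP/asboolP. Qed.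

Lemma quotient_pi (a : quotient_group) : exists x, a = \pi_quotient_group x.
Proof. by exists (repr a); rewrite reprK. Qed.

Lemma quotient_mulE x y : quotient_mul (\pi_quotient_group x) (\pi_quotient_group y) =
  \pi_quotient_group (x * y).
Proof.
apply/quotient_piP; have /quotient_piP Nx := reprK (\pi_quotient_group x).
have /quotient_piP Ny := reprK (\pi_quotient_group y).
move: (repr _) (repr _) Nx Ny => y' x' Nx Ny.
have := nsgM (normal_subgroupJ y' Nx) Ny.
by rewrite /conjg invgM !mulgA mulgK.
Qed.

Lemma quotient_invE x : quotient_inv (\pi_quotient_group x) = \pi_quotient_group x^-1.
Proof.
apply/quotient_piP; have /quotient_piP Nx := reprK (\pi_quotient_group x).
move: (repr _) Nx => x' Nx.
have := normal_subgroupJ x'^-1 (nsgV Nx).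
by rewrite /conjg invgM !invgK !mulgA mulgK.
Qed.

Lemma quotient_mulA : associative quotient_mul.
Proof.
move=> a b c; case: (quotient_pi a) (quotient_pi b) (quotient_pi c).
by move=> x -> [y ->] [z ->]; rewrite !quotient_mulE mulgA.
Qed.

Lemma quotient_mul1 : left_id quotient_one quotient_mul.
Proof. by move=> a; case: (quotient_pi a) => x ->; rewrite quotient_mulE mul1g. Qed.

Lemma quotient_1mul : right_id quotient_one quotient_mul.
Proof. by move=> a; case: (quotient_pi a) => x ->; rewrite quotient_mulE mulg1. Qed.

Lemma quotient_mulV : left_inverse quotient_one quotient_inv quotient_mul.
Proof.
by move=> a; case: (quotient_pi a) => x ->; rewrite quotient_invE quotient_mulE mulVg.
Qed.

Lemma quotient_Vmul : right_inverse quotient_one quotient_inv quotient_mul.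
Proof.
by move=> a; case: (quotient_pi a) => x ->; rewrite quotient_invE quotient_mulE mulgV.
Qed.

HB.instance Definition _ := isGroup.Build quotient_group
  quotient_mulA quotient_mul1 quotient_1mul quotient_mulV quotient_Vmul.

End Quotient.
End Subgroups.

Definition group_isomorphic (G H : groupType) : Prop :=
  exists f : {multiplicative G -> H}, bijective f.

(* Actions of an abelian group by automorphisms of an abelian group, both in
   additive notation. *)
Record zmod_action (Q N : zmodType) := ZmodAction {
  zact :> Q -> N -> N;
  zact0 : forall n, zact 0%R n = n;
  zactD : forall q r n, zact (q + r)%R n = zact q (zact r n);
  zactDr : forall q n m, zact q (n + m)%R = (zact q n + zact q m)%R
}.

Section SemidirectProduct.
Variables (Q N : zmodType) (theta : zmod_action Q N).

Definition semidirect_product of zmod_action Q N : Type := (N * Q)%type.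
Local Notation NxQ := (semidirect_product theta).
HB.instance Definition _ := Choice.copy NxQ (N * Q)%type.

(* (n, q) (n', q') = (n + q . n', q + q'), so that q acts on N by conjugation
   n |-> q n q^-1. *)
Definition sd_one : NxQ := (0%R, 0%R).
Definition sd_mul (a b : NxQ) : NxQ :=
  ((a.1 + theta a.2 b.1)%R, (a.2 + b.2)%R).
Definition sd_inv (a : NxQ) : NxQ := ((- theta (- a.2) a.1)%R, (- a.2)%R).

Lemma zact_0r q : theta q 0%R = 0%R.
Proof. by apply: (@addrI _ (theta q 0%R)); rewrite -zactDr !addr0. Qed.

Lemma zactN q n : theta q (- n)%R = (- theta q n)%R.
Proof. by apply: (@addrI _ (theta q n)); rewrite -zactDr !subrr zact_0r. Qed.

Lemma sd_mulA : associative sd_mul.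
Proof.
by move=> a b c; rewrite /sd_mul /= zactDr zactD !addrA.
Qed.

Lemma sd_mul1 : left_id sd_one sd_mul.
Proof. by case=> n q; rewrite /sd_mul /= zact0 !add0r. Qed.

Lemma sd_1mul : right_id sd_one sd_mul.
Proof. by case=> n q; rewrite /sd_mul /= zact_0r !addr0. Qed.

Lemma sd_mulV : left_inverse sd_one sd_inv sd_mul.
Proof. by case=> n q; rewrite /sd_mul /= !addNr. Qed.

Lemma sd_Vmul : right_inverse sd_one sd_inv sd_mul.
Proof. by case=> n q; rewrite /sd_mul /= zactN -zactD !subrr zact0 subrr. Qed.

HB.instance Definition _ := isGroup.Build NxQ
  sd_mulA sd_mul1 sd_1mul sd_mulV sd_Vmul.

End SemidirectProduct.

Definition unit_interval (R : realType) : Type :=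
  set_type (`[0%R, 1%R]%classic : set R).

HB.instance Definition _ (R : realType) :=
  Topological.copy (unit_interval R) (set_type (`[0%R, 1%R]%classic : set R)).

Local Open Scope ring_scope.

Lemma continuous_compT (X Y Z : topologicalType) (f : X -> Y) (g : Y -> Z) :
  continuous f -> continuous g -> continuous (fun x => g (f x)).
Proof. by move=> cf cg x; apply: continuous_comp; [exact: cf|exact: cg]. Qed.

Lemma continuous_pairT (X Y Z : topologicalType) (f : X -> Y) (g : X -> Z) :
  continuous f -> continuous g -> continuous (fun x => (f x, g x)).
Proof. by move=> cf cg x; exact: (cvg_pair (cf x) (cg x)). Qed.

Section UnitInterval.
Variable R : realType.
Local Notation I := (unit_interval R).

Lemma clampI_subproof (x : R) :
  Num.max 0 (Num.min 1 x) \in (`[0%R, 1%R]%classic : set R).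
Proof.
by rewrite inE /= in_itv /= le_max lexx /= ge_max ler01 ge_min lexx.
Qed.

(* The retraction of the real line onto the unit interval. *)
Definition clampI (x : R) : I :=
  exist (fun y : R => y \in (`[0%R, 1%R]%classic : set R)) _
    (clampI_subproof x).

Definition valI (t : I) : R := set_val t.

Lemma valI_inj : injective valI.
Proof. exact: val_inj. Qed.

Lemma valI_ge0 t : 0 <= valI t.
Proof. by have := set_valP t; rewrite /valI /= in_itv /= => /andP[]. Qed.

Lemma valI_le1 t : valI t <= 1.
Proof. by have := set_valP t; rewrite /valI /= in_itv /= => /andP[]. Qed.

Lemma clampIE x : valI (clampI x) = Num.max 0 (Num.min 1 x).
Proof. by []. Qed.

Lemma clampI_id x : 0 <= x <= 1 -> valI (clampI x) = x.
Proof.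
by move=> /andP[x0 x1]; rewrite clampIE (min_idPr x1) (max_idPr x0).
Qed.

Lemma clampI_le0 x : x <= 0 -> valI (clampI x) = 0.
Proof.
move=> x0; rewrite clampIE; apply/max_idPl.
by rewrite ge_min x0 orbT.
Qed.

Lemma clampI_ge1 x : 1 <= x -> valI (clampI x) = 1.
Proof. by move=> x1; rewrite clampIE (min_idPl x1); apply/max_idPr. Qed.

Lemma clampI01_neq : clampI 0 != clampI 1.
Proof.
apply/eqP => /(congr1 valI); rewrite !clampI_id ?lexx ?ler01 //.
by move/eqP; rewrite eq_sym oner_eq0.
Qed.

HB.instance Definition _ := isBiPointed.Build I clampI01_neq.

Lemma valI0 : valI zero = 0. Proof. by rewrite clampI_id ?lexx ?ler01. Qed.
Lemma valI1 : valI one = 1. Proof. by rewrite clampI_id ?lexx ?ler01. Qed.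

Lemma clampIK t : clampI (valI t) = t.
Proof. by apply: valI_inj; rewrite clampI_id // valI_ge0 valI_le1. Qed.

Lemma valI_continuous : continuous valI.
Proof. exact: initial_continuous. Qed.

Lemma clampI_continuous : continuous clampI.
Proof.
apply: continuous_comp_initial => x.
apply: (@continuous_max R R (cst 0) (fun y : R => Num.min 1 y)).
  exact: cvg_cst.
by apply: (@continuous_min R R (cst 1) id); [exact: cvg_cst|exact: cvg_id].
Qed.

Lemma continuous_clampI (X : topologicalType) (f : X -> R) :
  continuous f -> continuous (fun x => clampI (f x)).
Proof.
by move=> cf x; apply: continuous_comp; [exact: cf|exact: clampI_continuous].
Qed.

Lemma continuous_valI (X : topologicalType) (f : X -> I) :
  continuous f -> continuous (fun x => valI (f x)).
Proof.
by move=> cf x; apply: continuous_comp; [exact: cf|exact: valI_continuous].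
Qed.

Lemma continuous_mull (X : topologicalType) (f : X -> R) (c : R) :
  continuous f -> continuous (fun x => c * f x).
Proof.
by move=> cf x; apply: cvgM; [exact: cvg_cst|exact: cf].
Qed.

Lemma continuous_addr (X : topologicalType) (f : X -> R) (c : R) :
  continuous f -> continuous (fun x => f x + c).
Proof.
by move=> cf x; apply: cvgD; [exact: cf|exact: cvg_cst].
Qed.

Lemma continuous_sub1 (X : topologicalType) (f : X -> R) :
  continuous f -> continuous (fun x => f x - 1).
Proof.
by move=> cf x; apply: cvgB; [exact: cf|exact: cvg_cst].
Qed.

Lemma continuous_1sub (X : topologicalType) (f : X -> R) :
  continuous f -> continuous (fun x => 1 - f x).
Proof.
by move=> cf x; apply: cvgB; [exact: cvg_cst|exact: cf].
Qed.

Lemma paste_continuous (X Y : topologicalType) (h : X -> R) (f g : X -> Y) :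
  continuous h -> continuous f -> continuous g ->
  (forall x, h x = 2^-1 -> f x = g x) ->
  continuous (fun x => if h x <= 2^-1 then f x else g x).
Proof.
move=> ch cf cg fg; apply/continuous_subspace_setT.
have -> : [set: X] = [set x | h x <= 2^-1] `|` [set x | 2^-1 <= h x].
  by apply/seteqP; split=> // x _ /=; apply/orP; exact: le_total.
apply: withinU_continuous.
- by apply: (@closed_comp _ _ h [set y | y <= 2^-1]) => //; exact: closed_le.
- by apply: (@closed_comp _ _ h [set y | 2^-1 <= y]) => //; exact: closed_ge.
- apply: (@subspace_eq_continuous _ _ _ f); last exact: continuous_subspaceT.
  by move=> x; rewrite inE => hx; rewrite /from_subspace ifT.
- apply: (@subspace_eq_continuous _ _ _ g); last exact: continuous_subspaceT.
  move=> x; rewrite inE /from_subspace /= => hx; case: ifP => // hx'.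
  by rewrite fg //; apply/eqP; rewrite eq_le hx hx'.
Qed.

End UnitInterval.


Section PathHomotopy.
Variables (R : realType) (T : topologicalType).
Local Notation I := (unit_interval R).

Section Relation.
Variables x y : T.
Implicit Types p q r : {path I from x to y in T}.

Definition path_homotopic p q : Prop := exists H : I * I -> T,
  [/\ continuous H,
      forall t, H (t, zero) = p t, forall t, H (t, one) = q t,
      forall s, H (zero, s) = x & forall s, H (one, s) = y].

Lemma path_homotopic_refl p : path_homotopic p p.
Proof.
exists (fun ts => p ts.1); split=> //=; [|by rewrite path_zero|by rewrite path_one].
by move=> ts; apply: continuous_comp; [exact: cvg_fst|exact: cts_fun].
Qed.

Lemma path_homotopic_comp (a b : {path I from x to y in T}) (z w : T)
    (p : {path I from z to w in T}) (phi psi : I -> I) :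
  continuous phi -> continuous psi -> phi zero = psi zero ->
  phi one = psi one -> (forall t, a t = p (phi t)) ->
  (forall t, b t = p (psi t)) -> path_homotopic a b.
Proof.
move=> cphi cpsi e0 e1 aE bE.
pose L (ts : I * I) : R := (1 - valI ts.2) * valI (phi ts.1)
                         + valI ts.2 * valI (psi ts.1).
have cL : continuous L.
  have c2 : continuous (fun ts : I * I => valI ts.2).
    by apply: continuous_valI => ts; exact: cvg_snd.
  have cf (f : I -> I) : continuous f ->
      continuous (fun ts : I * I => valI (f ts.1)).
    move=> cf; apply: continuous_valI => ts.
    by apply: continuous_comp; [exact: cvg_fst|exact: cf].
  move=> ts; apply: cvgD; apply: cvgM; [|exact: cf|exact: c2|exact: cf].
  by apply: cvgB; [exact: cvg_cst|exact: c2].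
have Lid t s : phi t = psi t -> clampI (L (t, s)) = phi t.
  move=> e; rewrite /L /= -e -mulrDl subrK mul1r; exact: clampIK.
exists (fun ts => p (clampI (L ts))); split.
- exact: (continuous_compT (continuous_clampI cL) (@cts_fun _ _ p)).
- by move=> t; rewrite /L /= valI0 subr0 mul1r mul0r addr0 clampIK aE.
- by move=> t; rewrite /L /= valI1 subrr mul1r mul0r add0r clampIK bE.
- by move=> s; rewrite Lid // -aE path_zero.
- by move=> s; rewrite Lid // -aE path_one.
Qed.

Lemma path_homotopic_sym p q : path_homotopic p q -> path_homotopic q p.
Proof.
case=> H [cH H0 H1 Hx Hy].
exists (fun ts => H (ts.1, clampI (1 - valI ts.2))); split=> //=.
- apply: (continuous_compT _ cH); apply: continuous_pairT => [ts|].
    exact: cvg_fst.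
  apply: continuous_clampI; apply: continuous_1sub.
  by apply: continuous_valI => ts; exact: cvg_snd.
- by move=> t; rewrite valI0 subr0.
- by move=> t; rewrite valI1 subrr.
Qed.

Lemma path_homotopic_trans p q r :
  path_homotopic p q -> path_homotopic q r -> path_homotopic p r.
Proof.
case=> H [cH H0 H1 Hx Hy] [K [cK K0 K1 Kx Ky]].
exists (fun ts => if valI ts.2 <= 2^-1
  then H (ts.1, clampI (2 * valI ts.2))
  else K (ts.1, clampI (2 * valI ts.2 - 1))); split=> /=.
- have c2 : continuous (fun ts : I * I => valI ts.2).
    by apply: continuous_valI => ts; exact: cvg_snd.
  apply: (@paste_continuous R) => //.
  + apply: (continuous_compT _ cH); apply: continuous_pairT => [ts|].
      exact: cvg_fst.
    exact/continuous_clampI/continuous_mull.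
  + apply: (continuous_compT _ cK); apply: continuous_pairT => [ts|].
      exact: cvg_fst.
    exact/continuous_clampI/continuous_sub1/continuous_mull.
  + move=> ts ->; rewrite divff ?pnatr_eq0 // subrr.
    by rewrite -/one -/zero H1 K0.
- move=> t; rewrite valI0 ifT ?invr_ge0 ?ler0n // mulr0; exact: H0.
- move=> t; rewrite valI1 ifF; last by apply/negP; lra.
  by rewrite mulr1 (_ : 2 - 1 = 1) -?K1 //; lra.
- by move=> s; case: ifP => _; [exact: Hx|exact: Kx].
- by move=> s; case: ifP => _; [exact: Hy|exact: Ky].
Qed.

End Relation.

Section Concatenation.
Variables x y z : T.
Variables (p : {path I from x to y in T}) (q : {path I from y to z in T}).

Definition path_cat_fun (t : I) : T :=
  if valI t <= 2^-1 then p (clampI (2 * valI t))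
  else q (clampI (2 * valI t - 1)).

Lemma path_cat_continuous : continuous path_cat_fun.
Proof.
apply: (@paste_continuous R); first exact: valI_continuous.
- apply: (continuous_compT _ (@cts_fun _ _ p)).
  exact/continuous_clampI/continuous_mull/valI_continuous.
- apply: (continuous_compT _ (@cts_fun _ _ q)).
  exact/continuous_clampI/continuous_sub1/continuous_mull/valI_continuous.
- move=> t ->; rewrite divff ?pnatr_eq0 // subrr.
  by rewrite -/one -/zero path_zero path_one.
Qed.

Lemma path_cat_zero : path_cat_fun zero = x.
Proof.
by rewrite /path_cat_fun valI0 ifT ?invr_ge0 ?ler0n // mulr0 path_zero.
Qed.

Lemma path_cat_one : path_cat_fun one = z.
Proof.
rewrite /path_cat_fun valI1 ifF; last by apply/negP; lra.
by rewrite mulr1 (_ : 2 - 1 = 1) ?path_one //; lra.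
Qed.

Definition path_cat : {path I from x to z in T} :=
  mk_path path_cat_continuous path_cat_zero path_cat_one.

Lemma path_catE t : path_cat t = if valI t <= 2^-1
  then p (clampI (2 * valI t)) else q (clampI (2 * valI t - 1)).
Proof. by []. Qed.

Definition path_rev_fun (t : I) : T := p (clampI (1 - valI t)).

Lemma path_rev_continuous : continuous path_rev_fun.
Proof.
apply: (continuous_compT _ (@cts_fun _ _ p)).
exact/continuous_clampI/continuous_1sub/valI_continuous.
Qed.

Lemma path_rev_zero : path_rev_fun zero = y.
Proof. by rewrite /path_rev_fun valI0 subr0 path_one. Qed.

Lemma path_rev_one : path_rev_fun one = x.
Proof. by rewrite /path_rev_fun valI1 subrr path_zero. Qed.

Definition path_rev : {path I from y to x in T} :=
  mk_path path_rev_continuous path_rev_zero path_rev_one.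

Lemma path_revE t : path_rev t = p (clampI (1 - valI t)).
Proof. by []. Qed.

End Concatenation.
End PathHomotopy.

Section PathGroupoid.
Variables (R : realType) (T : topologicalType).
Local Notation I := (unit_interval R).
Implicit Types x y z w : T.

Lemma path_cat_homotopic x y z (p p' : {path I from x to y in T})
    (q q' : {path I from y to z in T}) :
  path_homotopic p p' -> path_homotopic q q' ->
  path_homotopic (path_cat p q) (path_cat p' q').
Proof.
case=> H [cH H0 H1 Hx Hy] [K [cK K0 K1 Kx Ky]].
exists (fun ts => if valI ts.1 <= 2^-1
  then H (clampI (2 * valI ts.1), ts.2)
  else K (clampI (2 * valI ts.1 - 1), ts.2)); split=> /=.
- have c1 : continuous (fun ts : I * I => valI ts.1).
    by apply: continuous_valI => ts; exact: cvg_fst.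
  apply: (@paste_continuous R) => //.
  + apply: (continuous_compT _ cH); apply: continuous_pairT => [|ts].
      exact/continuous_clampI/continuous_mull.
    exact: cvg_snd.
  + apply: (continuous_compT _ cK); apply: continuous_pairT => [|ts].
      exact/continuous_clampI/continuous_sub1/continuous_mull.
    exact: cvg_snd.
  + move=> ts ->; rewrite divff ?pnatr_eq0 // subrr.
    by rewrite -/one -/zero Hy Kx.
- by move=> t; rewrite path_catE H0 K0.
- by move=> t; rewrite path_catE H1 K1.
- by move=> s; rewrite valI0 ifT ?invr_ge0 ?ler0n // mulr0; exact: Hx.
- move=> s; rewrite valI1 ifF; last by apply/negP; lra.
  by rewrite mulr1 (_ : 2 - 1 = 1) -?(Ky s) //; lra.
Qed.

Lemma path_rev_homotopic x y (p p' : {path I from x to y in T}) :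
  path_homotopic p p' -> path_homotopic (path_rev p) (path_rev p').
Proof.
case=> H [cH H0 H1 Hx Hy].
exists (fun ts => H (clampI (1 - valI ts.1), ts.2)); split=> /=.
- apply: (continuous_compT _ cH); apply: continuous_pairT => [|ts].
    apply/continuous_clampI/continuous_1sub/continuous_valI => ts.
    exact: cvg_fst.
  exact: cvg_snd.
- by move=> t; rewrite H0.
- by move=> t; rewrite H1.
- by move=> s; rewrite valI0 subr0; exact: Hy.
- by move=> s; rewrite valI1 subrr; exact: Hx.
Qed.

Lemma path_revK x y (p : {path I from x to y in T}) :
  path_rev (path_rev p) = p.
Proof.
apply/path_eqP => t; rewrite !path_revE clampI_id.
  by rewrite opprB addrC subrK clampIK.
by rewrite subr_ge0 valI_le1 lerBlDr lerDl valI_ge0.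
Qed.

Definition path_cst x : {path I from x to x in T} := cst x.

Lemma path_cat_cstl x y (p : {path I from x to y in T}) :
  path_homotopic (path_cat (path_cst x) p) p.
Proof.
apply: (@path_homotopic_comp _ _ _ _ _ _ _ _ p
  (fun t => clampI (2 * valI t - 1)) id).
- exact/continuous_clampI/continuous_sub1/continuous_mull/valI_continuous.
- by move=> t; exact: cvg_id.
- by apply: valI_inj; rewrite valI0 mulr0 clampI_le0 //; lra.
- by apply: valI_inj; rewrite valI1 clampI_ge1 //; lra.
- move=> t; rewrite path_catE; case: ifPn => // ht.
  have -> : clampI (2 * valI t - 1) = zero :> I.
    by apply: valI_inj; rewrite valI0 clampI_le0 //; lra.
  by rewrite path_zero.
- by [].
Qed.

Lemma path_cat_cstr x y (p : {path I from x to y in T}) :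
  path_homotopic (path_cat p (path_cst y)) p.
Proof.
apply: (@path_homotopic_comp _ _ _ _ _ _ _ _ p
  (fun t => clampI (2 * valI t)) id).
- exact/continuous_clampI/continuous_mull/valI_continuous.
- by move=> t; exact: cvg_id.
- by apply: valI_inj; rewrite valI0 mulr0 clampI_le0.
- by apply: valI_inj; rewrite valI1 clampI_ge1 //; lra.
- move=> t; rewrite path_catE; case: ifPn => // ht.
  have -> : clampI (2 * valI t) = one :> I.
    by apply: valI_inj; rewrite valI1 clampI_ge1 //; lra.
  by rewrite path_one.
- by [].
Qed.

Lemma path_cat_rev x y (p : {path I from x to y in T}) :
  path_homotopic (path_cat p (path_rev p)) (path_cst x).
Proof.
pose phi (t : I) : I := if valI t <= 2^-1 then clampI (2 * valI t)
                        else clampI (1 - valI (clampI (2 * valI t - 1))).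
apply: (@path_homotopic_comp _ _ _ _ _ _ _ _ p phi (cst zero)).
- apply: (@paste_continuous R); first exact: valI_continuous.
  + exact/continuous_clampI/continuous_mull/valI_continuous.
  + apply/continuous_clampI/continuous_1sub/continuous_valI.
    exact/continuous_clampI/continuous_sub1/continuous_mull/valI_continuous.
  + move=> t ->; apply: valI_inj; rewrite divff ?pnatr_eq0 // subrr.
    by rewrite -/one -/zero valI0 subr0.
- exact: cst_continuous.
- rewrite /phi valI0 ifT ?invr_ge0 ?ler0n //.
  by apply: valI_inj; rewrite valI0 mulr0 clampI_le0.
- rewrite /phi valI1 ifF; last by apply/negP; lra.
  apply: valI_inj; rewrite valI0 (@clampI_ge1 _ (2 * 1 - 1)); last lra.
  by rewrite subrr clampI_le0.
- by move=> t; rewrite path_catE path_revE /phi; case: ifP.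
- by move=> t; rewrite path_zero.
Qed.

Lemma path_cat_revl x y (p : {path I from x to y in T}) :
  path_homotopic (path_cat (path_rev p) p) (path_cst y).
Proof. by rewrite -{2}(path_revK p); exact: path_cat_rev. Qed.

Lemma path_catA x y z w (p : {path I from x to y in T})
    (q : {path I from y to z in T}) (r : {path I from z to w in T}) :
  path_homotopic (path_cat p (path_cat q r)) (path_cat (path_cat p q) r).
Proof.
apply: path_homotopic_sym.
pose f (t : I) : R := Num.min (2 * valI t)
  (Num.min (valI t + 4^-1) (2^-1 * (valI t + 1))).
have cf : continuous f.
  move=> t; apply: (@continuous_min R _ (fun t => 2 * valI t) (fun t =>
    Num.min (valI t + 4^-1) (2^-1 * (valI t + 1)))).
    exact/continuous_mull/valI_continuous.
  apply: (@continuous_min R _ (fun t => valI t + 4^-1)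
    (fun t => 2^-1 * (valI t + 1))); first exact/continuous_addr/valI_continuous.
  exact/continuous_mull/continuous_addr/valI_continuous.
have f1 t : 4 * valI t <= 1 -> f t = 2 * valI t.
  by move=> ht; rewrite /f; apply/min_idPl; rewrite le_min; apply/andP; split; lra.
have f2 t : 1 < 4 * valI t -> valI t <= 2^-1 -> f t = valI t + 4^-1.
  move=> ht ht'; rewrite /f (_ : Num.min (_ + _) _ = valI t + 4^-1).
    by apply/min_idPr; lra.
  by apply/min_idPl; lra.
have f3 t : 2^-1 < valI t -> f t = 2^-1 * (valI t + 1).
  move=> ht; rewrite /f (_ : Num.min (_ + _) _ = 2^-1 * (valI t + 1)).
    by apply/min_idPr; have := valI_le1 t; lra.
  by apply/min_idPr; lra.
apply: (@path_homotopic_comp _ _ _ _ _ _ _ _ (path_cat p (path_cat q r))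
  (fun t => clampI (f t)) id).
- exact: continuous_clampI.
- by move=> t; exact: cvg_id.
- apply: valI_inj; rewrite f1 valI0 ?mulr0 ?clampI_le0 //; lra.
- apply: valI_inj; rewrite f3 valI1 ?clampI_ge1 //; lra.
- move=> t; have t0 := valI_ge0 t; have t1 := valI_le1 t.
  rewrite path_catE; case: ifPn => [ht|]; last first.
    rewrite -ltNge => ht; rewrite f3 // path_catE clampI_id; last first.
      by apply/andP; split; lra.
    rewrite ifF; last by apply/negP; lra.
    rewrite (_ : 2 * (2^-1 * (valI t + 1)) - 1 = valI t); last by lra.
    by rewrite clampIK path_catE ifF //; apply/negP; lra.
  rewrite path_catE clampI_id; last by apply/andP; split; lra.
  case: ifPn => [ht'|].
    rewrite f1; last lra.
    rewrite path_catE clampI_id ?ht' //.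
    by apply/andP; split; lra.
  rewrite -ltNge => ht'; rewrite f2 //; last lra.
  rewrite path_catE clampI_id; last by apply/andP; split; lra.
  rewrite ifF; last by apply/negP; lra.
  rewrite path_catE clampI_id; last by apply/andP; split; lra.
  rewrite ifT; last by lra.
  by congr (q (clampI _)); lra.
- by [].
Qed.

End PathGroupoid.

Section FundamentalGroup.
Variables (R : realType) (T : topologicalType) (x : T).
Local Notation I := (unit_interval R).
Local Notation loop := {path I from x to x in T}.

Definition loop_homotopic : rel loop := [rel p q | `[< path_homotopic p q >]].

Lemma loop_homotopic_refl : reflexive loop_homotopic.
Proof. by move=> p; apply/asboolP; exact: path_homotopic_refl. Qed.

Lemma loop_homotopic_sym : symmetric loop_homotopic.
Proof.
by move=> p q; apply/asboolP/asboolP; exact: path_homotopic_sym.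
Qed.

Lemma loop_homotopic_trans : transitive loop_homotopic.
Proof.
move=> q p r /asboolP pq /asboolP qr; apply/asboolP.
exact: path_homotopic_trans pq qr.
Qed.

Canonical loop_equiv := EquivRel loop_homotopic
  loop_homotopic_refl loop_homotopic_sym loop_homotopic_trans.

Definition fundamental_group := {eq_quot loop_homotopic}.
HB.instance Definition _ := Quotient.on fundamental_group.
HB.instance Definition _ := Choice.on fundamental_group.
Local Notation pi1 := fundamental_group.

Definition pi1_one : pi1 := \pi_pi1 (path_cst R x).
Definition pi1_mul (a b : pi1) : pi1 := \pi_pi1 (path_cat (repr a) (repr b)).
Definition pi1_inv (a : pi1) : pi1 := \pi_pi1 (path_rev (repr a)).

Lemma pi1_piP (p q : loop) : \pi_pi1 p = \pi_pi1 q <-> path_homotopic p q.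
Proof. by split=> [/eqmodP/asboolP|pq]; last exact/eqmodP/asboolP. Qed.

Lemma pi1_pi (a : pi1) : exists p, a = \pi_pi1 p.
Proof. by exists (repr a); rewrite reprK. Qed.

Lemma pi1_mulE (p q : loop) :
  pi1_mul (\pi_pi1 p) (\pi_pi1 q) = \pi_pi1 (path_cat p q).
Proof.
by apply/pi1_piP; apply: path_cat_homotopic; apply/pi1_piP; rewrite reprK.
Qed.

Lemma pi1_invE (p : loop) : pi1_inv (\pi_pi1 p) = \pi_pi1 (path_rev p).
Proof.
by apply/pi1_piP; apply: path_rev_homotopic; apply/pi1_piP; rewrite reprK.
Qed.

Lemma pi1_mulA : associative pi1_mul.
Proof.
move=> a b c; case: (pi1_pi a) (pi1_pi b) (pi1_pi c) => p -> [q ->] [r ->].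
by rewrite !pi1_mulE; apply/pi1_piP; exact: path_catA.
Qed.

Lemma pi1_mul1 : left_id pi1_one pi1_mul.
Proof.
move=> a; case: (pi1_pi a) => p ->.
by rewrite pi1_mulE; apply/pi1_piP; exact: path_cat_cstl.
Qed.

Lemma pi1_1mul : right_id pi1_one pi1_mul.
Proof.
move=> a; case: (pi1_pi a) => p ->.
by rewrite pi1_mulE; apply/pi1_piP; exact: path_cat_cstr.
Qed.

Lemma pi1_mulV : left_inverse pi1_one pi1_inv pi1_mul.
Proof.
move=> a; case: (pi1_pi a) => p ->.
by rewrite pi1_invE pi1_mulE; apply/pi1_piP; exact: path_cat_revl.
Qed.

Lemma pi1_Vmul : right_inverse pi1_one pi1_inv pi1_mul.
Proof.
move=> a; case: (pi1_pi a) => p ->.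
by rewrite pi1_invE pi1_mulE; apply/pi1_piP; exact: path_cat_rev.
Qed.

HB.instance Definition _ := isGroup.Build fundamental_group
  pi1_mulA pi1_mul1 pi1_1mul pi1_mulV pi1_Vmul.

End FundamentalGroup.

Section BraidGroup.
Variables (m : nat) (M : topologicalType).

Definition conf_space : topologicalType :=
  set_type [set y : prod_topology (fun _ : 'I_m => M) | injective y].

Definition conf_rel : rel conf_space :=
  [rel y z | [exists s : 'S_m, `[< forall i, set_val z i = set_val y (s i) >]]].

Lemma conf_rel_refl : reflexive conf_rel.
Proof.
by move=> y; apply/existsP; exists 1%g; apply/asboolP => i; rewrite perm1.
Qed.

Lemma conf_rel_sym : symmetric conf_rel.
Proof.
suff sym y z : conf_rel y z -> conf_rel z y by move=> y z; apply/idP/idP; exact: sym.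
case/existsP => s /asboolP yz; apply/existsP; exists s^-1%g; apply/asboolP => i.
by rewrite yz permKV.
Qed.

Lemma conf_rel_trans : transitive conf_rel.
Proof.
move=> z y w /existsP[s /asboolP yz] /existsP[t /asboolP zw].
by apply/existsP; exists (t * s)%g; apply/asboolP => i; rewrite zw yz permM.
Qed.

Canonical conf_equiv :=
  EquivRel conf_rel conf_rel_refl conf_rel_sym conf_rel_trans.

Definition unordered_conf_space : topologicalType :=
  quotient_topology {eq_quot conf_rel}.

(* R only provides the interval on which paths are parametrized; b is the base
   point. *)
Definition braid_group (R : realType) (b : unordered_conf_space) : groupType :=
  fundamental_group R b.

End BraidGroup.

Definition sphere2 (R : realType) : set 'rV[R]_3 :=
  [set x | \sum_(i < 3) x ord0 i ^+ 2 = 1].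

Definition sphere2_minus (R : realType) (x1 x2 : 'rV[R]_3) : topologicalType :=
  set_type (@sphere2 R `\` [set x1; x2]).

(* Main.v *)
(* The complement of two points in the sphere is identified with the punctured
   plane, and an unordered triple in the latter with four points of the plane,
   one of them marked as the puncture, up to translation.  The conditions
   comparing two points lexicographically or by height are convex, so the
   configuration space is locally covered by convex charts; by subdivision every
   loop is a product of half twists of neighbouring points, and, after trivializing
   along the simply connected region where the puncture is below the other points,
   all of them are expressed through s1, s2 and rho, with s1 s2 s1 = s2 s1 s2,
   rho s2 = s2 rho and s1 rho s1 rho = rho s1 rho s1.

   In the quotient by the second derived subgroup, the conjugates of
   U = s1 s2^-1 commute, and the relations show that U, s2 U s2^-1 and their
   conjugates by rho span a normal subgroup on which s2 and rho act by the stated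
   matrices; every element is thus a normal form Phi(x) s2^i rho^j with x in Z^4.
   This requires no presentation of the braid group: normal forms are separated by
   a homomorphism to the semidirect product sending s1, s2, rho to u sigma, sigma,
   rho_1.  It is the holonomy of a cocycle defined near the diagonal, which
   multiplies the values of the crossings between two close configurations; the
   cocycle condition is a finite verification over the orderings of four points. *)

From HB Require Import structures.
Require Import Defs.
From mathcomp Require Import all_boot all_order all_algebra perm.
From mathcomp Require Import all_classical all_reals all_analysis homotopy.
From mathcomp Require Import ring lra zify.
From Stdlib Require Setoid Morphisms.

Set Implicit Arguments.
Unset Strict Implicit.
Unset Printing Implicit Defensive.

Import Order.TTheory GRing.Theory Num.Theory.
Import numFieldNormedType.Exports.

Local Open Scope classical_set_scope.
Local Open Scope quotient_scope.
Local Open Scope ring_scope.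

(** * Holonomy of a cocycle defined near the diagonal *)

(** Paths are only continuous, so crossings cannot be counted along generic paths. Two
    configurations close to x can differ in their left-to-right order only at pairs aligned
    vertically in x, whose heights then stay apart; the crossings between them can be read off from
    the orders alone. Near x their values are differences of one potential, the value of sorting the
    points into the order of their heights. Z^4 enters through the basis u, v, rho_1 u, rho_1 v
    instead of the stated one: these correspond to U and its conjugates by s2, rho and rho s2, and
    alpha_0, beta_0 are recovered from the formulas for rho_1 u and rho_1 v. The relation s1 s2 s1 =
    s2 s1 s2 gives the action of sigma on v, the relation between s1 and rho gives that of rho_1 on
    rho_1 u, and the rest follows because rho and s2 commute. The two matrices have orders 6 and 3,
    so that integer powers of the actions can be written without inverse matrices. *)

Section UniformSubdivision.
Variable R : realType.

(** Lebesgue number of the unit square. The radius is twice the mesh, so that the open ball around a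
    grid point contains the neighbouring grid points; all large [n] are allowed, so that several
    functions can share one subdivision. *)
Lemma uniform_subdivision2 (Q : set (R * R) -> Prop) :
  (forall A B : set (R * R), A `<=` B -> Q B -> Q A) ->
  (forall z : R * R, exists2 U, nbhs z U & Q U) ->
  exists n0 : nat, forall n, (n0 <= n)%N ->
    forall z : R * R, 0 <= z.1 <= 1 -> 0 <= z.2 <= 1 ->
    Q (ball z (2 / n.+1%:R)).
Proof.
move=> Qsub Qloc.
have cK : compact (`[0, 1] `*` `[0, 1] : set (R * R)).
  by apply: compact_setX; exact: segment_compact.
have := cK; rewrite compact_near_coveringP.
move=> /(_ nat \oo (fun n z => Q (ball z (2 / n.+1%:R))) _) [z _|n0 _ H]; last first.
  by exists n0 => n n0n z z1 z2; apply: H => //=; rewrite !in_itv.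
have [U /nbhs_ballP[e /= e0 eU] QU] := Qloc z.
exists (ball z (e / 2), [set n | 2 / n.+1%:R < e / 2]) => /=.
  split; first by apply: nbhsx_ballx; rewrite divr_gt0.
  near=> n => /=; rewrite -ltr_pdivlMl // mulrC.
  near: n.
  by apply: (near_infty_natSinv_lt (PosNum _)); rewrite !divr_gt0.
move=> [z' n] /= [zz' ne]; apply: Qsub QU => w z'w; apply: eU.
apply: (@ball_split _ _ z') => //.
by apply: le_ball z'w; exact: ltW.
Unshelve. all: by end_near. Qed.

Lemma uniform_subdivision (Q : set R -> Prop) :
  (forall A B : set R, A `<=` B -> Q B -> Q A) ->
  (forall z : R, exists2 U, nbhs z U & Q U) ->
  exists n0 : nat, forall n, (n0 <= n)%N ->
    forall z : R, 0 <= z <= 1 -> Q (ball z (2 / n.+1%:R)).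
Proof.
move=> Qsub Qloc.
have [||n0 H] := @uniform_subdivision2 (fun A => Q [set x | A (x, 0)]).
- by move=> A B AB; apply: Qsub => x; exact: AB.
- move=> [x y]; have [U xU QU] := Qloc x.
  exists [set w | U w.1]; first exact: (@cvg_fst _ _ (nbhs x) (nbhs y) _ _ xU).
  by apply: Qsub QU.
exists n0 => n n0n z z01.
apply: Qsub (H n n0n (z, 0) z01 _) => /=; last by rewrite lexx ler01.
by move=> x zx; split=> //; apply: ballxx; rewrite divr_gt0.
Qed.

End UniformSubdivision.

Section AlexanderSpanier.
Variables (R : realType) (X : topologicalType) (H : groupType).
Variable c : X -> X -> H.
Local Notation I := (unit_interval R).

Definition cocycle_on (U : set X) := forall p q r, U p -> U q -> U r ->
  (c p q * c q r)%g = c p r.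

Hypothesis c_local : forall x : X, exists2 U, nbhs x U & cocycle_on U.

Lemma cocycle_id x : c x x = 1%g.
Proof.
have [U /nbhs_singleton Ux /(_ x x x Ux Ux Ux)] := c_local x.
by move/(congr1 (fun h => (c x x)^-1 * h)%g); rewrite mulKg mulVg.
Qed.

Fixpoint iprod (f : nat -> H) n : H :=
  if n is m.+1 then (iprod f m * f m)%g else 1%g.

Lemma eq_iprod f g n : (forall k, (k < n)%N -> f k = g k) -> iprod f n = iprod g n.
Proof.
elim: n => // n IHn fg /=; rewrite fg // IHn // => k kn.
by apply: fg; exact: ltnW.
Qed.

Lemma iprodD f m n : iprod f (m + n) = (iprod f m * iprod (fun k => f (m + k)%N) n)%g.
Proof.
by elim: n => [|n IHn]; rewrite ?addn0 ?mulg1 // addnS /= IHn mulgA.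
Qed.

Lemma iprodM f m n :
  iprod f (m * n) = iprod (fun k => iprod (fun j => f (k * n + j)%N) n) m.
Proof. by elim: m => // m IHm; rewrite mulSn addnC iprodD IHm. Qed.

Lemma iprod_telescope (F : nat -> H) n :
  iprod (fun k => (F k)^-1 * F k.+1)%g n = ((F 0%N)^-1 * F n)%g.
Proof. by elim: n => [|n /= ->]; rewrite ?mulVg //= mulgA mulgK. Qed.

Definition subdiv_val (f : R -> X) n : H :=
  iprod (fun k => c (f (k%:R / n.+1%:R)) (f (k.+1%:R / n.+1%:R))) n.+1.

Lemma subdiv_itv n k : (k <= n.+1)%N -> 0 <= (k%:R / n.+1%:R : R) <= 1.
Proof.
move=> kn; rewrite divr_ge0 ?ler0n //= ler_pdivrMr ?ltr0n // mul1r.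
by rewrite ler_nat.
Qed.

Lemma ball_subdiv n k k' : (k <= k' <= k.+1)%N ->
  ball (k%:R / n.+1%:R : R) (2 / n.+1%:R) (k'%:R / n.+1%:R).
Proof.
case/andP=> kk' k'k; rewrite -ball_normE /= -mulrBl normrM [X in _ * X]gtr0_norm ?invr_gt0 // distrC.
rewrite ltr_pM2r ?invr_gt0 // -natrB // normr_nat ltr_nat.
by rewrite ltnS leq_subLR addn1.
Qed.

Definition uniform_at (f : R -> X) (n : nat) := forall z : R, 0 <= z <= 1 ->
  cocycle_on (f @` ball z (2 / n.+1%:R)).

Lemma uniform_ex (f : R -> X) : continuous f ->
  exists n0, forall n, (n0 <= n)%N -> uniform_at f n.
Proof.
move=> cf; apply: (@uniform_subdivision R (fun A => cocycle_on (f @` A))).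
  move=> A B AB cB p q r fp fq fr; apply: cB.
  - by case: fp => x /AB; exists x.
  - by case: fq => x /AB; exists x.
  - by case: fr => x /AB; exists x.
move=> z; have [U zU cU] := c_local (f z).
exists (f @^-1` U); first exact: cf.
by move=> _ _ _ [x fx <-] [y fy <-] [w fw <-]; exact: cU.
Qed.

Lemma iprod_cocycle (U : set X) (g : nat -> X) n : cocycle_on U ->
  (forall k, (k <= n)%N -> U (g k)) ->
  iprod (fun k => c (g k) (g k.+1)) n = c (g 0) (g n).
Proof.
move=> cU; elim: n => [|n IHn] Ug /=; first by rewrite cocycle_id.
rewrite IHn; last by move=> k kn; apply: Ug; exact: leqW.
by apply: cU; apply: Ug.
Qed.

(** The points inserted between two consecutive ones lie in one ball on which [c] is a cocycle, so
    their product telescopes to the old factor. *)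
Lemma subdiv_refine f n m : uniform_at f n ->
  subdiv_val f (n.+1 * m.+1).-1 = subdiv_val f n.
Proof.
move=> uf; rewrite /subdiv_val prednK ?muln_gt0 // iprodM.
apply: eq_iprod => k kn.
have m0 : m.+1%:R != 0 :> R by rewrite pnatr_eq0.
have n0 : n.+1%:R != 0 :> R by rewrite pnatr_eq0.
have E j : (k * m.+1 + j)%:R / (n.+1 * m.+1)%:R
    = (k%:R + j%:R / m.+1%:R) / n.+1%:R :> R.
  rewrite natrD !natrM; move: (k%:R) (j%:R) (m.+1%:R) (n.+1%:R) m0 n0 => K J M N M0 N0.
  by field; rewrite M0 N0.
pose g j := f ((k * m.+1 + j)%:R / (n.+1 * m.+1)%:R).
have -> : f (k%:R / n.+1%:R) = g 0%N by rewrite /g E mul0r addr0.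
have -> : f (k.+1%:R / n.+1%:R) = g m.+1 by rewrite /g E divff // natr1.
rewrite -(@iprod_cocycle _ g m.+1 (uf (k%:R / n.+1%:R) _)).
- by apply: eq_iprod => j _; rewrite /g addnS.
- by apply: subdiv_itv; exact: ltnW.
move=> j jm; exists ((k%:R + j%:R / m.+1%:R) / n.+1%:R); last by rewrite /g E.
rewrite -ball_normE /= mulrDl opprD addrA subrr add0r normrN ger0_norm; last first.
  by rewrite !divr_ge0.
rewrite ltr_pM2r ?invr_gt0 //; apply: (@le_lt_trans _ _ 1); last by rewrite ltr1n.
by rewrite ler_pdivrMr // mul1r ler_nat.
Qed.

Lemma subdiv_stable f n m : uniform_at f n -> uniform_at f m ->
  subdiv_val f n = subdiv_val f m.
Proof.
by move=> un um; rewrite -(subdiv_refine m un) mulnC subdiv_refine.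
Qed.

Lemma hol_ex (f : R -> X) : exists h, continuous f ->
  exists n0, forall n, (n0 <= n)%N -> subdiv_val f n = h.
Proof.
(* The value 1 at discontinuous [f] makes [hol] total. *)
have [cf|ncf] := pselect (continuous f); last by exists 1%g.
have [n0 un0] := uniform_ex cf; exists (subdiv_val f n0) => _.
exists n0 => n n0n; apply: subdiv_stable; exact: un0.
Qed.

Definition hol f : H := projT1 (cid (hol_ex f)).

Lemma holP f : continuous f ->
  exists n0, forall n, (n0 <= n)%N -> subdiv_val f n = hol f.
Proof. by rewrite /hol; case: cid => h /=. Qed.

(** Constant beyond both ends, so that balls of the real line can be used at 0 and 1. *)
Definition path_ext (x y : X) (p : {path I from x to y in X}) (t : R) : X :=
  p (clampI t).

Lemma path_ext_continuous x y (p : {path I from x to y in X}) :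
  continuous (path_ext p).
Proof.
apply: (@continuous_compT _ _ _ (@clampI R) p); first exact: clampI_continuous.
exact: cts_fun.
Qed.

Definition path_hol x y (p : {path I from x to y in X}) : H := hol (path_ext p).

(** Discrete Stokes formula on a fine grid of the homotopy: consecutive rows differ by two vertical
    sides, which are trivial since the endpoints are fixed. *)
Lemma path_hol_homotopic x y (p q : {path I from x to y in X}) :
  path_homotopic p q -> path_hol p = path_hol q.
Proof.
case=> K [cK K0 K1 Kx Ky].
pose L (z : R * R) := K (clampI z.1, clampI z.2).
have cL : continuous L.
  apply: (@continuous_compT _ _ _ (fun z : R * R => (clampI z.1, clampI z.2)) K) => //.
  by apply: continuous_pairT; apply: continuous_clampI => z; [exact: cvg_fst|exact: cvg_snd].
have [n0 un0] : exists n0, forall n, (n0 <= n)%N -> forall z : R * R,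
    0 <= z.1 <= 1 -> 0 <= z.2 <= 1 -> cocycle_on (L @` ball z (2 / n.+1%:R)).
  apply: (@uniform_subdivision2 R (fun A => cocycle_on (L @` A))).
    move=> A B AB cB a b d fa fb fd; apply: cB.
    - by case: fa => z /AB; exists z.
    - by case: fb => z /AB; exists z.
    - by case: fd => z /AB; exists z.
  move=> z; have [U zU cU] := c_local (L z).
  exists (L @^-1` U); first exact: cL.
  by move=> _ _ _ [a fa <-] [b fb <-] [d fd <-]; exact: cU.
have [n1 Hp] := holP (@path_ext_continuous _ _ p).
have [n2 Hq] := holP (@path_ext_continuous _ _ q).
pose n := maxn n0 (maxn n1 n2).
have [nn0 nn1 nn2] : [/\ (n0 <= n)%N, (n1 <= n)%N & (n2 <= n)%N].
  by rewrite /n !leq_max !leqnn !orbT.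
rewrite /path_hol -(Hp n) // -(Hq n) //.
pose G j k := L (k%:R / n.+1%:R, j%:R / n.+1%:R).
have -> : subdiv_val (path_ext p) n = iprod (fun k => c (G 0%N k) (G 0%N k.+1)) n.+1.
  by apply: eq_iprod => k _; rewrite /G /L /= mul0r !K0.
have -> : subdiv_val (path_ext q) n = iprod (fun k => c (G n.+1 k) (G n.+1 k.+1)) n.+1.
  by apply: eq_iprod => k _; rewrite /G /L /= divff ?pnatr_eq0 // !K1.
suff : forall j, (j <= n.+1)%N -> iprod (fun k => c (G 0%N k) (G 0%N k.+1)) n.+1 =
  iprod (fun k => c (G j k) (G j k.+1)) n.+1 by apply.
elim=> // j IHj jn; rewrite IHj; last exact: ltnW.
pose B k : set (R * R) := ball ((k%:R / n.+1%:R, j%:R / n.+1%:R) : R * R) (2 / n.+1%:R).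
have cG k : (k <= n)%N -> cocycle_on (L @` B k).
  move=> kn; apply: un0 => //=; apply: subdiv_itv; first exact: leqW.
  exact: ltnW.
have inG j' k k' : (j <= j' <= j.+1)%N -> (k <= k' <= k.+1)%N -> (L @` B k) (G j' k').
  move=> jj kk; exists (k'%:R / n.+1%:R, j'%:R / n.+1%:R) => //.
  by split; exact: ball_subdiv.
(* Both ways around a small square give [c] of its diagonal. *)
have step k : (k <= n)%N ->
    (c (G j k) (G j k.+1) * c (G j k.+1) (G j.+1 k.+1))%g =
    (c (G j k) (G j.+1 k) * c (G j.+1 k) (G j.+1 k.+1))%g.
  move=> kn; rewrite (@cG k) //; last 3 first.
  - by apply: inG; rewrite leqnn leqnSn.
  - by apply: inG; rewrite leqnn leqnSn.
  - by apply: inG; rewrite leqnn leqnSn.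
  by rewrite (@cG k) //; apply: inG; rewrite leqnn leqnSn.
have side k : (k <= n.+1)%N -> (iprod (fun k => c (G j k) (G j k.+1)) k * c (G j k) (G j.+1 k))%g
    = (c (G j 0%N) (G j.+1 0%N) * iprod (fun k => c (G j.+1 k) (G j.+1 k.+1)) k)%g.
  elim: k => [|k IHk] kn /=; first by rewrite mulg1 mul1g.
  by rewrite mulgA -IHk 1?ltnW // -!mulgA step.
have G0 i : G i 0%N = x by rewrite /G /L /= mul0r Kx.
have G1 i : G i n.+1 = y by rewrite /G /L /= divff ?pnatr_eq0 // Ky.
by have := side n.+1 (leqnn _); rewrite !G0 !G1 !cocycle_id mulg1 mul1g.
Qed.

Lemma path_hol_cat x y z (p : {path I from x to y in X})
    (q : {path I from y to z in X}) :
  path_hol (path_cat p q) = (path_hol p * path_hol q)%g.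
Proof.
have [n0 Hp] := holP (@path_ext_continuous _ _ p).
have [n1 Hq] := holP (@path_ext_continuous _ _ q).
have [n2 Hpq] := holP (@path_ext_continuous _ _ (path_cat p q)).
pose n := maxn n0 (maxn n1 n2).
have [nn0 nn1 nn2] : [/\ (n0 <= n)%N, (n1 <= n)%N & (n2 <= n)%N].
  by rewrite /n !leq_max !leqnn !orbT.
(* The concatenation gets twice as many pieces, so that the midpoint is a subdivision point;
   [subdiv_val f n] has [n.+1] pieces, hence the predecessor. *)
rewrite /path_hol -(Hp n) // -(Hq n) // -(Hpq (n.+1 + n.+1).-1); last first.
  by rewrite addSn /= (leq_trans nn2) // leq_addr.
rewrite /subdiv_val prednK ?addSn // -addSn iprodD.
have N0 : n.+1%:R != 0 :> R by rewrite pnatr_eq0.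
have half : 2^-1 * (n.+1%:R + n.+1%:R) = n.+1%:R :> R by lra.
have in01 k : (k <= n.+1 + n.+1)%N -> valI (clampI (k%:R / (n.+1 + n.+1)%:R : R)) =
    k%:R / (n.+1 + n.+1)%:R :> R.
  by move=> kn; rewrite clampI_id // addSn subdiv_itv // -addSn.
have Ep k : (k <= n.+1)%N -> path_ext (path_cat p q) (k%:R / (n.+1 + n.+1)%:R) =
    path_ext p (k%:R / n.+1%:R).
  move=> kn; rewrite /path_ext path_catE in01 ?(leq_trans kn) ?leq_addr //.
  have -> : 2 * (k%:R / (n.+1 + n.+1)%:R) = k%:R / n.+1%:R :> R.
    rewrite natrD; move: (k%:R) (n.+1%:R) N0 => K N N0; field.
    by rewrite -mulr2n mulrn_eq0 /= N0.
  rewrite ifT // ler_pdivrMr ?ltr0n // natrD.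
  by rewrite half ler_nat.
have Eq k : (k <= n.+1)%N -> path_ext (path_cat p q) ((n.+1 + k)%:R / (n.+1 + n.+1)%:R) =
    path_ext q (k%:R / n.+1%:R).
  move=> kn; case: k kn => [|k] kn.
    by rewrite addn0 Ep // /path_ext divff // mul0r -/one -/zero path_one path_zero.
  rewrite /path_ext path_catE in01 ?leq_add2l //.
  have -> : 2 * ((n.+1 + k.+1)%:R / (n.+1 + n.+1)%:R) - 1 = k.+1%:R / n.+1%:R :> R.
    rewrite !natrD; move: (k.+1%:R) (n.+1%:R) N0 => K N N0; field.
    by rewrite -mulr2n mulrn_eq0 /= N0.
  rewrite ifF //; apply/negbTE; rewrite -ltNge ltr_pdivlMr ?ltr0n // natrD.
  rewrite half ltr_nat.
  by rewrite addnS ltnS leq_addr.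
congr (_ * _)%g; apply: eq_iprod => k kn.
  by rewrite !Ep // ltnW.
by rewrite -addnS !Eq // ltnW.
Qed.

(** [F] depends on the time and not on the point, so it can serve as a potential along one path even
    where [c] has no global one; the product then telescopes. *)
Lemma path_hol_coboundary x y (p : {path I from x to y in X}) (F : R -> H) :
  (forall t : R, exists2 U, nbhs t U & forall s s', U s -> U s' ->
     c (path_ext p s) (path_ext p s') = ((F s)^-1 * F s')%g) ->
  path_hol p = ((F 0%R)^-1 * F 1%R)%g.
Proof.
move=> Floc; have [n0 H0] := holP (@path_ext_continuous _ _ p).
have [n1 H1] : exists n1, forall n, (n1 <= n)%N -> forall z : R, 0 <= z <= 1 ->
    forall s s', ball z (2 / n.+1%:R) s -> ball z (2 / n.+1%:R) s' ->
    c (path_ext p s) (path_ext p s') = ((F s)^-1 * F s')%g.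
  apply: (@uniform_subdivision R (fun A => forall s s', A s -> A s' ->
    c (path_ext p s) (path_ext p s') = ((F s)^-1 * F s')%g)) => //.
  by move=> A B AB cB s s' /AB As /AB As'; exact: cB.
pose n := maxn n0 n1.
rewrite /path_hol -(H0 n) ?leq_maxl // /subdiv_val.
pose g k := F (k%:R / n.+1%:R).
rewrite (@eq_iprod _ (fun k => (g k)^-1 * g k.+1)%g) => [|k kn].
  by rewrite iprod_telescope /g mul0r divff ?pnatr_eq0.
apply: (H1 n _ (k%:R / n.+1%:R)); rewrite ?leq_maxr ?subdiv_itv // 1?ltnW //.
  by apply: ballxx; rewrite divr_gt0.
by apply: ball_subdiv; rewrite leqnn leqnSn.
Qed.

End AlexanderSpanier.

(** * Functors on the path groupoid *)

#[local] Instance path_homotopic_equivalence (R : realType) (T : topologicalType) (x y : T) :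
  RelationClasses.Equivalence (@path_homotopic R T x y).
Proof.
split; [exact: path_homotopic_refl|exact: path_homotopic_sym|].
exact: path_homotopic_trans.
Qed.

#[local] Instance path_cat_proper (R : realType) (T : topologicalType) (x y z : T) :
  Morphisms.Proper (Morphisms.respectful (@path_homotopic R T x y)
    (Morphisms.respectful (@path_homotopic R T y z)
    (@path_homotopic R T x z))) (@path_cat R T x y z).
Proof. by move=> p p' pp' q q' qq'; exact: path_cat_homotopic. Qed.

#[local] Instance path_rev_proper (R : realType) (T : topologicalType) (x y : T) :
  Morphisms.Proper (Morphisms.respectful (@path_homotopic R T x y)
    (@path_homotopic R T y x)) (@path_rev R T x y).
Proof. by move=> p p' pp'; exact: path_rev_homotopic. Qed.

#[local] Hint Resolve path_homotopic_refl : core.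

Section PathFunctor.
Variables (R : realType) (X : topologicalType).
Local Notation I := (unit_interval R).

Record path_functor (G : groupType) := PathFunctor {
  pf_map :> forall x y : X, {path I from x to y in X} -> G;
  pf_homotopic : forall x y (p q : {path I from x to y in X}),
    path_homotopic p q -> pf_map p = pf_map q;
  pf_cat : forall x y z (p : {path I from x to y in X}) (q : {path I from y to z in X}),
    pf_map (path_cat p q) = (pf_map p * pf_map q)%g
}.

Lemma pf_cst (G : groupType) (F : path_functor G) x : F _ _ (path_cst R x) = 1%g.
Proof.
apply: (mulgI (F _ _ (path_cst R x))); rewrite -pf_cat mulg1.
by apply: pf_homotopic; rewrite path_cat_cstl.
Qed.

Lemma pf_rev (G : groupType) (F : path_functor G) x y (p : {path I from x to y in X}) :
  F _ _ (path_rev p) = (F _ _ p)^-1%g.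
Proof.
apply: (mulgI (F _ _ p)); rewrite -pf_cat mulgV -(pf_cst F x).
by apply: pf_homotopic; rewrite path_cat_rev.
Qed.

(** The endpoints may differ syntactically: configurations such as [mk (y \o s)] and [mk y] are
    equal only by proof. *)
Lemma eq_pf (G : groupType) (F : path_functor G) x y x' y'
    (p : {path I from x to y in X}) (q : {path I from x' to y' in X}) :
  p =1 q -> F _ _ p = F _ _ q.
Proof.
move=> pq; have xx : x = x' := etrans (esym path_zero) (etrans (pq zero) path_zero).
have yy : y = y' := etrans (esym path_one) (etrans (pq one) path_one).
by subst x' y'; congr (F _ _ _); exact/path_eqP.
Qed.

Section Gauge.
Variables (G : groupType) (F : path_functor G) (g : X -> G).

Definition gauge_map x y (p : {path I from x to y in X}) := (g x * F _ _ p / g y)%g.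

Lemma gauge_homotopic x y (p q : {path I from x to y in X}) :
  path_homotopic p q -> gauge_map p = gauge_map q.
Proof. by move=> pq; rewrite /gauge_map (pf_homotopic F pq). Qed.

Lemma gauge_cat x y z (p : {path I from x to y in X}) (q : {path I from y to z in X}) :
  gauge_map (path_cat p q) = (gauge_map p * gauge_map q)%g.
Proof. by rewrite /gauge_map pf_cat !mulgA mulgVK. Qed.

Definition gauge := PathFunctor gauge_homotopic gauge_cat.

End Gauge.

Section PathClass.
Variables (b : X) (delta : forall x, {path I from b to x in X}).

Definition path_class x y (p : {path I from x to y in X}) : fundamental_group R b :=
  \pi_(fundamental_group R b) (path_cat (path_cat (delta x) p) (path_rev (delta y))).

Lemma path_class_homotopic x y (p q : {path I from x to y in X}) :
  path_homotopic p q -> path_class p = path_class q.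
Proof. by move=> pq; apply/pi1_piP; rewrite pq. Qed.

Lemma path_class_cat x y z (p : {path I from x to y in X})
    (q : {path I from y to z in X}) :
  path_class (path_cat p q) = (path_class p * path_class q)%g.
Proof.
rewrite /path_class [RHS]pi1_mulE; apply/pi1_piP.
symmetry; rewrite -(path_catA (path_cat (delta x) p) (path_rev (delta y))).
rewrite (path_catA (path_rev (delta y)) (path_cat (delta y) q)).
rewrite (path_catA (path_rev (delta y)) (delta y)) path_cat_revl path_cat_cstl.
by rewrite path_catA -(path_catA (delta x) p q).
Qed.

Definition path_class_functor := PathFunctor path_class_homotopic path_class_cat.

Lemma path_class_surj g : exists p : {path I from b to b in X}, path_class p = g.
Proof.
have [p gE] := pi1_pi g.
(* Conjugation by [delta b], which need not be the constant loop. *)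
exists (path_cat (path_cat (path_rev (delta b)) p) (delta b)).
rewrite gE; apply/pi1_piP.
rewrite -(path_catA (path_rev (delta b)) p) (path_catA (delta b) (path_rev (delta b))).
rewrite path_cat_rev path_cat_cstl -(path_catA p) path_cat_rev.
exact: path_cat_cstr.
Qed.

End PathClass.

(** [s] and [t] may come in either order and lie outside the unit interval, which spares side
    conditions in subdivisions. *)
Definition subpath_fun x y (p : {path I from x to y in X}) (s t : R) (i : I) : X :=
  path_ext p ((t - s) * valI i + s).

Section Subpath.
Variables (x y : X) (p : {path I from x to y in X}) (s t : R).

Lemma subpath_continuous : continuous (subpath_fun p s t).
Proof.
apply: (@continuous_compT _ _ _ (fun i : I => (t - s) * valI i + s) (path_ext p)).
  exact/continuous_addr/continuous_mull/valI_continuous.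
exact: path_ext_continuous.
Qed.

Lemma subpath_zero : subpath_fun p s t zero = path_ext p s.
Proof. by rewrite /subpath_fun valI0 mulr0 add0r. Qed.

Lemma subpath_one : subpath_fun p s t one = path_ext p t.
Proof. by rewrite /subpath_fun valI1 mulr1 subrK. Qed.

Definition subpath : {path I from path_ext p s to path_ext p t in X} :=
  mk_path subpath_continuous subpath_zero subpath_one.

Lemma subpathE i : subpath i = path_ext p ((t - s) * valI i + s).
Proof. by []. Qed.

End Subpath.

(** Both sides are [p] after maps of the interval to itself with the same ends. *)
Lemma subpath_cat x y (p : {path I from x to y in X}) s t u :
  path_homotopic (path_cat (subpath p s t) (subpath p t u)) (subpath p s u).
Proof.
pose phi (i : I) : I := if valI i <= 2^-1
  then clampI ((t - s) * valI (clampI (2 * valI i)) + s)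
  else clampI ((u - t) * valI (clampI (2 * valI i - 1)) + t).
have caff (v w : R) (f : I -> R) : continuous f ->
    continuous (fun i => clampI (w * valI (clampI (f i)) + v)).
  move=> cf; apply/continuous_clampI/continuous_addr/continuous_mull.
  exact/continuous_valI/continuous_clampI.
apply: (@path_homotopic_comp _ _ _ _ _ _ _ _ p phi
  (fun i => clampI ((u - s) * valI i + s))) => [||||i|i] //.
- apply: (@paste_continuous R); first exact: valI_continuous.
  + exact/caff/continuous_mull/valI_continuous.
  + exact/caff/continuous_sub1/continuous_mull/valI_continuous.
  + move=> i ->; rewrite divff ?pnatr_eq0 // subrr -/one -/zero valI0 valI1.
    by rewrite mulr0 mulr1 add0r subrK.
- exact/continuous_clampI/continuous_addr/continuous_mull/valI_continuous.
- by rewrite /phi valI0 ifT ?invr_ge0 // !mulr0 -/zero valI0 mulr0.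
- rewrite /phi valI1 ifF; last by apply/negP; lra.
  rewrite mulr1 (_ : 2 - 1 = 1) -/one ?valI1; last lra.
  by congr clampI; lra.
- by rewrite path_catE /phi; case: ifP.
Qed.

Lemma subpath_id x y (p : {path I from x to y in X}) s :
  path_homotopic (subpath p s s) (path_cst R (path_ext p s)).
Proof.
apply: (@path_homotopic_comp _ _ _ _ _ _ _ _ p (cst (clampI s)) (cst (clampI s))).
- exact: cst_continuous.
- exact: cst_continuous.
- by [].
- by [].
- by move=> i; rewrite subpathE subrr mul0r add0r.
- by [].
Qed.

(** By subdivision, a path is homotopic to a product of pieces each contained in one of the given
    neighbourhoods. *)
Lemma pf_ind (G : groupType) (F : path_functor G) (S : set G) : is_subgroup S ->
  (forall x : X, exists2 U, nbhs x U & forall y z (p : {path I from y to z in X}),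
    (forall i, U (p i)) -> S (F _ _ p)) ->
  forall x y (p : {path I from x to y in X}), S (F _ _ p).
Proof.
move=> [S1 SM SV] Sloc x y p.
have [n0 H0] : exists n0, forall n, (n0 <= n)%N -> forall z : R, 0 <= z <= 1 ->
    forall s t, ball z (2 / n.+1%:R) s -> ball z (2 / n.+1%:R) t ->
    S (F _ _ (subpath p s t)).
  apply: (@uniform_subdivision R (fun A => forall s t, A s -> A t ->
    S (F _ _ (subpath p s t)))) => //.
    by move=> A B AB cB s t /AB As /AB At; exact: cB.
  move=> z; have [U zU SU] := Sloc (path_ext p z).
  have /nbhs_ballP[e /= e0 eU] := @path_ext_continuous _ _ _ _ p z _ zU.
  exists (ball z e); first exact: nbhsx_ballx.
  move=> s t zs zt; apply: SU => i; apply: eU.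
  have i0 := valI_ge0 i; have i1 := valI_le1 i.
  move: zs zt; rewrite -ball_normE /= !ltr_distlC => /andP[s1 s2] /andP[t1 t2].
  have [st|st] := leP s t.
    have v0 : 0 <= (t - s) * valI i by apply: mulr_ge0; lra.
    have v1 : 0 <= (t - s) * (1 - valI i) by apply: mulr_ge0; lra.
    by apply/andP; split; lra.
  have v0 : 0 <= (s - t) * valI i by apply: mulr_ge0; lra.
  have v1 : 0 <= (s - t) * (1 - valI i) by apply: mulr_ge0; lra.
  by apply/andP; split; lra.
pose q k : R := k%:R / n0.+1%:R.
have step k : (k <= n0.+1)%N -> S (F _ _ (subpath p (q 0%N) (q k))).
  elim: k => [|k IHk] kn.
    by rewrite (pf_homotopic F (subpath_id _ _)) pf_cst.
  rewrite -(pf_homotopic F (subpath_cat p (q 0%N) (q k) (q k.+1))).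
  rewrite pf_cat; apply: SM; first by apply: IHk; exact: ltnW.
  apply: (H0 n0 _ (q k)) => //; first by apply: subdiv_itv; exact: ltnW.
    by apply: ballxx; rewrite divr_gt0.
  by apply: ball_subdiv; rewrite leqnn leqnSn.
have := step n0.+1 (leqnn _).
have q0 : path_ext p (q 0%N) = x by rewrite /path_ext /q mul0r -/zero path_zero.
have q1 : path_ext p (q n0.+1) = y.
  by rewrite /path_ext /q divff ?pnatr_eq0 // -/one path_one.
have E : forall t : I, subpath p (q 0%N) (q n0.+1) t = p t.
  move=> t; rewrite subpathE /q mul0r divff ?pnatr_eq0 // subr0 mul1r addr0.
  by rewrite /path_ext clampIK.
(* The ends of the subpath equal [x] and [y] only by proof, so the subpath is generalized before
   they are rewritten. *)
move: (subpath _ _ _) E; rewrite q0 q1 => p' E.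
by rewrite (_ : p' = p) //; apply/path_eqP.
Qed.

End PathFunctor.

(** * Configurations in the punctured plane *)

Lemma initial_cvg (Y : choiceType) (Z : topologicalType) (w : Y -> Z)
    (F : set_system Y) (y : Y) :
  Filter F -> w @ F --> w y -> F --> (y : initial_topology w).
Proof.
move=> FF Fy A; rewrite nbhsE => -[B [[W oW WB] By] BA].
apply: (@filterS _ F _ B) => //; rewrite -WB; apply: Fy; apply: open_nbhs_nbhs.
by split=> //; move: By; rewrite -WB.
Qed.

Section OrderedConfigurations.
Variables (m : nat) (M : topologicalType).
Local Notation C := (conf_space m M).
Local Notation X := (unordered_conf_space m M).

Lemma conf_val_continuous i : continuous (fun o : C => set_val o i).
Proof.
move=> o; apply: (@continuous_comp _ _ _ (set_val : C -> prod_topology _) (proj i)).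
  exact: initial_continuous.
exact: proj_continuous.
Qed.

Lemma conf_continuous_at (T : topologicalType) (f : T -> C) (t : T) :
  (forall i, {for t, continuous (fun t => set_val (f t) i)}) -> {for t, continuous f}.
Proof.
move=> cf; apply: initial_cvg => /=.
apply/cvg_sup => i; apply: initial_cvg; exact: cf.
Qed.

Local Notation inj_fun := [set y : prod_topology (fun _ : 'I_m => M) | injective y].

Lemma conf_perm_subproof (s : 'S_m) (o : C) : (fun i => set_val o (s i)) \in inj_fun.
Proof.
have inj_o : injective (set_val o) := set_valP o.
by rewrite inE /= => i j /inj_o; exact: perm_inj.
Qed.

Definition conf_perm (s : 'S_m) (o : C) : C :=
  exist (fun y => y \in inj_fun) _ (conf_perm_subproof s o).

Lemma conf_permE s o i : set_val (conf_perm s o) i = set_val o (s i).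
Proof. by []. Qed.

Lemma conf_perm_continuous s : continuous (conf_perm s).
Proof. by move=> o; apply: conf_continuous_at => i; exact: conf_val_continuous. Qed.

Lemma pi_conf_eq (o o' : C) :
  \pi_X o = \pi_X o' <-> exists s : 'S_m, o' = conf_perm s o.
Proof.
split=> [/eqmodP/existsP[s /asboolP so]|[s ->]]; last first.
  by apply/eqmodP/existsP; exists s; apply/asboolP.
exists s; apply: val_inj; apply/funext => i; exact: so.
Qed.

(** Permutations act by homeomorphisms, so the saturation of an open set is a union of open sets. *)
Lemma pi_conf_open (A : set C) : open A -> open (\pi_X @` A : set X).
Proof.
move=> oA; rewrite /open /= /quotient_open.
rewrite (_ : _ @^-1` _ = \bigcup_s (conf_perm s @^-1` A)); last first.
  apply/seteqP; split=> [w [w' Aw' /esym/pi_conf_eq[s sw]]|w [s _ Asw]].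
    by exists s; rewrite //= -sw.
  by exists (conf_perm s w); rewrite //; apply/esym/pi_conf_eq; exists s.
apply: bigcup_open => s _; move/continuousP: (@conf_perm_continuous s); exact.
Qed.

End OrderedConfigurations.

Section PlanarConfigurations.
Variables (R : realType) (M : topologicalType) (h : M -> R * R) (k : R * R -> M).
Hypotheses (h_continuous : continuous h) (h_neq0 : forall p, h p != 0)
  (hK : cancel h k) (kK : forall z : R * R, z != 0 -> h (k z) = z)
  (k_continuous : forall z : R * R, z != 0 -> {for z, continuous k}).
Local Notation C := (conf_space 3 M).
Local Notation X := (unordered_conf_space 3 M).
Local Notation inj_fun := [set y : prod_topology (fun _ : 'I_3 => M) | injective y].
Variable w0 : C.

(* The point labelled 0 is the puncture, and configurations are considered up
   to translation. *)
Definition cfg : Type := 'I_4 -> R * R.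
Implicit Types x y z : cfg.

Lemma cfg_conf_subproof y : injective y ->
  (fun i => k (y (lift ord0 i) - y ord0)) \in inj_fun.
Proof.
move=> yI; have y0 i : y (lift ord0 i) - y ord0 != 0.
  by rewrite subr_eq0; apply/eqP => /yI/eqP; rewrite eq_sym (negbTE (neq_lift _ _)).
rewrite inE /= => i j /(congr1 h); rewrite !kK // => /addIr/yI.
exact: lift_inj.
Qed.

(** The default [w0] is taken only at non-injective [y]. *)
Definition cfg_conf y : C :=
  if pselect (injective y) is left yI
  then exist (fun f => f \in inj_fun) _ (cfg_conf_subproof yI) else w0.

Lemma cfg_confE y i : injective y ->
  set_val (cfg_conf y) i = k (y (lift ord0 i) - y ord0).
Proof. by rewrite /cfg_conf; case: pselect. Qed.

Definition mk y : X := \pi_X (cfg_conf y).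

Lemma eq_mk y z : y =1 z -> mk y = mk z.
Proof. by move=> /funext ->. Qed.

Lemma mk_continuous (T : topologicalType) (f : T -> cfg) :
  (forall i, continuous (fun t => f t i)) -> (forall t, injective (f t)) ->
  continuous (fun t => mk (f t)).
Proof.
move=> cf fI t; apply: (@continuous_comp _ _ _ (fun t => cfg_conf (f t)) (\pi_X)); last first.
  exact: pi_continuous.
apply: conf_continuous_at => i.
rewrite (_ : (fun _ => _) = k \o (fun t => f t (lift ord0 i) - f t ord0)); last first.
  by apply/funext => s; rewrite cfg_confE.
apply: continuous_comp; first by apply: cvgB; exact: cf.
apply: k_continuous; rewrite subr_eq0; apply/eqP => /fI/eqP.
by rewrite eq_sym (negbTE (neq_lift _ _)).
Qed.

Lemma mk_perm y (s : 'S_4) : injective y -> s ord0 = ord0 -> mk (y \o s) = mk y.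
Proof.
move=> yI s0; apply/esym/pi_conf_eq.
have si i : exists j, s (lift ord0 i) = lift ord0 j.
  case: (unliftP ord0 (s (lift ord0 i))) => [j ->|]; first by exists j.
  by rewrite -{2}s0 => /perm_inj/eqP; rewrite eq_sym (negbTE (neq_lift _ _)).
have [r rE] := choice si.
have rI : injective r.
  by move=> i j rij; apply: (@lift_inj _ ord0); apply: (@perm_inj _ s); rewrite !rE rij.
exists (perm rI); apply: val_inj; apply/funext => i.
have ysI : injective (y \o s) by move=> a c /yI/perm_inj.
rewrite -[LHS]/(set_val _ i) -[RHS]/(set_val (conf_perm _ _) i) conf_permE.
by rewrite !cfg_confE // permE /= rE s0.
Qed.

Lemma mk_translate y v : injective y -> mk (fun i => y i + v) = mk y.
Proof.
move=> yI; congr (\pi_X _); apply: val_inj; apply/funext => i.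
have yvI : injective (fun i => y i + v) by move=> a c /addIr/yI.
by rewrite -[LHS]/(set_val _ i) -[RHS]/(set_val _ i) !cfg_confE // opprD addrACA subrr addr0.
Qed.

(** The only ambiguity in lifting a point of [X] is a relabelling of the points other than the
    puncture, and a translation. *)
Lemma mk_eq y z : injective y -> injective z -> mk y = mk z ->
  exists (s : 'S_4) (v : R * R), s ord0 = ord0 /\ z = (fun i => y (s i) + v).
Proof.
move=> yI zI /pi_conf_eq[s sE].
exists (lift_perm ord0 ord0 s), (z ord0 - y ord0); split; first by rewrite lift_perm_id.
apply/funext => i; case: (unliftP ord0 i) => [j ->|->]; last first.
  by rewrite lift_perm_id addrC subrK.
rewrite lift_perm_lift.
have ne (x : cfg) a : injective x -> x (lift ord0 a) - x ord0 != 0.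
  move=> xI; rewrite subr_eq0; apply/eqP => /xI/eqP.
  by rewrite eq_sym (negbTE (neq_lift _ _)).
have := congr1 (fun w : C => h (set_val w j)) sE.
rewrite conf_permE !cfg_confE // !kK ?ne // => /(canRL (subrK _)) ->.
by rewrite -!addrA; congr (_ + _); rewrite addrC.
Qed.

Definition cfg_of (w : C) : cfg :=
  fun i => if unlift ord0 i is Some j then h (set_val w j) else 0.

Lemma cfg_of0 w : cfg_of w ord0 = 0. Proof. by rewrite /cfg_of unlift_none. Qed.

Lemma cfg_of_lift w i : cfg_of w (lift ord0 i) = h (set_val w i).
Proof. by rewrite /cfg_of liftK. Qed.

Lemma cfg_of_inj w : injective (cfg_of w).
Proof.
have wI : injective (set_val w) := set_valP w.
move=> i j; case: (unliftP ord0 i) => [i' ->|->]; case: (unliftP ord0 j) => [j' ->|->].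
- by rewrite !cfg_of_lift => /(can_inj hK)/wI ->.
- by rewrite cfg_of_lift cfg_of0 => /eqP; rewrite (negbTE (h_neq0 _)).
- by rewrite cfg_of_lift cfg_of0 => /esym/eqP; rewrite (negbTE (h_neq0 _)).
- by [].
Qed.

Lemma mk_cfg_of w : mk (cfg_of w) = \pi_X w.
Proof.
congr (\pi_X _); apply: val_inj; apply/funext => i.
rewrite -[LHS]/(set_val _ i) cfg_confE; last exact: cfg_of_inj.
by rewrite cfg_of_lift cfg_of0 subr0 hK.
Qed.

Lemma mk_surj (P : X) : exists2 y, injective y & mk y = P.
Proof.
exists (cfg_of (repr P)); first exact: cfg_of_inj.
by rewrite mk_cfg_of reprK.
Qed.

Lemma cfg_of_continuous i : continuous (fun w : C => cfg_of w i).
Proof.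
case: (unliftP ord0 i) => [j ->|->].
  rewrite (_ : (fun _ => _) = (fun w => h (set_val w j))); last first.
    by apply/funext => w; rewrite cfg_of_lift.
  by move=> w; apply: continuous_comp; [exact: conf_val_continuous|exact: h_continuous].
rewrite (_ : (fun _ => _) = cst 0); first exact: cst_continuous.
by apply/funext => w; rewrite cfg_of0.
Qed.

Definition near_cfg x (e : R) y := forall i, `|y i - x i| < e.

Lemma cfg_separated x : injective x ->
  exists2 e : R, 0 < e & forall i j, i != j -> e < `|x i - x j|.
Proof.
move=> xI.
have : \forall e \near (0 : R)^'+, forall ij : 'I_4 * 'I_4, ij.1 != ij.2 -> e < `|x ij.1 - x ij.2|.
  apply: filter_forall => -[i j] /=.
  have [->|ij] := eqVneq i j; first exact: nearW.
  near=> e => _; near: e; apply: nbhs_right_lt.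
  by rewrite normr_gt0 subr_eq0; apply: contra_neq ij; exact: xI.
move=> H; have [e [e0 He]] : exists e : R, 0 < e /\
    forall ij : 'I_4 * 'I_4, ij.1 != ij.2 -> e < `|x ij.1 - x ij.2|.
  near (0 : R)^'+ => e; exists e; split; first by near: e; exact: nbhs_right_gt.
  by near: e.
by exists e => // i j ij; exact: (He (i, j)).
Unshelve. all: by end_near. Qed.

Lemma near_cfg_open (w : C) e : open [set w' | near_cfg (cfg_of w) e (cfg_of w')].
Proof.
rewrite openE => w' ww'.
apply: (@filter_forall _ _ (fun i w'' => `|cfg_of w'' i - cfg_of w i| < e) (nbhs w')) => i.
have : open [set z : R * R | `|z - cfg_of w i| < e].
  rewrite (_ : [set _ | _] = ball (cfg_of w i) e); first exact: ball_open.
  by rewrite -ball_normE; apply/seteqP; split=> z; rewrite /= distrC.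
move=> oB; have := open_nbhs_nbhs (conj oB (ww' i)).
exact: cfg_of_continuous.
Qed.

(** Covering property: two orderings of one configuration cannot both be close to [w], and choosing
    the close one is continuous because the quotient map is open. *)
Lemma mk_local_section (w : C) (e : R) : 0 < e ->
  exists (U : set X) (L : X -> cfg), nbhs (\pi_X w) U /\
    forall P, U P -> [/\ injective (L P), mk (L P) = P, near_cfg (cfg_of w) e (L P) &
      forall i, {for P, continuous (fun P => L P i)}].
Proof.
move=> e0; have [d d0 dw] := cfg_separated (@cfg_of_inj w).
(* A nontrivial relabelling would bring some point within [d / 2] of two points of [w], which are
   more than [d] apart. *)
pose e' := Num.min e (d / 2).
have e'0 : 0 < e' by rewrite lt_min e0 divr_gt0.
pose V := [set w' : C | near_cfg (cfg_of w) e' (cfg_of w')].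
have Vw : V w by move=> i; rewrite subrr normr0.
have VI w1 w2 : V w1 -> V w2 -> \pi_X w1 = \pi_X w2 -> w1 = w2.
  move=> V1 V2 /pi_conf_eq[s sE].
  suff s1 : s =1 id by rewrite sE; apply: val_inj; apply/funext => i; rewrite /= s1.
  move=> i; apply: contrapT => si.
  have := dw (lift ord0 (s i)) (lift ord0 i) _.
  rewrite (inj_eq (@lift_inj _ _)) => /(_ (introN eqP si)); apply/negP; rewrite -leNgt.
  have := V1 (lift ord0 (s i)); have := V2 (lift ord0 i).
  rewrite sE !cfg_of_lift conf_permE => a1 a2.
  rewrite (_ : _ - _ = - (h (set_val w1 (s i)) - h (set_val w (s i)))
    + (h (set_val w1 (s i)) - h (set_val w i))); last by rewrite opprB addrA subrK.
  apply: le_trans (ler_normD _ _) _; rewrite normrN.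
  have e'd : e' <= d / 2 by rewrite /e' ge_min lexx orbT.
  by lra.
pose sec P := xget w0 [set w' | V w' /\ \pi_X w' = P].
have secP P : (\pi_X @` V : set X) P -> V (sec P) /\ \pi_X (sec P) = P.
  move=> [w' Vw' w'P].
  by apply: (xgetPex w0 (P := [set w' | V w' /\ \pi_X w' = P])); exists w'.
exists (\pi_X @` V), (fun P => cfg_of (sec P)); split.
  apply: open_nbhs_nbhs; split; first exact/pi_conf_open/near_cfg_open.
  by exists w.
move=> P UP; have [VsP sPP] := secP P UP; split.
- exact: cfg_of_inj.
- by rewrite mk_cfg_of.
- by move=> i; apply: lt_le_trans (VsP i) _; rewrite /e' ge_min lexx.
move=> i A; rewrite nbhsE => -[B [oB Bi] BA].
pose W := V `&` (fun w' => cfg_of w' i) @^-1` B.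
have oW : open W.
  apply: openI; first exact: near_cfg_open.
  by move/continuousP: (@cfg_of_continuous i); exact.
have : nbhs P (\pi_X @` W : set X).
  apply: open_nbhs_nbhs; split; first exact: pi_conf_open.
  by exists (sec P).
apply: filterS => Q [w' [Vw' Bw'] w'Q]; apply: BA => /=.
have [Vs sQ] := secP Q (ex_intro2 _ _ w' Vw' w'Q).
by rewrite (VI (sec Q) w' Vs Vw') // sQ w'Q.
Qed.

End PlanarConfigurations.

(** * Convex charts and straight segments *)

Section ConvexCharts.
Variable R : realType.
Local Notation I := (unit_interval R).
Implicit Types (u v : R * R) (x y z : cfg R).

Definition lexlt u v := (u.1 < v.1) || (u.1 == v.1) && (u.2 < v.2).

(* The first boolean chooses between the lexicographic order and the order of
   heights, the second one the direction of the inequality. *)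
Definition cone (c : bool * bool) u v :=
  match c with
  | (true, true) => lexlt u v
  | (true, false) => lexlt v u
  | (false, true) => u.2 < v.2
  | (false, false) => v.2 < u.2
  end.

Lemma lexlt_irr u : lexlt u u = false.
Proof. by rewrite /lexlt !ltxx andbF. Qed.

Lemma lexlt_trans : transitive lexlt.
Proof.
move=> v u w /orP[uv|/andP[/eqP uv uv2]] /orP[vw|/andP[/eqP vw vw2]]; apply/orP.
- by left; exact: lt_trans uv vw.
- by left; rewrite -vw.
- by left; rewrite uv.
- by right; rewrite uv vw eqxx (lt_trans uv2 vw2).
Qed.

Lemma lexlt_total u v : u != v -> lexlt u v || lexlt v u.
Proof.
case: u v => [a b] [c d]; rewrite xpair_eqE /lexlt /=.
by case: (ltgtP a c) => //= _; case: (ltgtP b d).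
Qed.

Lemma lexlt_asym u v : lexlt u v -> lexlt v u = false.
Proof. by move=> uv; apply/negP => vu; have := lexlt_trans uv vu; rewrite lexlt_irr. Qed.

Definition lin_pt u v (t : R) : R * R :=
  ((1 - t) * u.1 + t * v.1, (1 - t) * u.2 + t * v.2).

Lemma lin_pt0 u v : lin_pt u v 0 = u.
Proof. by case: u => a b; rewrite /lin_pt subr0 !mul1r !mul0r !addr0. Qed.

Lemma lin_pt1 u v : lin_pt u v 1 = v.
Proof. by case: v => a b; rewrite /lin_pt subrr !mul1r !mul0r !add0r. Qed.

Lemma lin_pt_id u t : lin_pt u u t = u.
Proof. by case: u => a b; rewrite /lin_pt -!mulrDl subrK !mul1r. Qed.

Lemma lexlt_lin u v u' v' t : 0 <= t <= 1 -> lexlt u v -> lexlt u' v' ->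
  lexlt (lin_pt u u' t) (lin_pt v v' t).
Proof.
move=> /andP[t0 t1].
have [->|tn0] := eqVneq t 0; first by rewrite !lin_pt0.
have [->|tn1] := eqVneq t 1; first by rewrite !lin_pt1.
have {t0}t0 : 0 < t by rewrite lt_neqAle eq_sym tn0.
have {t1}t1 : 0 < 1 - t by rewrite subr_gt0 lt_neqAle tn1.
case: u v u' v' => [a b] [c d] [a' b'] [c' d'].
rewrite /lexlt /lin_pt /=.
move=> /orP[ac|/andP[/eqP -> bd]] /orP[ac'|/andP[/eqP -> bd']]; apply/orP.
- by left; apply: ltrD; rewrite lter_pM2l.
- by left; apply: ltr_leD; rewrite // ltr_pM2l.
- by left; apply: ler_ltD; rewrite // ltr_pM2l.
- by right; rewrite eqxx /=; apply: ltrD; rewrite ltr_pM2l.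
Qed.

Lemma cone_lin c u v u' v' t : 0 <= t <= 1 -> cone c u v -> cone c u' v' ->
  cone c (lin_pt u u' t) (lin_pt v v' t).
Proof.
have im a b a' b' : 0 <= t <= 1 -> a < b -> a' < b' ->
    (1 - t) * a + t * a' < (1 - t) * b + t * b'.
  move=> /andP[t0 t1] ab ab'.
  have [->|tn0] := eqVneq t 0; first by rewrite subr0 !mul1r !mul0r !addr0.
  apply: ler_ltD; first by apply: ler_wpM2l; [rewrite subr_ge0|exact: ltW].
  by rewrite ltr_pM2l // lt_neqAle eq_sym tn0.
by case: c => [[] []] t01; [exact: lexlt_lin|exact: lexlt_lin|exact: im|exact: im].
Qed.

Lemma cone_neq c u v : cone c u v -> u <> v.
Proof. by move=> + uv; rewrite uv; case: c => [[] []] /=; rewrite ?lexlt_irr ?ltxx. Qed.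

Definition chart (c : 'I_4 -> 'I_4 -> bool * bool) : set (cfg R) :=
  [set y | forall i j, i != j -> cone (c i j) (y i) (y j)].

Lemma chart_inj c y : chart c y -> injective y.
Proof.
move=> cy i j; apply: contraPeq => ij; exact: cone_neq (cy i j ij).
Qed.

Definition lin y z (t : R) : cfg R := fun i => lin_pt (y i) (z i) t.

Lemma lin0 y z : lin y z 0 = y. Proof. by apply/funext => i; exact: lin_pt0. Qed.
Lemma lin1 y z : lin y z 1 = z. Proof. by apply/funext => i; exact: lin_pt1. Qed.

Lemma chart_lin c y z t : 0 <= t <= 1 -> chart c y -> chart c z -> chart c (lin y z t).
Proof. by move=> t01 cy cz i j ij; apply: cone_lin => //; [exact: cy|exact: cz]. Qed.

Lemma lin_pt_continuous (T : topologicalType) (f g : T -> R * R) (t : T -> R) :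
  continuous f -> continuous g -> continuous t ->
  continuous (fun s => lin_pt (f s) (g s) (t s)).
Proof.
move=> cf cg ct.
have ccomb (a c : T -> R) : continuous a -> continuous c ->
    continuous (fun s => (1 - t s) * a s + t s * c s).
  move=> ca cc s; apply: cvgD; apply: cvgM; [|exact: ca|exact: ct|exact: cc].
  by apply: cvgB; [exact: cvg_cst|exact: ct].
by apply: continuous_pairT; apply: ccomb => s;
  apply: (@continuous_comp _ _ _ _ (fun u : R * R => _ u)) => //;
  [exact: cf|exact: cvg_fst|exact: cg|exact: cvg_fst|exact: cf|exact: cvg_snd|exact: cg|exact: cvg_snd].
Qed.

(** When two abscissas agree, the lexicographic comparison is not stable near [x]; the heights then
    differ, and their comparison is stable. *)
Definition chart_of x (i j : 'I_4) : bool * bool :=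
  if (x i).1 != (x j).1 then (true, (x i).1 < (x j).1) else (false, (x i).2 < (x j).2).

Lemma near_chart x : injective x ->
  exists2 e : R, 0 < e & forall y, near_cfg x e y -> chart (chart_of x) y.
Proof.
move=> xI.
have ex_e (f : 'I_4 -> R) : \forall e \near (0 : R)^'+,
    forall ij : 'I_4 * 'I_4, f ij.1 != f ij.2 -> 2 * e < `|f ij.1 - f ij.2|.
  apply: filter_forall => -[i j] /=; have [->|fij] := eqVneq (f i) (f j).
    exact: nearW.
  near=> e => _; rewrite mulrC -ltr_pdivlMr //; near: e; apply: nbhs_right_lt.
  by rewrite divr_gt0 // normr_gt0 subr_eq0.
have [e [e0 He1 He2]] : exists e : R, [/\ 0 < e,
    forall ij : 'I_4 * 'I_4, (x ij.1).1 != (x ij.2).1 -> 2 * e < `|(x ij.1).1 - (x ij.2).1| &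
    forall ij : 'I_4 * 'I_4, (x ij.1).2 != (x ij.2).2 -> 2 * e < `|(x ij.1).2 - (x ij.2).2|].
  near (0 : R)^'+ => e; exists e; split; first by near: e; exact: nbhs_right_gt.
    by near: e; exact: (ex_e (fun i => (x i).1)).
  by near: e; exact: (ex_e (fun i => (x i).2)).
exists e => //.
have ord (a b a' b' : R) : 2 * e < `|a - b| -> `|a' - a| < e -> `|b' - b| < e ->
    if a < b then a' < b' else b' < a'.
  rewrite !ltr_distl => ab /andP[a1 a2] /andP[b1 b2].
  by move: ab; case: (ltP a b) => ?; [rewrite ltr0_norm|rewrite ger0_norm]; lra.
move=> y yx i j ij; rewrite /chart_of.
have y1 l : `|(y l).1 - (x l).1| < e.
  by apply: le_lt_trans (yx l); rewrite prod_normE /= le_max lexx.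
have y2 l : `|(y l).2 - (x l).2| < e.
  by apply: le_lt_trans (yx l); rewrite prod_normE /= le_max lexx orbT.
case: ifPn => [xij|/negPn/eqP xij].
  have := ord _ _ _ _ (He1 (i, j) xij) (y1 i) (y1 j).
  by case: ((x i).1 < (x j).1) => /= yij; rewrite /lexlt yij.
have xij2 : (x i).2 != (x j).2.
  apply: contra_neq ij => xij2; apply: xI.
  by case: (x i) (x j) xij xij2 => [? ?] [? ?] /= -> ->.
by have := ord _ _ _ _ (He2 (i, j) xij2) (y2 i) (y2 j); case: ifP.
Unshelve. all: by end_near. Qed.

End ConvexCharts.

Section Segments.
Variables (R : realType) (M : topologicalType) (h : M -> R * R) (k : R * R -> M).
Hypotheses (h_continuous : continuous h) (h_neq0 : forall p, h p != 0)
  (hK : cancel h k) (kK : forall z : R * R, z != 0 -> h (k z) = z)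
  (k_continuous : forall z : R * R, z != 0 -> {for z, continuous k}).
Local Notation X := (unordered_conf_space 3 M).
Local Notation I := (unit_interval R).
Variable w0 : conf_space 3 M.
Local Notation mk := (mk kK w0).
Variables (G : groupType) (F : path_functor R X G).
Implicit Types x y z : cfg R.

Section Seg.
Variables y z : cfg R.
Hypothesis yz : exists c, chart c y /\ chart c z.

Definition seg_fun (t : I) : X := mk (lin y z (valI t)).

Lemma seg_continuous : continuous seg_fun.
Proof.
have [c [cy cz]] := yz; apply: mk_continuous => // [i|t].
  apply: lin_pt_continuous; [exact: cst_continuous|exact: cst_continuous|].
  exact: valI_continuous.
by apply: (@chart_inj _ c); apply: chart_lin; rewrite ?valI_ge0 ?valI_le1.
Qed.

Lemma seg_zero : seg_fun zero = mk y.
Proof. by rewrite /seg_fun valI0 lin0. Qed.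

Lemma seg_one : seg_fun one = mk z.
Proof. by rewrite /seg_fun valI1 lin1. Qed.

Definition seg : {path I from mk y to mk z in X} := mk_path seg_continuous seg_zero seg_one.

Lemma segE t : seg t = mk (lin y z (valI t)). Proof. by []. Qed.

End Seg.

(** The value 1 is a default for configurations that share no chart. *)
Definition seg_val y z : G :=
  if pselect (exists c, chart c y /\ chart c z) is left yz then F _ _ (seg yz) else 1%g.

Lemma seg_valE y z (yz : exists c, chart c y /\ chart c z) : seg_val y z = F _ _ (seg yz).
Proof. by rewrite /seg_val; case: pselect => // yz'; apply: eq_pf. Qed.

(** By convexity of the chart, the straight-line homotopy between the two lifts stays injective. *)
Lemma chart_path_eq c (f g : I -> cfg R) a b a' b' (p : {path I from a to b in X})
    (q : {path I from a' to b' in X}) :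
  (forall i, continuous (fun t => f t i)) -> (forall i, continuous (fun t => g t i)) ->
  (forall t, chart c (f t)) -> (forall t, chart c (g t)) ->
  f zero = g zero -> f one = g one ->
  (forall t, p t = mk (f t)) -> (forall t, q t = mk (g t)) -> F _ _ p = F _ _ q.
Proof.
move=> cf cg Cf Cg fg0 fg1 pE qE.
have aa : a = a'.
  by rewrite -(@path_zero _ _ _ _ p) -(@path_zero _ _ _ _ q) pE qE fg0.
have bb : b = b'.
  by rewrite -(@path_one _ _ _ _ p) -(@path_one _ _ _ _ q) pE qE fg1.
subst a' b'; apply: pf_homotopic.
exists (fun ts => mk (lin (f ts.1) (g ts.1) (valI ts.2))); split.
- apply: mk_continuous => // [i|ts].
    have c1 (e : I -> cfg R) : (forall i, continuous (fun t => e t i)) ->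
        continuous (fun ts : I * I => e ts.1 i).
      move=> ce; apply: (@continuous_compT _ _ _ fst (fun t => e t i)) => // ts.
      exact: cvg_fst.
    apply: lin_pt_continuous; [exact: c1|exact: c1|].
    by apply: continuous_valI => ts; exact: cvg_snd.
  by apply: (@chart_inj _ c); apply: chart_lin; rewrite ?valI_ge0 ?valI_le1.
- by move=> t /=; rewrite valI0 lin0.
- by move=> t /=; rewrite valI1 lin1.
- move=> s /=; rewrite fg0 (_ : lin _ _ _ = g zero).
    by rewrite -qE path_zero.
  by apply/funext => i; exact: lin_pt_id.
- move=> s /=; rewrite fg1 (_ : lin _ _ _ = g one).
    by rewrite -qE path_one.
  by apply/funext => i; exact: lin_pt_id.
Qed.

Lemma chart_path c (f : I -> cfg R) a b (p : {path I from a to b in X}) :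
  (forall i, continuous (fun t => f t i)) -> (forall t, chart c (f t)) ->
  (forall t, p t = mk (f t)) -> F _ _ p = seg_val (f zero) (f one).
Proof.
move=> cf Cf pE; have fz : exists c, chart c (f zero) /\ chart c (f one) by exists c.
rewrite (seg_valE fz).
apply: (@chart_path_eq c f (fun t => lin (f zero) (f one) (valI t))) => //.
- move=> i; apply: lin_pt_continuous; [exact: cst_continuous|exact: cst_continuous|].
  exact: valI_continuous.
- by move=> t; apply: chart_lin; rewrite ?valI_ge0 ?valI_le1.
- by rewrite valI0 lin0.
- by rewrite valI1 lin1.
Qed.

Lemma seg_val_trans c x y z : chart c x -> chart c y -> chart c z ->
  (seg_val x y * seg_val y z)%g = seg_val x z.
Proof.
move=> cx cy cz.
have xy : exists c, chart c x /\ chart c y by exists c.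
have yz : exists c, chart c y /\ chart c z by exists c.
rewrite (seg_valE xy) (seg_valE yz) -pf_cat.
pose f (t : I) := if valI t <= 2^-1 then lin x y (valI (clampI (2 * valI t)))
                  else lin y z (valI (clampI (2 * valI t - 1))).
rewrite (@chart_path c f).
- rewrite /f valI0 ifT ?invr_ge0 // mulr0 -/zero valI0 lin0 valI1 ifF; last first.
    by apply/negP; lra.
  by rewrite mulr1 (_ : 2 - 1 = 1) -/one ?valI1 ?lin1 //; lra.
- move=> i; rewrite (_ : (fun _ => _) = fun t => if valI t <= 2^-1 :> R
      then lin x y (valI (clampI (2 * valI t))) i
      else lin y z (valI (clampI (2 * valI t - 1))) i); last first.
    by apply/funext => t; rewrite /f; case: ifP.
  apply: (@paste_continuous R); first exact: valI_continuous.
  + apply: lin_pt_continuous; [exact: cst_continuous|exact: cst_continuous|].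
    exact/continuous_valI/continuous_clampI/continuous_mull/valI_continuous.
  + apply: lin_pt_continuous; [exact: cst_continuous|exact: cst_continuous|].
    exact/continuous_valI/continuous_clampI/continuous_sub1/continuous_mull/valI_continuous.
  + move=> t ->; rewrite divff ?pnatr_eq0 // subrr -/one -/zero valI0 valI1.
    by rewrite lin0 lin1.
- by move=> t; rewrite /f; case: ifP => _; apply: chart_lin; rewrite ?valI_ge0 ?valI_le1.
- by move=> t; rewrite path_catE /f; case: ifP.
Qed.

Lemma seg_val_id c x : chart c x -> seg_val x x = 1%g.
Proof.
by move=> cx; apply: (mulgI (seg_val x x)); rewrite (@seg_val_trans c) // mulg1.
Qed.

Lemma seg_val_sym c x y : chart c x -> chart c y -> seg_val y x = (seg_val x y)^-1%g.
Proof.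
move=> cx cy; apply: (mulgI (seg_val x y)).
by rewrite (@seg_val_trans c) // (seg_val_id cx) mulgV.
Qed.

Lemma seg_val_perm (s : 'S_4) x y c : s ord0 = ord0 -> chart c x -> chart c y ->
  seg_val (x \o s) (y \o s) = seg_val x y.
Proof.
move=> s0 cx cy; have xy : exists c, chart c x /\ chart c y by exists c.
have xys : exists c, chart c (x \o s) /\ chart c (y \o s).
  by exists (fun i j => c (s i) (s j)); split=> i j ij; [apply: cx|apply: cy];
     rewrite (inj_eq (@perm_inj _ s)).
rewrite (seg_valE xys) (seg_valE xy); apply: eq_pf => t; rewrite !segE.
rewrite -(@mk_perm _ _ _ _ kK w0 (lin x y (valI t)) s) //.
by apply: (@chart_inj _ c); apply: chart_lin; rewrite ?valI_ge0 ?valI_le1.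
Qed.

(** The translations at the two ends may differ, since at each time [mk] forgets the interpolated
    translation. *)
Lemma seg_val_translate x y u v c : chart c x -> chart c y ->
  seg_val (fun i => x i + u) (fun i => y i + v) = seg_val x y.
Proof.
move=> cx cy; have xy : exists c, chart c x /\ chart c y by exists c.
have ct z a : chart c z -> chart c (fun i => z i + a).
  move=> cz i j ij; have := cz i j ij; case: (c i j) => [[] []];
  by rewrite /= /lexlt /= ?(inj_eq (addIr _)) ?ltrD2r.
have xyt : exists c, chart c (fun i => x i + u) /\ chart c (fun i => y i + v).
  by exists c; split; exact: ct.
rewrite (seg_valE xyt) (seg_valE xy); apply: eq_pf => t; rewrite !segE.
rewrite -(@mk_translate _ _ _ _ kK w0 (lin x y (valI t)) (lin_pt u v (valI t))).
  by apply: eq_mk => i; rewrite /lin /lin_pt /= !mulrDr addrACA [in X in (_, X)]addrACA.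
by apply: (@chart_inj _ c); apply: chart_lin; rewrite ?valI_ge0 ?valI_le1.
Qed.

(** A short path lifts to a single chart, where its value is that of the segment between its
    ends. *)
Lemma pf_gen_near (S : set G) : is_subgroup S ->
  (forall x, injective x -> exists2 e : R, 0 < e &
    forall y z, near_cfg x e y -> near_cfg x e z -> S (seg_val y z)) ->
  forall a b (p : {path I from a to b in X}), S (F _ _ p).
Proof.
move=> sS Snear; apply: pf_ind => // P.
have PE : \pi_X (repr P) = P by rewrite reprK.
pose x := cfg_of h (repr P).
have xI : injective x by apply: (cfg_of_inj h_neq0 hK).
have [e e0 Se] := Snear x xI; have [d d0 cd] := near_chart xI.
have ed0 : 0 < Num.min e d by rewrite lt_min e0 d0.
have [U [L [PU UL]]] := mk_local_section h_continuous h_neq0 hK kK w0 (repr P) ed0.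
exists U; first by rewrite -PE.
have nearP Q : U Q -> near_cfg x e (L Q) /\ near_cfg x d (L Q).
  by move=> /UL[_ _ nx _]; split=> i; apply: lt_le_trans (nx i) _; rewrite ge_min lexx ?orbT.
move=> a b p pU; rewrite (@chart_path (chart_of x) (fun t => L (p t))).
- by apply: Se; have [] := nearP _ (pU zero); have [] := nearP _ (pU one).
- move=> i t; apply: (@continuous_comp _ _ _ p (fun Q => L Q i)).
    exact: cts_fun.
  by have [_ _ _] := UL _ (pU t).
- by move=> t; apply: cd; have [] := nearP _ (pU t).
- by move=> t; have [_ ->] := UL _ (pU t).
Qed.

End Segments.

(** * Half twists and their relations *)

Section Chambers.
Variable R : realType.
Implicit Types (y z : cfg R) (P Q H : 'S_4).

(** The rank of a point is the number of lexicographically smaller ones. *)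
Lemma rank_perm y : injective y ->
  exists P : 'S_4, forall i j, (P i < P j)%N = lexlt (y i) (y j).
Proof.
move=> yI; pose A i := [set j : 'I_4 | lexlt (y j) (y i)]%SET.
have Alt i j : lexlt (y i) (y j) -> (#|A i| < #|A j|)%N.
  move=> ij; apply: proper_card; apply/properP; split.
    by apply/fintype.subsetP => l; rewrite !inE => /lexlt_trans; exact.
  by exists i; rewrite !inE ?lexlt_irr.
have A4 i : (#|A i| < 4)%N.
  rewrite -[X in (_ < X)%N](card_ord 4) -cardsT; apply: proper_card.
  by apply/properP; split; [exact: finset.subsetT|exists i; rewrite !inE ?lexlt_irr].
have Alt' i j : (#|A i| < #|A j|)%N = lexlt (y i) (y j).
  apply/idP/idP => [ij|]; last exact: Alt.
  have : y i != y j by apply: contraTneq ij => /yI ->; rewrite ltnn.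
  case/lexlt_total/orP => // /Alt; rewrite ltnNge => /negP[]; exact: ltnW.
have rI : injective (fun i => Ordinal (A4 i)).
  move=> i j /(congr1 val) /= ij; apply: yI; apply: contrapT => /eqP/lexlt_total.
  by rewrite -!Alt' ij ltnn.
by exists (perm rI) => i j; rewrite !permE /= Alt'.
Qed.

(* A configuration with the prescribed left-to-right ranks [P] and heights [H]. *)
Definition node H P : cfg R := fun i => ((P i)%:R, (H i)%:R).

Lemma lexlt_node H P i j : i != j -> lexlt (node H P i) (node H P j) = (P i < P j)%N.
Proof.
move=> ij; rewrite /lexlt /= ltr_nat eqr_nat; case: eqVneq => [/val_inj/perm_inj/eqP|_].
  by rewrite (negbTE ij).
by rewrite orbF.
Qed.

Definition sw (j : nat) : 'S_4 := tperm (inord j) (inord j.+1).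

(** A transposition of numbers instead of ordinals, so that the braid and commutation identities are
    decided by [lia]. *)
Definition swn (j k : nat) : nat := if k == j then j.+1 else if k == j.+1 then j else k.

Lemma swn_spec j l : (l = j /\ swn j l = j.+1) \/ (l = j.+1 /\ swn j l = j) \/
  (l <> j /\ l <> j.+1 /\ swn j l = l).
Proof. by rewrite /swn; case: eqP => [->|nj]; [left|case: eqP; [right; left|right; right]]. Qed.

Lemma swn_braid j l : swn j (swn j.+1 (swn j l)) = swn j.+1 (swn j (swn j.+1 l)).
Proof.
have := swn_spec j l; have := swn_spec j.+1 (swn j l).
have := swn_spec j (swn j.+1 (swn j l)); have := swn_spec j.+1 l.
have := swn_spec j (swn j.+1 l); have := swn_spec j.+1 (swn j (swn j.+1 l)).
lia.
Qed.

Lemma swn_far l : swn 2 (swn 0 l) = swn 0 (swn 2 l).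
Proof.
have := swn_spec 0 l; have := swn_spec 2 (swn 0 l).
have := swn_spec 2 l; have := swn_spec 0 (swn 2 l).
lia.
Qed.

Lemma swE j (i : 'I_4) : (j < 3)%N -> sw j i = swn j i :> nat.
Proof.
move=> j3; rewrite /sw /swn.
have j0 : (inord j : 'I_4) = j :> nat by rewrite inordK // ltnW.
have j1 : (inord j.+1 : 'I_4) = j.+1 :> nat by rewrite inordK.
case: tpermP => [->|->|/eqP + /eqP]; rewrite ?j0 ?j1 ?eqxx //.
  by rewrite gtn_eqF.
by rewrite -!val_eqE /= j0 j1 => /negbTE -> /negbTE ->.
Qed.

Lemma swn_lt j i l : i != l -> (i, l) != (j, j.+1) -> (l, i) != (j, j.+1) ->
  (swn j i < swn j l)%N = (i < l)%N.
Proof.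
rewrite !xpair_eqE /swn.
by do ![case: eqP]; move=> *; subst; lia.
Qed.

End Chambers.

Section Generators.
Variables (R : realType) (M : topologicalType) (h : M -> R * R) (k : R * R -> M).
Hypotheses (h_continuous : continuous h) (h_neq0 : forall p, h p != 0)
  (hK : cancel h k) (kK : forall z : R * R, z != 0 -> h (k z) = z)
  (k_continuous : forall z : R * R, z != 0 -> {for z, continuous k}).
Local Notation X := (unordered_conf_space 3 M).
Variable w0 : conf_space 3 M.
Variables (G : groupType) (F : path_functor R X G).
Local Notation E := (seg_val kK k_continuous w0 F).
Local Notation node := (node R).
Implicit Types (y z : cfg R) (P Q H : 'S_4).

(** This hypothesis and the next one fix a gauge; [trivialized_chamber] and [trivialized_over] show
    that every functor can be brought to it. *)
Hypothesis chamber_trivial : forall y z, injective y -> injective z ->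
  (forall i j, lexlt (y i) (y j) = lexlt (z i) (z j)) -> E y z = 1%g.

Hypothesis over_trivial : forall y z, injective y -> injective z ->
  (forall i j, i != ord0 -> j != ord0 -> lexlt (y i) (y j) = lexlt (z i) (z j)) ->
  (forall i, i != ord0 -> (y ord0).2 < (y i).2 /\ (z ord0).2 < (z i).2) -> E y z = 1%g.

Definition heights H : 'I_4 -> 'I_4 -> bool * bool := fun i j => (false, (H i < H j)%N).

Lemma node_chart H P : chart (heights H) (node H P).
Proof.
move=> i j ij; rewrite /heights; case: ltnP => /= Hij; rewrite ltr_nat //.
by rewrite ltn_neqAle Hij andbT; apply: contra_neq ij => /val_inj/perm_inj.
Qed.

Lemma node_inj H P : injective (node H P).
Proof. exact: chart_inj (node_chart H P). Qed.

(* The half twist exchanging the points of ranks [j] and [j.+1], the left one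
   passing below the right one. *)
Definition twist P j := E (node P P) (node P (P * sw j)%g).

Lemma adjacent_swap j P i l : (j < 3)%N -> i != l ->
  (P i : nat, P l : nat) != (j, j.+1) -> (P l : nat, P i : nat) != (j, j.+1) ->
  ((P * sw j)%g i < (P * sw j)%g l)%N = (P i < P l)%N.
Proof.
move=> j3 il ij lj; rewrite !permM !swE // swn_lt //.
by apply: contra_neq il => /val_inj/perm_inj.
Qed.

(** In a chart that compares [a] and [b] by height and all other pairs lexicographically, the move
    factors through the standard twist; the two outer segments stay in a chamber. *)
Lemma twist_eq P j a b y z : (j < 3)%N -> P a = j :> nat -> P b = j.+1 :> nat ->
  injective y -> injective z ->
  (forall i l, lexlt (y i) (y l) = (P i < P l)%N) ->
  (forall i l, lexlt (z i) (z l) = ((P * sw j)%g i < (P * sw j)%g l)%N) ->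
  (y a).2 < (y b).2 -> (z a).2 < (z b).2 ->
  E y z = twist P j.
Proof.
move=> j3 Pa Pb yI zI yP zP yab zab.
have ab : a != b by apply/eqP => ab; move: Pb; rewrite -ab Pa => /eqP; lia.
pose c (i l : 'I_4) := if (i, l) == (a, b) then (false, true)
  else if (i, l) == (b, a) then (false, false) else (true, (P i < P l)%N).
have charts (x : cfg R) : injective x -> (x a).2 < (x b).2 ->
    (forall i l, (i, l) != (a, b) -> (i, l) != (b, a) -> lexlt (x i) (x l) = (P i < P l)%N) ->
    chart c x.
  move=> xI xab xP i l il; rewrite /c.
  case: ifPn => [/eqP[-> ->] //|n1]; case: ifPn => [/eqP[-> ->] //|n2].
  have : x i != x l by apply: contra_neq il; exact: xI.
  by rewrite -xP // => /lexlt_total; case lt_il: (lexlt (x i) (x l)).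
have swP i l : (i, l) != (a, b) -> (i, l) != (b, a) ->
    ((P * sw j)%g i < (P * sw j)%g l)%N = (P i < P l)%N.
  move=> n1 n2; have [->|il] := eqVneq i l; first by rewrite !ltnn.
  apply: adjacent_swap => //.
  - apply: contra_neq n1 => -[ij lj]; congr (_, _); apply: (@perm_inj _ P); apply: val_inj => /=.
      by rewrite ij Pa.
    by rewrite lj Pb.
  - apply: contra_neq n2 => -[lj ij]; congr (_, _); apply: (@perm_inj _ P); apply: val_inj => /=.
      by rewrite ij Pb.
    by rewrite lj Pa.
have nodeP Q : forall i l, lexlt (node P Q i) (node P Q l) = (Q i < Q l)%N.
  by move=> i l; have [->|il] := eqVneq i l; rewrite ?lexlt_irr ?ltnn // lexlt_node.
have hab : (P a)%:R < (P b)%:R :> R by rewrite ltr_nat Pa Pb.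
have cy : chart c y by apply: charts.
have cz : chart c z by apply: charts => // i l n1 n2; rewrite zP swP.
have cn : chart c (node P P) by apply: charts => //; exact: node_inj.
have cn' : chart c (node P (P * sw j)%g).
  by apply: charts => //; [exact: node_inj|move=> i l n1 n2; rewrite nodeP swP].
rewrite -(seg_val_trans kK k_continuous w0 F cy cn cz).
rewrite -(seg_val_trans kK k_continuous w0 F cn cn' cz).
rewrite (chamber_trivial yI (@node_inj _ _)) ?mul1g; last by move=> i l; rewrite nodeP.
rewrite [E (node P (P * sw j)%g) z]chamber_trivial ?mulg1 //; first exact: node_inj.
by move=> i l; rewrite nodeP zP.
Qed.
Arguments twist_eq P j a b {y z}.

Lemma twist_node P j H a b : (j < 3)%N -> P a = j :> nat -> P b = j.+1 :> nat ->
  (H a < H b)%N -> E (node H P) (node H (P * sw j)%g) = twist P j.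
Proof.
move=> j3 Pa Pb Hab; apply: (twist_eq P j a b) => //; try exact: node_inj.
- by move=> i l; have [->|il] := eqVneq i l; rewrite ?lexlt_irr ?ltnn // lexlt_node.
- by move=> i l; have [->|il] := eqVneq i l; rewrite ?lexlt_irr ?ltnn // lexlt_node.
- by rewrite ltr_nat.
- by rewrite ltr_nat.
Qed.

Lemma twist_state P Q j : P ord0 = Q ord0 -> twist P j = twist Q j.
Proof.
move=> PQ0.
have [s s0 sP] : exists2 s : 'S_4, s ord0 = ord0 & forall i, P (s i) = Q i.
  by exists (Q * P^-1)%g => [|i]; rewrite permM ?permKV // -PQ0 permK.
rewrite /twist -(seg_val_perm kK k_continuous w0 F s0 (node_chart _ _) (node_chart _ _)).
by congr (E _ _); apply/funext => i; rewrite /node /= ?permM sP.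
Qed.

(* A twist only depends on the rank [i] of the puncture. *)
Definition gen (i j : nat) := twist (tperm ord0 (inord i)) j.

Lemma twist_gen P j : twist P j = gen (P ord0) j.
Proof. by apply: twist_state; rewrite tpermL inord_val. Qed.

Lemma gen_node j P H a b i : (j < 3)%N -> P a = j :> nat -> P b = j.+1 :> nat ->
  (H a < H b)%N -> P ord0 = i :> nat ->
  E (node H P) (node H (P * sw j)%g) = gen i j.
Proof. by move=> j3 Pa Pb Hab <-; rewrite (twist_node j3 Pa Pb Hab) twist_gen. Qed.

Lemma node_trans H P Q Q' :
  (E (node H P) (node H Q) * E (node H Q) (node H Q') = E (node H P) (node H Q'))%g.
Proof. by apply: (seg_val_trans kK k_continuous w0 F); exact: node_chart. Qed.

Lemma perm_val_ex (i : nat) : (i < 4)%N -> exists P : 'S_4, P ord0 = i :> nat.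
Proof. by move=> i4; exists (tperm ord0 (inord i)); rewrite tpermL inordK. Qed.

Lemma rank_ex P (j : nat) : (j < 4)%N -> exists a, P a = j :> nat.
Proof. by move=> j4; exists ((P^-1)%g (Ordinal j4)); rewrite permKV. Qed.

(** Keeping the heights fixed and equal to the initial ranks puts all six orderings of three
    adjacent points into one convex chart, so both ways of reversing them have the value of the
    direct segment. The first index follows the rank of the puncture. *)
Lemma gen_hexagon (i j : nat) : (i < 4)%N -> (j < 2)%N ->
  (gen i j * gen (swn j i) j.+1 * gen (swn j.+1 (swn j i)) j =
   gen i j.+1 * gen (swn j.+1 i) j * gen (swn j (swn j.+1 i)) j.+1)%g.
Proof.
move=> i4 j2; have [P P0] := perm_val_ex i4.
have j3 : (j < 3)%N by exact: ltnW.
have j13 : (j.+1 < 3)%N by [].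
have [a Pa] : exists a, P a = j :> nat by apply: rank_ex; lia.
have [b Pb] : exists b, P b = j.+1 :> nat by apply: rank_ex; lia.
have [c Pc] : exists c, P c = j.+2 :> nat by apply: rank_ex; lia.
have swP (Q : 'S_4) l n : (l < 3)%N -> (Q * sw l)%g n = swn l (Q n) :> nat.
  by move=> l3; rewrite permM swE.
rewrite -(@gen_node j P P a b i) ?Pa ?Pb //.
rewrite -(@gen_node j.+1 (P * sw j)%g P a c) ?swP ?Pa ?Pc ?P0 //; try by case: (j) j2 => [|[|]].
rewrite -(@gen_node j (P * sw j * sw j.+1)%g P b c) ?swP ?Pb ?Pc ?P0 //; try by case: (j) j2 => [|[|]].
rewrite -(@gen_node j.+1 P P b c i) ?Pb ?Pc //.
rewrite -(@gen_node j (P * sw j.+1)%g P a c) ?swP ?Pa ?Pc ?P0 //; try by case: (j) j2 => [|[|]].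
rewrite -(@gen_node j.+1 (P * sw j.+1 * sw j)%g P a b) ?swP ?Pa ?Pb ?P0 //; try by case: (j) j2 => [|[|]].
rewrite !node_trans; congr (E _ (node _ _)); apply/permP => n; apply: val_inj.
by rewrite /= !swP // swn_braid.
Qed.

(** As for the hexagon, with two disjoint exchanges in place of a reversal. *)
Lemma gen_square (i : nat) : (i < 4)%N ->
  (gen i 0 * gen (swn 0 i) 2 = gen i 2 * gen (swn 2 i) 0)%g.
Proof.
move=> i4; have [P P0] := perm_val_ex i4.
have [a Pa] : exists a, P a = 0%N :> nat by apply: rank_ex.
have [b Pb] : exists b, P b = 1%N :> nat by apply: rank_ex.
have [c Pc] : exists c, P c = 2%N :> nat by apply: rank_ex.
have [d Pd] : exists d, P d = 3%N :> nat by apply: rank_ex.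
have swP (Q : 'S_4) l n : (l < 3)%N -> (Q * sw l)%g n = swn l (Q n) :> nat.
  by move=> l3; rewrite permM swE.
rewrite -(@gen_node 0 P P a b i) ?Pa ?Pb //.
rewrite -(@gen_node 2 (P * sw 0)%g P c d) ?swP ?Pd ?Pc ?P0 //.
rewrite -(@gen_node 2 P P c d i) ?Pd ?Pc //.
rewrite -(@gen_node 0 (P * sw 2)%g P a b) ?swP ?Pa ?Pb ?P0 //.
rewrite !node_trans; congr (E _ (node _ _)); apply/permP => n; apply: val_inj.
by rewrite /= !swP // swn_far.
Qed.

(** The puncture is the left point of the exchange; with heights given by the labels it lies below
    all others throughout. *)
Lemma gen_over j : (j < 3)%N -> gen j j = 1%g.
Proof.
move=> j3; have j4 : (j < 4)%N := ltnW j3.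
pose P : 'S_4 := tperm ord0 (inord j); have P0 : P ord0 = j :> nat by rewrite tpermL inordK.
have [b Pb] := @rank_ex P j.+1 j3.
have b0 : b != ord0.
  by apply/eqP => b0; move: Pb; rewrite b0 P0 => /eqP; lia.
have H0b : ((1%g : 'S_4) ord0 < (1%g : 'S_4) b)%N by rewrite !perm1 lt0n.
rewrite -(gen_node j3 P0 Pb H0b P0); apply: over_trivial; try exact: node_inj.
  move=> i l i0 l0; have [->|il] := eqVneq i l; first by rewrite !lexlt_irr.
  rewrite !lexlt_node // adjacent_swap //; apply/eqP => -[].
    by rewrite -P0 => /val_inj/perm_inj /eqP; rewrite (negbTE i0).
  by rewrite -P0 => /val_inj/perm_inj /eqP; rewrite (negbTE l0).
by move=> i i0; rewrite /= !perm1 ltr0n lt0n.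
Qed.

(** Of the twelve [gen i j], the three with [i = j] are trivial by [gen_over]; hexagons and squares
    express the remaining ones through these three. *)
Definition s1 := gen 0 1.
Definition s2 := gen 0 2.
Definition rho := gen 1 0.

Lemma gen20 : gen 2 0 = s1.
Proof.
have : (gen 0 0 * gen 1 1 * gen 2 0 = gen 0 1 * gen 0 0 * gen 1 1)%g := @gen_hexagon 0 0 isT isT.
by rewrite !gen_over // !mul1g !mulg1.
Qed.

Lemma gen12 : gen 1 2 = s2.
Proof.
have : (gen 0 0 * gen 1 2 = gen 0 2 * gen 0 0)%g := @gen_square 0 isT.
by rewrite !gen_over // mul1g mulg1.
Qed.

Lemma gen30 : gen 3 0 = s1.
Proof.
have : (gen 2 0 * gen 2 2 = gen 2 2 * gen 3 0)%g := @gen_square 2 isT.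
by rewrite !gen_over // mul1g mulg1 gen20.
Qed.

Lemma gen31 : gen 3 1 = s2.
Proof.
have : (gen 1 1 * gen 2 2 * gen 3 1 = gen 1 2 * gen 1 1 * gen 2 2)%g := @gen_hexagon 1 1 isT isT.
by rewrite !gen_over // !mul1g !mulg1 gen12.
Qed.

Lemma gen21 : gen 2 1 = (s1^-1 * rho * s1)%g.
Proof.
have : (gen 1 0 * gen 0 1 * gen 0 0 = gen 1 1 * gen 2 0 * gen 2 1)%g := @gen_hexagon 1 0 isT isT.
rewrite !gen_over // mulg1 mul1g gen20 => H.
by rewrite -mulgA [(rho * s1)%g]H mulKg.
Qed.

Lemma gen32 : gen 3 2 = (s2^-1 * gen 2 1 * s2)%g.
Proof.
have : (gen 2 1 * gen 1 2 * gen 1 1 = gen 2 2 * gen 3 1 * gen 3 2)%g := @gen_hexagon 2 1 isT isT.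
rewrite !gen_over // mulg1 mul1g gen12 gen31 => H.
by rewrite -mulgA H mulKg.
Qed.

Lemma braid_s1_s2 : (s1 * s2 * s1 = s2 * s1 * s2)%g.
Proof. exact: (@gen_hexagon 0 1 isT isT). Qed.

Lemma braid_rho_s2 : (rho * s2 = s2 * rho)%g.
Proof.
have : (gen 1 0 * gen 0 2 = gen 1 2 * gen 1 0)%g := @gen_square 1 isT.
by rewrite gen12.
Qed.

Lemma braid_rho_s1 : (s1 * rho * s1 * rho = rho * s1 * rho * s1)%g.
Proof.
have : (gen 2 0 * gen 2 1 * rho = gen 2 1 * rho * s1)%g := @gen_hexagon 2 0 isT isT.
rewrite gen20 gen21 => /(congr1 (fun g => s1 * g)%g).
by rewrite !mulgA mulgK mulgV mul1g.
Qed.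

Lemma twist_subgroup (S : set G) : is_subgroup S -> S s1 -> S s2 -> S rho ->
  forall P j, (j < 3)%N -> S (twist P j).
Proof.
move=> [S1 SM SV] Ss1 Ss2 Sr P j j3; rewrite twist_gen.
have S21 : S (gen 2 1) by rewrite gen21; apply: (SM _ _ (SM _ _ (SV _ Ss1) Sr) Ss1).
have S32 : S (gen 3 2) by rewrite gen32; apply: (SM _ _ (SM _ _ (SV _ Ss2) S21) Ss2).
have i4 := ltn_ord (P ord0); move: (nat_of_ord (P ord0)) i4 => i i4.
case: (eqVneq i j) => [->|]; first by rewrite gen_over.
by case: i i4 => [|[|[|[|//]]]] _; case: j j3 => [|[|[|//]]] _ // _;
  rewrite ?gen20 ?gen12 ?gen30 ?gen31.
Qed.

Section Generation.
Variables (S : set G) (sS : is_subgroup S).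
Hypotheses (Ss1 : S s1) (Ss2 : S s2) (Srho : S rho).

Definition inversions (x y : cfg R) : {set 'I_4 * 'I_4} :=
  [set ab | lexlt (x ab.1) (x ab.2) && lexlt (y ab.2) (y ab.1)]%SET.

(** Take an inversion with the fewest points between its members in [y]. A further point between
    them would form with one of them an inversion with fewer. *)
Lemma adjacent_inversion x y : injective x -> injective y -> inversions x y != finset.set0 ->
  exists2 ab, ab \in inversions x y &
    forall c, ~~ (lexlt (y ab.2) (y c) && lexlt (y c) (y ab.1)).
Proof.
move=> xI yI /finset.set0Pn[ab0 ab0i].
pose between (ab : 'I_4 * 'I_4) := #|[set c | lexlt (y ab.2) (y c) && lexlt (y c) (y ab.1)]%SET|.
case: (arg_minnP between ab0i) => -[a b] abi minab; exists (a, b) => // c; apply/negP => /= /andP[bc ca].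
have : (a, b) \in inversions x y by [].
rewrite inE /= => /andP[xab yba].
have cb : x c != x b by apply: contraTneq bc => /xI ->; rewrite lexlt_irr.
have smaller a' b' : (a', b') \in inversions x y ->
    (forall d, lexlt (y b') (y d) && lexlt (y d) (y a') -> lexlt (y b) (y d) && lexlt (y d) (y a)) ->
    ~~ (lexlt (y b') (y c) && lexlt (y c) (y a')) -> False.
  move=> i' sub nc; have := minab _ i'; rewrite leqNgt => /negP[].
  apply: proper_card; apply/properP; split.
    by apply/fintype.subsetP => d; rewrite !inE /=; exact: sub.
  by exists c; rewrite inE /= ?bc ?ca.
case/orP: (lexlt_total cb) => [xcb|xbc].
  apply: (smaller c b); first by rewrite inE /= xcb bc.
    by move=> d /andP[-> dc] /=; exact: lexlt_trans dc ca.
  by rewrite lexlt_irr andbF.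
apply: (smaller a c); first by rewrite inE /= (lexlt_trans xab xbc) ca.
  by move=> d /andP[cd ->]; rewrite (lexlt_trans bc cd).
by rewrite lexlt_irr.
Qed.

(** Inside the chart of [x] only points with the same abscissa in [x] can be inverted, and the chart
    fixes their vertical order. As no other point lies between them in [y], exchanging them is a
    single twist. *)
Lemma undo_inversion x y ab : injective x -> chart (chart_of x) x -> chart (chart_of x) y ->
  ab \in inversions x y ->
  (forall c, ~~ (lexlt (y ab.2) (y c) && lexlt (y c) (y ab.1))) ->
  exists y', [/\ chart (chart_of x) y', (#|inversions x y'| < #|inversions x y|)%N & S (E y' y)].
Proof.
case: ab => a b xI cx cy abi adj.
have yI := chart_inj cy.
have : (a, b) \in inversions x y by []; rewrite inE /= => /andP[xab yba].
have ab : a != b by apply: contraTneq xab => ->; rewrite lexlt_irr.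
have xab1 : (x a).1 = (x b).1.
  apply/eqP/negPn/negP => nab.
  have := cx a b ab; have := cy a b ab; rewrite /chart_of nab.
  by case: (_ < _) => /=; rewrite ?(lexlt_asym xab) ?(lexlt_asym yba).
have xab2 : (x a).2 < (x b).2 by move: xab; rewrite /lexlt xab1 ltxx eqxx.
have yab2 : (y a).2 < (y b).2.
  by have := cy a b ab; rewrite /chart_of xab1 eqxx xab2.
have yba1 : (y b).1 < (y a).1.
  by move: yba; rewrite /lexlt => /orP[//|/andP[_]]; rewrite ltNge (ltW yab2).
(* The new abscissas divide the interval from [b] to [a] into thirds, with [a] now on the left; the
   heights are kept. *)
pose m t := (1 - t) * (y b).1 + t * (y a).1.
pose y' i := if i == a then (m 3^-1, (y a).2) else if i == b then (m (2 / 3), (y b).2) else y i.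
have y'2 i : (y' i).2 = (y i).2 by rewrite /y'; case: eqP => [->//|_]; case: eqP => [->|].
have ba : (b == a) = false by rewrite eq_sym (negbTE ab).
have y'a : y' a = (m 3^-1, (y a).2) by rewrite /y' eqxx.
have y'b : y' b = (m (2 / 3), (y b).2) by rewrite /y' ba eqxx.
have y'o i : i != a -> i != b -> y' i = y i by rewrite /y' => /negbTE -> /negbTE ->.
have m3 (t : R) : 0 < t < 1 -> (y b).1 < m t < (y a).1.
  move=> /andP[t0 t1].
  have e1 : 0 < t * ((y a).1 - (y b).1) by rewrite mulr_gt0 // subr_gt0.
  have e2 : 0 < (1 - t) * ((y a).1 - (y b).1) by rewrite mulr_gt0 // subr_gt0.
  by rewrite /m; apply/andP; split; lra.
have [lt_ba lt_aa] : lexlt (y b) (y' a) /\ lexlt (y' a) (y a).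
  have /andP[? ?] : (y b).1 < m 3^-1 < (y a).1 by apply: m3; lra.
  by rewrite y'a; split; apply/orP; left.
have [lt_bb lt_ab] : lexlt (y b) (y' b) /\ lexlt (y' b) (y a).
  have /andP[? ?] : (y b).1 < m (2 / 3) < (y a).1 by apply: m3; lra.
  by rewrite y'b; split; apply/orP; left.
have lt'ab : lexlt (y' a) (y' b).
  by rewrite y'a y'b /lexlt /= /m; apply/orP; left; lra.
have sideP c : c != a -> c != b -> lexlt (y c) (y b) \/ lexlt (y a) (y c).
  move=> ca cb; have := adj c; rewrite negb_and => /orP[bc|ca'].
    left; have : y c != y b by apply: contra_neq cb; exact: yI.
    by move/lexlt_total; rewrite (negbTE bc) orbF.
  right; have : y c != y a by apply: contra_neq ca; exact: yI.
  by move/lexlt_total; rewrite (negbTE ca').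
(* Positions between [y b] and [y a], ends included, all compare alike with every third point. *)
pose btw v := ((v == y b) || lexlt (y b) v) && ((v == y a) || lexlt v (y a)).
have outP c v w : c != a -> c != b -> btw v -> btw w ->
    (lexlt (y c) v = lexlt (y c) w) * (lexlt v (y c) = lexlt w (y c)).
  move=> ca cb /andP[bv va] /andP[bw wa]; have [clt|clt] := sideP c ca cb.
    have lo u : (u == y b) || lexlt (y b) u -> lexlt (y c) u.
      by move=> /orP[/eqP ->//|]; exact: lexlt_trans clt.
    by rewrite (lo v bv) (lo w bw) !(lexlt_asym (lo _ _)).
  have hi u : (u == y a) || lexlt u (y a) -> lexlt u (y c).
    by move=> /orP[/eqP ->//|] ua; exact: lexlt_trans ua clt.
  by rewrite (hi v va) (hi w wa) !(lexlt_asym (hi _ _)).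
have btw_y i : i \in [:: a; b] -> btw (y i).
  by rewrite /btw !inE => /orP[] /eqP ->; rewrite eqxx ?yba ?orbT.
have btw_y' i : i \in [:: a; b] -> btw (y' i).
  by rewrite /btw !inE => /orP[] /eqP ->; rewrite ?lt_ba ?lt_aa ?lt_bb ?lt_ab !orbT.
have same i j : (i, j) != (a, b) -> (i, j) != (b, a) ->
    lexlt (y' i) (y' j) = lexlt (y i) (y j).
  move=> n1 n2; case: (boolP (i \in [:: a; b])) => iab; case: (boolP (j \in [:: a; b])) => jab.
  - move: iab jab n1 n2; rewrite !inE => /orP[] /eqP -> /orP[] /eqP ->;
      by rewrite ?eqxx // => _ _; rewrite !lexlt_irr.
  - move: (jab); rewrite !inE negb_or => /andP[ja jb].
    by rewrite (y'o j) // (outP j (y' i) (y i)) //; [exact: btw_y'|exact: btw_y].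
  - move: (iab); rewrite !inE negb_or => /andP[ia ib].
    by rewrite (y'o i) // (outP i (y' j) (y j)) //; [exact: btw_y'|exact: btw_y].
  - by move: iab jab; rewrite !inE !negb_or => /andP[ia ib] /andP[ja jb]; rewrite !y'o.
have cy' : chart (chart_of x) y'.
  move=> i j ij; have := cy i j ij; rewrite /chart_of; case: ifPn => nij; last first.
    by case: (_ < _) => /=; rewrite !y'2.
  have n1 : (i, j) != (a, b).
    by apply: contraNneq nij => -[-> ->]; rewrite xab1.
  have n2 : (i, j) != (b, a).
    by apply: contraNneq nij => -[-> ->]; rewrite xab1.
  have n1' : (j, i) != (a, b) by apply: contraNneq n2 => -[-> ->].
  have n2' : (j, i) != (b, a) by apply: contraNneq n1 => -[-> ->].
  by case: (_ < _) => /=; rewrite same.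
have y'I := chart_inj cy'.
exists y'; split => //.
  apply: proper_card; apply/properP; split; last first.
    by exists (a, b); rewrite // inE /= (lexlt_asym lt'ab) andbF.
  apply/fintype.subsetP => -[i j]; rewrite !inE /= => /andP[xij]; rewrite xij /=.
  have [[-> ->]|n1] := eqVneq (i, j) (a, b); first by [].
  have [[ib ja]|n2] := eqVneq (i, j) (b, a).
    by move: xij; rewrite ib ja (lexlt_asym xab).
  rewrite same //; first by apply: contraNneq n2 => -[-> ->].
  by apply: contraNneq n1 => -[-> ->].
have [P PE] := rank_perm y'I.
(* A point of intermediate rank in [y'] would lie between [b] and [a] in [y] as well. *)
have Pab : P b = (P a).+1 :> nat.
  have Plt : (P a < P b)%N by rewrite PE.
  apply/eqP; rewrite eqn_leq Plt andbT leqNgt; apply/negP => gap.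
  have [c Pc] : exists c, P c = (P a).+1 :> nat.
    by apply: rank_ex; apply: leq_trans gap _; exact: ltnW.
  have ac : lexlt (y' a) (y' c) by rewrite -PE Pc.
  have cb : lexlt (y' c) (y' b) by rewrite -PE Pc.
  have ca : c != a by apply: contraTneq ac => ->; rewrite lexlt_irr.
  have cb' : c != b by apply: contraTneq cb => ->; rewrite lexlt_irr.
  move: ac cb; rewrite (y'o c) // !(outP c (y' a) (y a)) ?(outP c (y' b) (y b)) //;
    try by [apply: btw_y; rewrite !inE eqxx ?orbT|apply: btw_y'; rewrite !inE eqxx ?orbT].
  by move=> ac cb; have := adj c; rewrite /=; case: (sideP c ca cb') => lt;
    [rewrite (lexlt_asym (lexlt_trans lt yba)) in ac|rewrite (lexlt_asym (lexlt_trans yba lt)) in cb].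
rewrite (@twist_eq P (P a) a b y' y) ?y'2 //.
- by apply: twist_subgroup; rewrite // -ltnS -Pab.
- by rewrite -ltnS -Pab.
- move=> i l; have [->|il] := eqVneq i l; first by rewrite lexlt_irr ltnn.
  have j3 : (P a < 3)%N by rewrite -ltnS -Pab.
  have Pinj n n' : P n = P n' :> nat -> n = n' by move=> /val_inj/perm_inj.
  have [[-> ->]|n1] := eqVneq (i, l) (a, b).
    by rewrite !permM !swE // Pab /swn eqxx gtn_eqF // eqxx ltnNge leqnSn /= (lexlt_asym yba).
  have [[-> ->]|n2] := eqVneq (i, l) (b, a).
    by rewrite !permM !swE // Pab /swn eqxx gtn_eqF // eqxx ltnSn yba.
  rewrite -same // adjacent_swap ?PE //.
    by apply: contra_neq n1 => -[/Pinj -> ll]; congr (_, _); apply: Pinj; rewrite ll.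
  by apply: contra_neq n2 => -[/Pinj -> ll]; congr (_, _); apply: Pinj; rewrite ll.
Qed.

(** Induction on the number of inversions relative to the centre [x] of a chart; without inversions
    the segment from [x] has value 1 by [chamber_trivial]. *)
Lemma pf_gen (u v : X) (p : {path unit_interval R from u to v in X}) : S (F _ _ p).
Proof.
apply: (@pf_gen_near _ _ _ _ h_continuous h_neq0 hK kK k_continuous w0 _ F _ sS) => x xI.
have [S1 SM SV] := sS; have [e e0 cx] := near_chart xI; exists e => //.
have xx : chart (chart_of x) x by apply: cx => i; rewrite subrr normr0.
have Sx z : chart (chart_of x) z -> S (E x z).
  move: {2}#|inversions x z|%N (leqnn #|inversions x z|) => n.
  elim: n z => [|n IHn] z zn cz.
    rewrite chamber_trivial ?S1 //; first exact: chart_inj cz.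
    have noinv i j : lexlt (x i) (x j) -> lexlt (z i) (z j).
      move=> xij; have zij : z i != z j.
        by apply: contraTneq xij => /(chart_inj cz) ->; rewrite lexlt_irr.
      case/orP: (lexlt_total zij) => // zji.
      move: zn; rewrite leqn0 cards_eq0 => /eqP/setP/(_ (i, j)).
      by rewrite !inE /= xij zji.
    move=> i j; apply/idP/idP; first exact: noinv.
    have [->|ij] := eqVneq i j; first by rewrite !lexlt_irr.
    have : x i != x j by apply: contra_neq ij; exact: xI.
    by case/lexlt_total/orP => // /noinv/lexlt_asym ->.
  have [no|some] := eqVneq (inversions x z) finset.set0.
    by apply: IHn => //; rewrite no cards0.
  have [ab abi adj] := adjacent_inversion xI (chart_inj cz) some.
  have [z' [cz' lt' Sz']] := undo_inversion xI xx cz abi adj.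
  rewrite -(seg_val_trans kK k_continuous w0 F xx cz' cz); apply: SM => //.
  by apply: IHn => //; rewrite -ltnS; exact: leq_trans lt' zn.
move=> y z /cx cy /cx cz.
rewrite -(seg_val_trans kK k_continuous w0 F cy xx cz); apply: SM; last exact: Sx.
by rewrite (seg_val_sym kK k_continuous w0 F xx cy); apply: SV; exact: Sx.
Qed.

End Generation.

End Generators.

Lemma perm_order_id (n : nat) (P : 'S_n) :
  (forall i j, (P i < P j)%N = (i < j)%N) -> P = 1%g.
Proof.
have ge (Q : 'S_n) : (forall i j, (Q i < Q j)%N = (i < j)%N) -> forall i : 'I_n, (i <= Q i)%N.
  move=> QE i; suff H m (mn : (m < n)%N) : (m <= Q (Ordinal mn))%N.
    by case: i => m mn; exact: H.
  elim: m mn => // m IHm mn; apply: leq_ltn_trans (IHm (ltnW mn)) _.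
  by rewrite QE.
move=> PE; apply/permP => i; rewrite perm1; apply/val_inj/eqP; rewrite eqn_leq ge // andbT.
rewrite -{2}(permK P i); apply: ge => a b.
by rewrite -PE !permKV.
Qed.

(** * Sorted lifts and the choice of gauge *)

Section Sorting.
Variable R : realType.
Implicit Types (y z : cfg R) (P : 'S_4).

Definition sorted_cfg y := forall i j : 'I_4, i != ord0 -> j != ord0 ->
  lexlt (y i) (y j) = (i < j)%N.

Definition rank_of y P := forall i j, (P i < P j)%N = lexlt (y i) (y j).

Lemma sort_cfg y : injective y ->
  exists s : 'S_4, s ord0 = ord0 /\ sorted_cfg (y \o s).
Proof.
(* The puncture is moved to the left of all points, so that the sorting permutation fixes its label;
   the order of the other points is unaffected. *)
move=> yI; pose m : R := - (1 + \sum_i `|(y i).1|).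
have my i : m < (y i).1.
  apply: (@lt_le_trans _ _ (- `|(y i).1|)); last by rewrite lerNl -normrN ler_norm.
  rewrite ltrN2 (bigD1 i) //= addrCA ltrDl.
  by apply: ltr_pwDl => //; apply: sumr_ge0.
pose y' i := if i == ord0 then (m, 0) else y i.
have y'o i : i != ord0 -> y' i = y i by rewrite /y' => /negbTE ->.
have lt0 i : i != ord0 -> lexlt (y' ord0) (y' i).
  by move=> i0; rewrite (y'o i) // /y' eqxx /lexlt /= my.
have y'I : injective y'.
  move=> i j; have [->|i0] := eqVneq i ord0; have [->|j0] := eqVneq j ord0 => //.
  - by move=> e; have := lt0 _ j0; rewrite e lexlt_irr.
  - by move=> e; have := lt0 _ i0; rewrite e lexlt_irr.
  - by rewrite !y'o //; exact: yI.
have [P PE] := rank_perm y'I.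
have P0 : P ord0 = ord0.
  apply/eqP/negPn/negP => P0; pose j := (P^-1)%g ord0.
  have j0 : j != ord0 by apply: contra_neq P0 => j0; rewrite -j0 permKV.
  by have := lt0 _ j0; rewrite -PE permKV ltn0.
have s0 : (P^-1)%g ord0 = ord0 by rewrite -{1}P0 permK.
exists (P^-1)%g; split=> // i j i0 j0 /=.
have nz l : l != ord0 -> (P^-1)%g l != ord0.
  by apply: contra_neq => e; rewrite -(permKV P l) e P0.
by rewrite -!y'o ?nz // -PE !permKV.
Qed.

End Sorting.

Section Trivialization.
Variables (R : realType) (M : topologicalType) (h : M -> R * R) (k : R * R -> M).
Hypotheses (h_neq0 : forall p, h p != 0)
  (hK : cancel h k) (kK : forall z : R * R, z != 0 -> h (k z) = z)
  (k_continuous : forall z : R * R, z != 0 -> {for z, continuous k}).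
Local Notation X := (unordered_conf_space 3 M).
Variable w0 : conf_space 3 M.
Local Notation mk := (mk kK w0).
Local Notation node := (node R).
Implicit Types (y z : cfg R) (P : 'S_4).

Definition origin : cfg R := node 1 1.

Lemma sorted_lift (Q : X) : exists yP : cfg R * 'S_4,
  [/\ injective yP.1, mk yP.1 = Q, sorted_cfg yP.1 & rank_of yP.1 yP.2].
Proof.
have [y yI yQ] := mk_surj h_neq0 hK kK w0 Q.
have [s [s0 sy]] := sort_cfg yI; have syI : injective (y \o s) by move=> i j /yI/perm_inj.
have [P PE] := rank_perm syI.
by exists (y \o s, P); split=> //=; rewrite mk_perm.
Qed.

Lemma sorted_lift_unique y z : injective y -> injective z -> mk y = mk z ->
  sorted_cfg y -> sorted_cfg z -> exists v, z = fun i => y i + v.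
Proof.
move=> yI zI /(mk_eq yI zI)[s [v [s0 zE]]] sy sz.
suff s1 : s = 1%g by exists v; rewrite zE s1; apply/funext => i; rewrite perm1.
have nz l : l != ord0 -> s l != ord0.
  by apply: contra_neq => e; apply: (@perm_inj _ s); rewrite s0.
apply: perm_order_id => i j; have [->|i0] := eqVneq i ord0.
  have [->|j0] := eqVneq j ord0; first by rewrite s0.
  by rewrite s0 !lt0n -!val_eqE in j0 *; rewrite j0 (nz j).
have [->|j0] := eqVneq j ord0; first by rewrite s0.
rewrite -(sz i j) // -(sy (s i) (s j)) ?nz // zE.
by rewrite /lexlt /= !ltrD2r (inj_eq (addIr _)).
Qed.

Variables (G : groupType) (F : path_functor R X G).
Local Notation E := (seg_val kK k_continuous w0 F).

(** The intermediate node has the ranks of the lift but the puncture at the bottom: for a sorted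
    lift the first segment lies in [over_chart], the second in one chamber. *)
Definition lift_val (yP : cfg R * 'S_4) : G :=
  (E origin (node 1 yP.2) * E (node 1 yP.2) yP.1)%g.

Definition base_val (Q : X) : G := lift_val (projT1 (cid (sorted_lift Q))).

Lemma rank_chart y P : injective y -> rank_of y P ->
  chart (fun i j => (true, (P i < P j)%N)) y.
Proof.
move=> yI PE i j ij; rewrite PE.
have : y i != y j by apply: contra_neq ij; exact: yI.
by move/lexlt_total; case lt_ij: (lexlt (y i) (y j)).
Qed.

Lemma rank_node H P : rank_of (node H P) P.
Proof. by move=> i j; have [->|ij] := eqVneq i j; rewrite ?lexlt_irr ?ltnn // lexlt_node. Qed.

Lemma rank_of_unique y P P' : rank_of y P -> rank_of y P' -> P = P'.
Proof.
move=> PE P'E; apply: (mulgI (P^-1)%g); rewrite mulVg; apply/esym/perm_order_id => i j.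
by rewrite !permM P'E -PE !permKV.
Qed.

Lemma base_valE y P : injective y -> sorted_cfg y -> rank_of y P ->
  base_val (mk y) = lift_val (y, P).
Proof.
move=> yI sy PE; rewrite /base_val; case: cid => -[z P'] /= [zI zy sz P'E].
have [v yE] := sorted_lift_unique zI yI zy sz sy.
have PP' : P = P'.
  by apply: (rank_of_unique PE) => i j; rewrite P'E yE /lexlt /= !ltrD2r (inj_eq (addIr _)).
rewrite /lift_val /= -PP'; congr (_ * _)%g.
rewrite -[RHS](@seg_val_translate _ _ _ _ kK k_continuous w0 _ F _ _ 0 (-v) (fun i j => (true, (P i < P j)%N))).
- by congr (E _ _); apply/funext => i; rewrite ?addr0 // yE addrK.
- by apply: rank_chart; [exact: node_inj|exact: rank_node].
- exact: rank_chart.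
Qed.

(* Gauging by paths that keep the puncture below the other points, and then stay in
   one chamber, makes all such moves trivial. *)
Definition trivialized := gauge F base_val.
Local Notation E' := (seg_val kK k_continuous w0 trivialized).

Lemma seg_val_trivialized c y z : chart c y -> chart c z ->
  E' y z = (base_val (mk y) * E y z / base_val (mk z))%g.
Proof.
move=> cy cz; have yz : exists c, chart c y /\ chart c z by exists c.
by rewrite !(seg_valE _ _ _ _ yz).
Qed.

Lemma sorted_rank y P : sorted_cfg y -> rank_of y P -> forall i j, i != ord0 -> j != ord0 ->
  (P i < P j)%N = (i < j)%N.
Proof. by move=> sy PE i j i0 j0; rewrite PE sy. Qed.

Definition over_chart (i j : 'I_4) : bool * bool :=
  if (i == ord0) || (j == ord0) then (false, (i < j)%N) else (true, (i < j)%N).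

Lemma over_chart_sorted y : injective y -> sorted_cfg y ->
  (forall i, i != ord0 -> (y ord0).2 < (y i).2) -> chart over_chart y.
Proof.
move=> yI sy y0 i j ij; rewrite /over_chart.
have [i0|i0] := eqVneq i ord0 => /=.
  have j0 : j != ord0 by rewrite -i0 eq_sym.
  by rewrite i0 lt0n -val_eqE /= in j0 *; rewrite j0; apply: y0; rewrite -val_eqE.
have [j0|j0] := eqVneq j ord0 => /=; first by rewrite j0 ltn0; exact: y0.
have : y i != y j by apply: contra_neq ij; exact: yI.
by rewrite -sy // => /lexlt_total; case lt_ij: (lexlt (y i) (y j)).
Qed.

Lemma sorted_node P : (forall i j, i != ord0 -> j != ord0 -> (P i < P j)%N = (i < j)%N) ->
  chart over_chart (node 1 P).
Proof.
move=> Po; apply: over_chart_sorted; first exact: node_inj.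
  by move=> i j i0 j0; rewrite -rank_node Po.
by move=> i i0; rewrite /= !perm1 ltr0n lt0n.
Qed.

(** After relabelling, both ends are sorted lifts with the same ranks, so [lift_val] at [z] is
    [lift_val] at [y] times the value of the segment. *)
Lemma trivialized_chamber y z : injective y -> injective z ->
  (forall i j, lexlt (y i) (y j) = lexlt (z i) (z j)) -> E' y z = 1%g.
Proof.
move=> yI zI yz; have [s [s0 sy]] := sort_cfg yI.
have [Q QE] := rank_perm yI.
have cy : chart (fun i j => (true, (Q i < Q j)%N)) y by apply: rank_chart.
have cz : chart (fun i j => (true, (Q i < Q j)%N)) z.
  by apply: rank_chart => // i j; rewrite -yz.
rewrite -(seg_val_perm kK k_continuous w0 trivialized s0 cy cz).
have syI : injective (y \o s) by move=> i j /yI/perm_inj.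
have szI : injective (z \o s) by move=> i j /zI/perm_inj.
have [P PE] := rank_perm syI.
have sz : sorted_cfg (z \o s) by move=> i j i0 j0; rewrite /= -yz; exact: sy.
have PE' : rank_of (z \o s) P by move=> i j; rewrite PE /= yz.
have cn := rank_chart (@node_inj R 1 P) (@rank_node 1 P).
rewrite (seg_val_trivialized (rank_chart syI PE) (rank_chart szI PE')).
rewrite (base_valE syI sy PE) (base_valE szI sz PE') /lift_val /=.
rewrite -(mulgA (E origin _)) (seg_val_trans kK k_continuous w0 F cn (rank_chart syI PE) (rank_chart szI PE')).
by rewrite mulgV.
Qed.

(** On sorted lifts with the puncture at the bottom, [base_val] is the value of one segment from
    [origin], since everything takes place in [over_chart]. *)
Lemma trivialized_over y z : injective y -> injective z ->
  (forall i j, i != ord0 -> j != ord0 -> lexlt (y i) (y j) = lexlt (z i) (z j)) ->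
  (forall i, i != ord0 -> (y ord0).2 < (y i).2 /\ (z ord0).2 < (z i).2) -> E' y z = 1%g.
Proof.
move=> yI zI yz yz0; have [s [s0 sy]] := sort_cfg yI.
have nz l : l != ord0 -> s l != ord0.
  by apply: contra_neq => e; apply: (@perm_inj _ s); rewrite s0.
have syI : injective (y \o s) by move=> i j /yI/perm_inj.
have szI : injective (z \o s) by move=> i j /zI/perm_inj.
have sz : sorted_cfg (z \o s).
  by move=> i j i0 j0; rewrite /= -yz ?nz //; exact: sy.
have cy : chart over_chart (y \o s).
  by apply: over_chart_sorted => // i i0; rewrite /= s0; case: (yz0 _ (nz _ i0)).
have cz : chart over_chart (z \o s).
  by apply: over_chart_sorted => // i i0; rewrite /= s0; case: (yz0 _ (nz _ i0)).
have tr (x : cfg R) : injective x -> sorted_cfg x -> chart over_chart x ->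
    base_val (mk x) = E origin x.
  move=> xI sx cx; have [P PE] := rank_perm xI.
  rewrite (base_valE xI sx PE) /lift_val /=.
  apply: (seg_val_trans kK k_continuous w0 F _ _ cx).
    by apply: sorted_node => i j; rewrite !perm1.
  by apply: sorted_node; exact: sorted_rank PE.
have corig : chart over_chart origin by apply: sorted_node => i j; rewrite !perm1.
have s'0 : (s^-1)%g ord0 = ord0 by rewrite -{1}s0 permK.
have -> : E' y z = E' (y \o s) (z \o s).
  rewrite -(seg_val_perm kK k_continuous w0 trivialized s'0 cy cz).
  by congr (E' _ _); apply/funext => i; rewrite /= permKV.
rewrite (seg_val_trivialized cy cz) !tr // (seg_val_trans kK k_continuous w0 F corig cy cz).
by rewrite mulgV.
Qed.

End Trivialization.

(** * The model group and the crossing cocycle *)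

(* The coordinates are those on alpha_0, beta_0, u, v, and on sigma, rho_1. *)
Definition N4 : Type := ((int * int) * (int * int))%type.
HB.instance Definition _ := GRing.Zmodule.on N4.
Definition Q2 : Type := (int * int)%type.
HB.instance Definition _ := GRing.Zmodule.on Q2.

Definition sigma_act (x : N4) : N4 :=
  ((- x.1.2, x.1.1 + x.1.2), (- x.2.2, x.2.1 + x.2.2)).

Definition rho_act (x : N4) : N4 :=
  ((x.1.1 - x.2.1, x.1.2 - x.2.2), (- x.2.1 - x.2.2, x.2.1)).

Lemma sigma_act6 x : iter 6 sigma_act x = x.
Proof. by case: x => [[a b] [c d]]; rewrite /sigma_act /=; do 2 congr (_, _); ring. Qed.

Lemma rho_act3 x : iter 3 rho_act x = x.
Proof. by case: x => [[a b] [c d]]; rewrite /rho_act /=; do 2 congr (_, _); ring. Qed.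

Lemma sigma_rho_act x : sigma_act (rho_act x) = rho_act (sigma_act x).
Proof. by case: x => [[a b] [c d]]; rewrite /rho_act /sigma_act /=; do 2 congr (_, _); ring. Qed.

Lemma iter_comm (T : Type) (f g : T -> T) m n x : (forall x, f (g x) = g (f x)) ->
  iter m f (iter n g x) = iter n g (iter m f x).
Proof.
move=> fg; elim: n => //= n <-.
by elim: m => //= m ->.
Qed.

(** For [f] of order dividing [p], reduction modulo [p] gives all integer powers, negative ones
    included, by plain iteration. *)
Definition periodic_iter (p : nat) (f : N4 -> N4) (m : int) (x : N4) : N4 :=
  iter `|(m %% p)%Z|%N f x.

Lemma periodic_iterD p f m n x : (0 < p)%N -> (forall x, iter p f x = x) ->
  periodic_iter p f (m + n) x = periodic_iter p f m (periodic_iter p f n x).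
Proof.
move=> p0 fp.
have fpM j y : iter (j * p) f y = y by elim: j y => // j IHj y; rewrite mulSn iterD IHj fp.
rewrite /periodic_iter -iterD.
have pz : p%:Z != 0 by rewrite eqz_nat -lt0n.
have [a [ap am]] : exists a : nat, (m %% p)%Z = a /\ (a < p)%N.
  have := modz_ge0 m pz; have := ltz_mod m pz.
  by case: (m %% p)%Z => // a am _; exists a.
have [b [bp bm]] : exists a : nat, (n %% p)%Z = a /\ (a < p)%N.
  have := modz_ge0 n pz; have := ltz_mod n pz.
  by case: (n %% p)%Z => // b bm _; exists b.
rewrite -modzDm ap bp /= -PoszD modz_nat /=.
by rewrite {2}(divn_eq (a + b) p) iterD fpM.
Qed.

Definition group_act (q : Q2) (x : N4) : N4 :=
  periodic_iter 6 sigma_act q.1 (periodic_iter 3 rho_act q.2 x).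

Lemma group_act0 x : group_act 0 x = x. Proof. by []. Qed.

Lemma group_actD q r x : group_act (q + r) x = group_act q (group_act r x).
Proof.
rewrite /group_act !periodic_iterD //; [|exact: rho_act3|exact: sigma_act6].
by rewrite /periodic_iter [iter _ sigma_act (iter _ rho_act _)]iter_comm //; exact: sigma_rho_act.
Qed.

Lemma group_actDr q x y : group_act q (x + y) = group_act q x + group_act q y.
Proof.
have iterDr f n : (forall x y : N4, f (x + y) = f x + f y) ->
    forall x y : N4, iter n f (x + y) = iter n f x + iter n f y.
  by move=> fD; elim: n => //= n IHn x' y'; rewrite IHn fD.
have addE (a b c d a' b' c' d' : int) : ((a, b, (c, d)) : N4) + (a', b', (c', d')) =
  (a + a', b + b', (c + c', d + d')) by [].
rewrite /group_act /periodic_iter !iterDr // => -[[a b] [c d]] [[a' b'] [c' d']];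
  by rewrite /sigma_act /rho_act addE /= addE; do 2 congr (_, _); ring.
Qed.

Definition model_action : zmod_action Q2 N4 := ZmodAction group_act0 group_actD group_actDr.

Definition model : groupType := semidirect_product model_action.

Definition mk_model (x : N4) (q : Q2) : model := (x, q).

(* The images of the generators s1, s2 and rho. *)
Definition m1 := mk_model ((0, 0), (1, 0)) (1, 0).
Definition m2 := mk_model 0 (1, 0).
Definition mr := mk_model 0 (0, 1).

Definition crossing (m : nat) : model := if m is 0 then m1 else m2.

(** The values that [gen21] and [gen32] force on [gen 2 1] and [gen 3 2], with [mr] for [rho]. *)
Definition passing (m : nat) : model :=
  match m with
  | 0 => mr
  | 1 => m1^-1 * mr * m1
  | _ => m2^-1 * (m1^-1 * mr * m1) * m2
  end%g.

(* The value of the exchange of two adjacent points with [m] points other than the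
   puncture to their left: [l0] and [r0] tell whether the left, resp. the right, one
   is the puncture, and [low] whether the left one passes below the right one. *)
Definition label (m : nat) (l0 r0 low : bool) : model :=
  (if l0 then (if low then 1 else (passing m)^-1)
   else if r0 then (if low then passing m else 1)
   else if low then crossing m else (crossing m)^-1)%g.

(** * Crossing words and their potential *)

Section InsertionSort.
Variables (T : Type) (lt low : rel T) (nz : pred T).

(** [m] is the number of points other than the puncture on the left of [a], as required by
    [label]. *)
Fixpoint insertion (m : nat) (a : T) (s : seq T) : model * seq T :=
  if s is b :: s' then
    if lt b a then
      let r := insertion (m + nz b) a s' in
      ((label m (~~ nz a) (~~ nz b) (low a b) * r.1)%g, b :: r.2)
    else (1%g, a :: s)
  else (1%g, [:: a]).

Fixpoint insertion_sort (m : nat) (s : seq T) : model * seq T :=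
  if s is a :: s' then
    let r := insertion_sort (m + nz a) s' in
    let r' := insertion m a r.2 in ((r.1 * r'.1)%g, r'.2)
  else (1%g, [::]).

End InsertionSort.

(** [l] lists vertical ranks from left to right and [z] is that of the puncture. The arrangement
    with heights increasing to the right is taken as the zero of the potential. *)
Definition sort_val (z : nat) (l : seq nat) : model :=
  (insertion_sort ltn ltn (predC1 z) 0 l).1.

Definition swap_check (z : nat) (l : seq nat) (i : nat) : bool :=
  let a := nth 0%N l i in let b := nth 0%N l i.+1 in
  sort_val z l ==
    (label (count (predC1 z) (take i l)) (a == z) (b == z) (a < b)%N *
     sort_val z (take i l ++ b :: a :: drop i.+2 l))%g.

(* Since [sort_val] changes by the label of any adjacent exchange, not only of those
   performed by insertion sort, the values of crossings are differences of [sort_val];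
   this gives the cocycle condition. *)
Lemma swap_checks : all (fun z => all (fun l => all (swap_check z l) (iota 0 3))
  (permutations (iota 0 4))) (iota 0 4).
Proof. by vm_compute. Qed.

(** Only the puncture has to move, and it passes below the other points, which costs nothing. *)
Lemma over_checks : all (fun l => ([seq i <- l | i != 0%N] == [:: 1; 2; 3]%N) ==>
  (sort_val 0 l == 1%g)) (permutations (iota 0 4)).
Proof. by vm_compute. Qed.

Lemma swap_checkP z l i : (z < 4)%N -> perm_eq l (iota 0 4) -> (i < 3)%N -> swap_check z l i.
Proof.
move=> z4 lp i3.
have zin : z \in iota 0 4 by rewrite mem_iota.
have iin : i \in iota 0 3 by rewrite mem_iota.
rewrite -mem_permutations in lp.
exact: (allP (allP (allP swap_checks z zin) l lp) i iin).
Qed.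

Lemma over_checkP l : perm_eq l (iota 0 4) -> [seq i <- l | i != 0%N] = [:: 1; 2; 3]%N ->
  sort_val 0 l = 1%g.
Proof.
move=> lp lf; rewrite -mem_permutations in lp.
by apply/eqP; apply: (implyP (allP over_checks l lp)); rewrite lf.
Qed.

Lemma swap_check_cat z pre a b post :
  swap_check z (pre ++ a :: b :: post) (size pre) =
  (sort_val z (pre ++ a :: b :: post) ==
    label (count (predC1 z) pre) (a == z) (b == z) (a < b)%N * sort_val z (pre ++ b :: a :: post))%g.
Proof.
rewrite /swap_check !nth_cat ltnn subnn ltnNge leqnSn subSnn take_size_cat //.
have -> : drop (size pre).+2 (pre ++ a :: b :: post) = post.
  by rewrite -!cat_rcons drop_size_cat // !size_rcons.
by [].
Qed.

Section InsertionSortValue.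
Variables (T : eqType) (lt low : rel T) (nz : pred T) (F : seq T -> model) (L : seq T).
Variable allowed : rel T.
Hypothesis F_swap : forall pre a b post, perm_eq (pre ++ a :: b :: post) L -> allowed a b ->
  F (pre ++ a :: b :: post) =
    (label (count nz pre) (~~ nz a) (~~ nz b) (low a b) * F (pre ++ b :: a :: post))%g.

Lemma insertion_perm m a s : perm_eq (insertion lt low nz m a s).2 (a :: s).
Proof.
elim: s m => //= b s IHs m; case: ifP => //= _.
apply: (@perm_trans _ (b :: a :: s)); first by rewrite perm_cons.
by apply/seq.permP => p /=; rewrite addnCA.
Qed.

Lemma insertion_sort_perm m s : perm_eq (insertion_sort lt low nz m s).2 s.
Proof.
elim: s m => //= a s IHs m.
by apply: perm_trans (insertion_perm _ _ _) _; rewrite perm_cons.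
Qed.

Lemma insertion_val pre a s : perm_eq (pre ++ a :: s) L ->
  (forall b, b \in s -> lt b a -> allowed a b) ->
  let r := insertion lt low nz (count nz pre) a s in F (pre ++ a :: s) = (r.1 * F (pre ++ r.2))%g.
Proof.
elim: s pre => [|b s IHs] pre pL al /=; first by rewrite mul1g.
case: ifP => [ba|_] /=; last by rewrite mul1g.
rewrite F_swap //; last by apply: al; rewrite ?mem_head.
rewrite -mulgA; congr (_ * _)%g.
have -> : pre ++ b :: a :: s = rcons pre b ++ a :: s by rewrite cat_rcons.
rewrite IHs.
- by rewrite -cats1 count_cat /= addn0 -catA.
- rewrite cat_rcons; apply: perm_trans pL; rewrite perm_cat2l.
  by apply/seq.permP => p /=; rewrite addnCA.
- by move=> c cs; apply: al; rewrite inE cs orbT.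
Qed.

(** Each exchange removes one label from [F]. The [pairwise] condition covers all exchanges, since
    insertion sort exchanges a pair only out of its original order. *)
Lemma insertion_sort_val pre s : perm_eq (pre ++ s) L ->
  pairwise (fun a b => lt b a ==> allowed a b) s ->
  let r := insertion_sort lt low nz (count nz pre) s in F (pre ++ s) = (r.1 * F (pre ++ r.2))%g.
Proof.
elim: s pre => [|a s IHs] pre pL /=; first by rewrite mul1g.
move=> /andP[al pw]; rewrite -cat_rcons IHs //; last by rewrite cat_rcons.
have -> : count nz (rcons pre a) = (count nz pre + nz a)%N by rewrite -cats1 count_cat /= addn0.
rewrite cat_rcons insertion_val; first by rewrite mulgA.
  apply: perm_trans pL; rewrite perm_cat2l perm_cons; exact: insertion_sort_perm.
move=> b; rewrite (perm_mem (insertion_sort_perm _ _)) => bs ba.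
by move/allP: al => /(_ b bs); rewrite ba.
Qed.

End InsertionSortValue.

Section CrossingWord.
Variable R : realType.
Implicit Types (y z : cfg R) (v : 'S_4).

Definition labels : seq 'I_4 := enum 'I_4.

Definition lexle y : rel 'I_4 := fun i j => ~~ lexlt (y j) (y i).

Definition lexsort y : seq 'I_4 := sort (lexle y) labels.

(** Heights are read in [y] alone; this is harmless for close configurations, where exchanged points
    keep their vertical order. *)
Definition crossing_word y z : model :=
  (insertion_sort (fun i j => lexlt (z i) (z j)) (fun i j => (y i).2 < (y j).2)
    (predC1 ord0) 0 (lexsort y)).1.

Definition vertical_val v (l : seq 'I_4) : model := sort_val (v ord0) (map (fun i => v i : nat) l).

Lemma lexle_total y : total (lexle y).
Proof.
move=> i j; rewrite /lexle -negb_and; apply/negP => /andP[ji ij].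
by rewrite (lexlt_asym ij) in ji.
Qed.

Lemma lexle_trans y : transitive (lexle y).
Proof.
move=> j i l; rewrite /lexle => ij jl; apply: contra ij => li.
have [->|jl'] := eqVneq (y j) (y l); first by [].
by case/orP: (lexlt_total jl') => [jl2|lj]; [exact: lexlt_trans jl2 li|rewrite lj in jl].
Qed.

Lemma lexsort_perm y : perm_eq (lexsort y) labels.
Proof. by rewrite /lexsort perm_sort. Qed.

Lemma label_swap v pre a b post : perm_eq (pre ++ a :: b :: post) labels ->
  vertical_val v (pre ++ a :: b :: post) =
    (label (count (predC1 ord0) pre) (a == ord0) (b == ord0) (v a < v b)%N *
      vertical_val v (pre ++ b :: a :: post))%g.
Proof.
move=> pL.
have vinj : injective (fun i => v i : nat) by move=> i j /val_inj/perm_inj.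
have vL : perm_eq (map (fun i => v i : nat) (pre ++ a :: b :: post)) (iota 0 4).
  apply: perm_trans (perm_map _ pL) _.
  apply: uniq_perm; [by rewrite map_inj_uniq // enum_uniq|exact: iota_uniq|].
  move=> m; rewrite mem_iota /= add0n; apply/mapP/idP => [[i _ ->]|m4]; first exact: ltn_ord.
  by exists ((v^-1)%g (Ordinal m4)); rewrite ?mem_enum // permKV.
have sz : (size pre < 3)%N.
  have := perm_size pL; rewrite size_cat /= size_enum_ord; lia.
have := swap_checkP (ltn_ord (v ord0)) vL sz.
rewrite map_cat !map_cons -(size_map (fun i => v i : nat) pre) swap_check_cat => /eqP.
rewrite /vertical_val !map_cat !map_cons => ->.
rewrite count_map !(inj_eq vinj) (@eq_count _ _ (predC1 ord0)) // => i.
by rewrite /= (inj_eq vinj).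
Qed.

Lemma lexsort_unique y l : injective y -> perm_eq l labels ->
  sorted (fun i j => lexlt (y i) (y j)) l -> l = lexsort y.
Proof.
move=> yI lL sl; apply: (sorted_eq (@lexle_trans y)).
- move=> i j; rewrite /lexle -negb_or => nij; apply: yI; apply: contrapT => /eqP/lexlt_total.
  by rewrite orbC (negbTE nij).
- apply: sub_sorted sl => i j ij; by rewrite /lexle (lexlt_asym ij).
- by apply: sort_sorted; exact: lexle_total.
- by rewrite perm_sym; apply: perm_trans (lexsort_perm y) _; rewrite perm_sym.
Qed.

Lemma insertion_sort_sorted y (low : rel 'I_4) (nz : pred 'I_4) m l : injective y -> uniq l ->
  sorted (fun i j => lexlt (y i) (y j)) (insertion_sort (fun i j => lexlt (y i) (y j)) low nz m l).2.
Proof.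
move=> yI; elim: l m => //= a l IHl m /andP[al ul].
have {IHl} := IHl (m + nz a)%N ul.
have : a \notin (insertion_sort (fun i j => lexlt (y i) (y j)) low nz (m + nz a)%N l).2.
  by rewrite (perm_mem (insertion_sort_perm _ _ _ _ _)).
move: (insertion_sort _ _ _ _ _).2 => s; elim: s m => //= b s IHs m.
rewrite inE negb_or => /andP[ab as_] pbs.
case: ifP => [ba|/negbT ba] /=.
  have ps := path_sorted pbs; have := IHs (m + nz b)%N as_ ps.
  rewrite !(path_sortedE (fun j i k => @lexlt_trans R (y j) (y i) (y k))) in pbs *.
  case/andP: pbs => allb _ ->; rewrite andbT.
  by rewrite (perm_all _ (insertion_perm _ _ _ _ _ _)) /= ba.
rewrite pbs andbT.
have : y a != y b by apply: contra_neq ab; exact: yI.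
by move/lexlt_total; rewrite (negbTE ba) orbF.
Qed.

(** [vertical_val v] is the potential: by [label_swap] an exchange of neighbours changes it by its
    label, provided [v] orders that pair as the heights do. Only pairs reversed from [y] to [z] are
    exchanged. *)
Lemma crossing_wordE v y z : injective y -> injective z ->
  (forall a b, lexlt (y a) (y b) -> lexlt (z b) (z a) -> ((y a).2 < (y b).2) = (v a < v b)%N) ->
  crossing_word y z = (vertical_val v (lexsort y) * (vertical_val v (lexsort z))^-1)%g.
Proof.
move=> yI zI inv.
pose ltz i j := lexlt (z i) (z j).
pose low i j := (y i).2 < (y j).2.
pose allowed (a b : 'I_4) := low a b == (v a < v b)%N.
have Fsw pre a b post : perm_eq (pre ++ a :: b :: post) labels -> allowed a b ->
    vertical_val v (pre ++ a :: b :: post) =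
    (label (count (predC1 ord0) pre) (~~ predC1 ord0 a) (~~ predC1 ord0 b) (low a b) *
      vertical_val v (pre ++ b :: a :: post))%g.
  by move=> pL /eqP ->; rewrite label_swap //= !negbK.
have := @insertion_sort_val _ ltz low (predC1 ord0) _ _ _ Fsw [::] (lexsort y) (lexsort_perm y).
rewrite /= => ->; last first.
  (* The list has no repetitions, so an earlier entry is strictly smaller in [y]; an exchanged pair
     is therefore a true inversion. *)
  have : sorted (lexle y) (lexsort y) by apply: sort_sorted; exact: lexle_total.
  rewrite (sorted_pairwise (@lexle_trans y)).
  have : uniq (lexsort y) by rewrite (perm_uniq (lexsort_perm y)) enum_uniq.
  rewrite uniq_pairwise => ul pl; move: (conj ul pl) => /andP.
  rewrite -pairwise_relI; apply: sub_pairwise => i j /= /andP[ij le_ij].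
  apply/implyP => ltz_ji; apply/eqP; apply: inv => //.
  have : y i != y j by apply: contra_neq ij; exact: yI.
  by move/lexlt_total; rewrite (negbTE le_ij) orbF.
rewrite [X in vertical_val v X](_ : _ = lexsort z) ?mulgK //.
apply: lexsort_unique => //.
  by apply: perm_trans (insertion_sort_perm _ _ _ _ _) _; exact: lexsort_perm.
by apply: insertion_sort_sorted; rewrite // (perm_uniq (lexsort_perm y)) enum_uniq.
Qed.

End CrossingWord.

Section CrossingWordInvariance.
Variable R : realType.
Implicit Types (y z : cfg R) (v : 'S_4).

Lemma eq_crossing_word y z y' z' :
  (forall i j, lexlt (y i) (y j) = lexlt (y' i) (y' j)) ->
  (forall i j, lexlt (z i) (z j) = lexlt (z' i) (z' j)) ->
  (forall i j, ((y i).2 < (y j).2) = ((y' i).2 < (y' j).2)) ->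
  crossing_word y z = crossing_word y' z'.
Proof.
move=> yy zz y2; rewrite /crossing_word.
have -> : lexsort y = lexsort y'.
  by rewrite /lexsort; congr sort; apply/funext => i; apply/funext => j; rewrite /lexle yy.
have -> : (fun i j => lexlt (z i) (z j)) = (fun i j => lexlt (z' i) (z' j)).
  by apply/funext => i; apply/funext => j; rewrite zz.
have -> // : (fun i j => (y i).2 < (y j).2) = (fun i j => (y' i).2 < (y' j).2).
by apply/funext => i; apply/funext => j; rewrite y2.
Qed.

Lemma insertion_map (T T' : Type) (f : T -> T') (lt low : rel T') (nz : pred T') m a s :
  insertion lt low nz m (f a) (map f s) =
  let r := insertion (relpre f lt) (relpre f low) (preim f nz) m a s in (r.1, map f r.2).
Proof. by elim: s m => //= b s IHs m; case: ifP => //= _; rewrite IHs. Qed.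

Lemma insertion_sort_map (T T' : Type) (f : T -> T') (lt low : rel T') (nz : pred T') m s :
  insertion_sort lt low nz m (map f s) =
  let r := insertion_sort (relpre f lt) (relpre f low) (preim f nz) m s in (r.1, map f r.2).
Proof. by elim: s m => //= a s IHs m; rewrite IHs /= insertion_map. Qed.

Lemma crossing_word_perm (s : 'S_4) y z : injective y -> s ord0 = ord0 ->
  crossing_word (y \o s) (z \o s) = crossing_word y z.
Proof.
move=> yI s0; rewrite /crossing_word.
have -> : lexsort y = map s (lexsort (y \o s)).
  apply/esym/lexsort_unique => //.
    apply: perm_trans (perm_map s (lexsort_perm _)) _.
    apply: uniq_perm; [|exact: enum_uniq|move=> i].
      by rewrite map_inj_uniq ?enum_uniq //; exact: perm_inj.
    rewrite mem_enum; apply/mapP; exists ((s^-1)%g i); last by rewrite permKV.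
    by rewrite mem_enum.
  rewrite sorted_map.
  have ysI : injective (y \o s) by move=> i j /yI/perm_inj.
  have : sorted (lexle (y \o s)) (lexsort (y \o s)) by apply: sort_sorted; exact: lexle_total.
  have : uniq (lexsort (y \o s)) by rewrite (perm_uniq (lexsort_perm _)) enum_uniq.
  rewrite uniq_pairwise (sorted_pairwise (@lexle_trans _ (y \o s))) => ul sl.
  rewrite sorted_pairwise; last by move=> j i k /=; exact: lexlt_trans.
  move: (conj ul sl) => /andP; rewrite -pairwise_relI; apply: sub_pairwise => i j /andP[ij le_ij].
  have : (y \o s) i != (y \o s) j by apply: contra_neq ij; exact: ysI.
  by move/lexlt_total; rewrite (negbTE le_ij) orbF.
rewrite insertion_sort_map /=.
have sE : (preim s (predC1 ord0) : pred 'I_4) = predC1 ord0.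
  by apply/funext => i /=; rewrite -{1}s0 (inj_eq (@perm_inj _ s)).
by rewrite sE.
Qed.

End CrossingWordInvariance.

(** * The crossing cocycle on configurations *)

Section Cocycle.
Variables (R : realType) (M : topologicalType) (h : M -> R * R) (k : R * R -> M).
Hypotheses (h_continuous : continuous h) (h_neq0 : forall p, h p != 0)
  (hK : cancel h k) (kK : forall z : R * R, z != 0 -> h (k z) = z)
  (k_continuous : forall z : R * R, z != 0 -> {for z, continuous k}).
Local Notation X := (unordered_conf_space 3 M).
Variable w0 : conf_space 3 M.
Local Notation mk := (mk kK w0).
Implicit Types (x y z p q : cfg R) (P Q : X) (v : 'S_4).

Definition close p q := forall i j, i != j -> `|q i - p i| < `|q i - p j|.

Definition close_lift p Q : set (cfg R) :=
  [set q : cfg R | [/\ injective q, mk q = Q, q ord0 = 0 & close p q]].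

(* [close] determines the lift of [Q] uniquely, each point of it being matched with the
   nearest point of [p]. *)
Definition crossing_cocycle P Q : model :=
  let p := cfg_of h (repr P) in crossing_word p (xget p (close_lift p Q)).

(** The representative chosen in the definition differs from [y] by a relabelling and a translation.
    The close lift differs from [z] by the same relabelling and a translation, which leaves the
    crossing word unchanged. *)
Lemma crossing_cocycle_near x : injective x ->
  exists2 e : R, 0 < e & forall y z, near_cfg x e y -> near_cfg x e z ->
    crossing_cocycle (mk y) (mk z) = crossing_word y z.
Proof.
move=> xI; have [d d0 dx] := cfg_separated xI.
(* Closeness compares two differences that are each off by four errors below [d / 8]: one stays
   below [d / 2], the other above it. *)
exists (d / 8) => [|y z yx zx]; first by rewrite divr_gt0.
have nearI (y' : cfg R) : near_cfg x (d / 8) y' -> injective y'.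
  move=> y'x i j ij; apply: contrapT => /eqP /dx; apply/negP; rewrite -leNgt.
  have := y'x i; have := y'x j; rewrite ij => a1 a2.
  rewrite (_ : x i - x j = (y' j - x j) - (y' j - x i)); last by ring.
  apply: le_trans (ler_normB _ _) _; lra.
have yI := nearI y yx; have zI := nearI z zx.
rewrite /crossing_cocycle; set p := cfg_of h _.
have pI : injective p by exact: (cfg_of_inj h_neq0 hK).
have mkp : mk p = mk y by rewrite mk_cfg_of // reprK.
have [s [u [s0 pE]]] := mk_eq yI pI (esym mkp).
have uE : u = - y ord0.
  apply/eqP; rewrite -addr_eq0 addrC -[X in y X]s0.
  by have := congr1 (fun f => f ord0) pE; rewrite /p cfg_of0 => <-.
have zsI : injective (z \o s) by move=> i j /zI/perm_inj.
pose q : cfg R := fun i => (z \o s) i + (- z ord0).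
have qI : injective q by move=> i j /addIr/zsI.
have mkq : mk q = mk z by rewrite /q mk_translate // mk_perm.
have q0 : q ord0 = 0 by rewrite /q /= s0 subrr.
have norm4 (a b c e : R * R) : `|a - b - c + e| <= `|a| + `|b| + `|c| + `|e|.
  apply: le_trans (ler_normD _ _) _; rewrite lerD2r.
  by apply: le_trans (ler_normB _ _) _; rewrite lerD2r; exact: ler_normB.
have clq : close p q.
  move=> i j ij; rewrite pE uE /q /=.
  have := yx ord0; have := zx ord0; have := yx (s i); have := zx (s i); have := yx (s j).
  have : d < `|x (s i) - x (s j)| by apply: dx; rewrite (inj_eq (@perm_inj _ s)).
  move: (y (s j)) (y (s i)) (y ord0) (z (s i)) (z ord0) (x (s i)) (x (s j)) (x ord0).
  move=> yj yi y0 zi z0 xi xj xo.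
  move=> dij nj ni' ni n0' n0.
  have b1 := norm4 (zi - xi) (z0 - xo) (yi - xi) (y0 - xo).
  have b2 := norm4 (zi - xi) (z0 - xo) (yj - xj) (y0 - xo).
  have b3 := ler_normB (zi + - z0 - (yj + - y0)) ((zi - xi) - (z0 - xo) - (yj - xj) + (y0 - xo)).
  rewrite (_ : zi + - z0 - (yi + - y0) = (zi - xi) - (z0 - xo) - (yi - xi) + (y0 - xo)); last by ring.
  rewrite (_ : _ - _ = xi - xj) in b3; last by ring.
  lra.
have qP : close_lift p (mk z) q by split.
have [rI mkr r0 clr] := xgetPex p (ex_intro _ q qP).
have -> : xget p (close_lift p (mk z)) = q.
  move: (xget _ _) rI mkr r0 clr => r rI mkr r0 clr.
  have [t [u' [t0 rE]]] := mk_eq qI rI (etrans mkq (esym mkr)).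
  have u'0 : u' = 0 by move: r0; rewrite rE t0 q0 add0r.
  (* If [t] moved [i], closeness of [r] at [i] would contradict closeness of [q] at [t i]. *)
  suff t1 : t = 1%g by rewrite rE t1 u'0; apply/funext => i; rewrite perm1 addr0.
  apply/permP => i; rewrite perm1; apply: contrapT => /eqP ti.
  have := clr i (t i); rewrite eq_sym ti rE u'0 addr0 => /(_ isT).
  by apply/negP; rewrite -leNgt ltW // clq.
rewrite -(crossing_word_perm z yI s0); apply: eq_crossing_word => i j.
- by rewrite pE /lexlt /= !ltrD2r (inj_eq (addIr _)).
- by rewrite /q /lexlt /= !ltrD2r (inj_eq (addIr _)).
- by rewrite pE /= ltrD2r.
Qed.

(** Equal heights are separated by the abscissa, only to obtain a permutation. *)
Lemma vertical_rank x : injective x -> exists v : 'S_4, forall i j,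
  (x i).2 != (x j).2 -> ((x i).2 < (x j).2) = (v i < v j)%N.
Proof.
move=> xI; have xsI : injective (fun i => ((x i).2, (x i).1)).
  by move=> i j [e2 e1]; apply: xI; case: (x i) (x j) e1 e2 => [? ?] [? ?] /= -> ->.
have [v vE] := rank_perm xsI; exists v => i j ij.
by rewrite vE /lexlt /= (negbTE ij) orbF.
Qed.

(** Nearby lifts can reverse only pairs aligned vertically at [x], and these keep the height order
    of [x], recorded by [v]. So the values are differences of one potential. *)
Lemma crossing_cocycle_local P : exists2 U, nbhs P U & cocycle_on crossing_cocycle U.
Proof.
pose x := cfg_of h (repr P); have xI : injective x by exact: (cfg_of_inj h_neq0 hK).
have [e e0 xe] := crossing_cocycle_near xI; have [d d0 xd] := near_chart xI.
have [v vE] := vertical_rank xI.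
have ed0 : 0 < Num.min e d by rewrite lt_min e0 d0.
have [U [L [PU UL]]] := mk_local_section h_continuous h_neq0 hK kK w0 (repr P) ed0.
exists U; first by rewrite -{1}(reprK P).
have UP Q : U Q -> [/\ injective (L Q), mk (L Q) = Q, near_cfg x e (L Q) & chart (chart_of x) (L Q)].
  move=> /UL[LI LQ nx _]; split => //; last apply: xd.
    by move=> i; apply: lt_le_trans (nx i) _; rewrite ge_min lexx.
  by move=> i; apply: lt_le_trans (nx i) _; rewrite ge_min lexx orbT.
have cE Q Q' : U Q -> U Q' -> crossing_cocycle Q Q' =
    (vertical_val v (lexsort (L Q)) * (vertical_val v (lexsort (L Q')))^-1)%g.
  move=> /UP[LI LQ nQ cQ] /UP[LI' LQ' nQ' cQ'].
  rewrite -{1}LQ -{1}LQ' xe //; apply: crossing_wordE => // a b lab lba.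
  have ab : a != b by apply: contraTneq lab => ->; rewrite lexlt_irr.
  have := cQ a b ab; have := cQ' a b ab; rewrite /chart_of; case: ifPn => xab.
    by case: (_ < _) => /=; rewrite ?(lexlt_asym lab) ?(lexlt_asym lba).
  have xab2 : (x a).2 != (x b).2.
    apply: contra_neq ab => e2; apply: xI; move/negPn/eqP: xab e2.
    by case: (x a) (x b) => [? ?] [? ?] /= -> ->.
  by rewrite -vE //; case: (_ < _) => /= _ h2; [rewrite h2|rewrite ltNge (ltW h2)].
move=> Q1 Q2 Q3 U1 U2 U3; rewrite !cE // -mulgA.
by rewrite mulKg.
Qed.

Definition holonomy : path_functor R X model :=
  PathFunctor (path_hol_homotopic crossing_cocycle_local) (path_hol_cat crossing_cocycle_local).

End Cocycle.

Section HolonomyValues.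
Variables (R : realType) (M : topologicalType) (h : M -> R * R) (k : R * R -> M).
Hypotheses (h_continuous : continuous h) (h_neq0 : forall p, h p != 0)
  (hK : cancel h k) (kK : forall z : R * R, z != 0 -> h (k z) = z)
  (k_continuous : forall z : R * R, z != 0 -> {for z, continuous k}).
Local Notation X := (unordered_conf_space 3 M).
Variable w0 : conf_space 3 M.
Local Notation mk := (mk kK w0).
Local Notation node := (node R).
Local Notation hol := (holonomy h_continuous h_neq0 hK kK w0).
Local Notation E := (seg_val kK k_continuous w0 hol).
Implicit Types (x y z : cfg R) (v P H : 'S_4).

(** In a chart only pairs compared by height can be exchanged, and [v] orders them as the chart
    does; so one potential serves along the whole segment. *)
Lemma holonomy_seg c v y z : chart c y -> chart c z ->
  (forall a b, a != b -> (c a b).1 \/ (c a b).2 = (v a < v b)%N) ->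
  E y z = (vertical_val v (lexsort y) * (vertical_val v (lexsort z))^-1)%g.
Proof.
move=> cy cz cv; have yz : exists c, chart c y /\ chart c z by exists c.
pose f (t : R) := lin y z (valI (clampI t)).
have cf t : chart c (f t) by apply: chart_lin; rewrite ?valI_ge0 ?valI_le1.
pose Fv t := ((vertical_val v (lexsort (f t)))^-1)%g.
rewrite (seg_valE _ _ _ _ yz) /=.
rewrite (@path_hol_coboundary _ _ _ _ (crossing_cocycle_local h_continuous h_neq0 hK kK w0) _ _ _ Fv).
  rewrite /Fv /f invgK -/zero -/one valI0 valI1 lin0 lin1 //.
move=> t; have [e e0 fe] := crossing_cocycle_near h_neq0 hK kK w0 (chart_inj (cf t)).
exists [set s | near_cfg (f t) e (f s)].
  apply: (@filter_forall _ _ (fun i s => `|f s i - f t i| < e) (nbhs t)) => i.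
  have cfi : continuous (fun s => f s i).
    apply: lin_pt_continuous; [exact: cst_continuous|exact: cst_continuous|].
    exact/continuous_valI/clampI_continuous.
  have oB : open [set u : R * R | `|u - f t i| < e].
    rewrite (_ : [set _ | _] = ball (f t i) e); first exact: ball_open.
    by rewrite -ball_normE; apply/seteqP; split=> u; rewrite /= distrC.
  have fB : [set u : R * R | `|u - f t i| < e] (f t i) by rewrite /= subrr normr0.
  exact: cfi _ _ (open_nbhs_nbhs (conj oB fB)).
move=> s s' ns ns'; rewrite /path_ext !segE -/(f s) -/(f s') fe // /Fv invgK.
apply: crossing_wordE; try exact: chart_inj (cf _).
move=> a b lab lba; have ab : a != b by apply: contraTneq lab => ->; rewrite lexlt_irr.
have := cf s a b ab; have := cf s' a b ab.
have lex_case l : cone (true, l) (f s a) (f s b) -> cone (true, l) (f s' a) (f s' b) -> False.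
  by case: l => /=; rewrite ?(lexlt_asym lab) ?(lexlt_asym lba).
case: (cv a b ab); case: (c a b) => -[] l //=.
- by move=> _ c' cc; case: (lex_case l).
- by move=> _ c' cc; case: (lex_case l).
- by move=> <- _; case: l => [->//|lt_ba]; rewrite ltNge (ltW lt_ba).
Qed.

Lemma eq_lexsort y z : (forall i j, lexlt (y i) (y j) = lexlt (z i) (z j)) -> lexsort y = lexsort z.
Proof.
by move=> yz; rewrite /lexsort; congr sort; apply/funext => i; apply/funext => j; rewrite /lexle yz.
Qed.

Lemma holonomy_chamber y z : injective y -> injective z ->
  (forall i j, lexlt (y i) (y j) = lexlt (z i) (z j)) -> E y z = 1%g.
Proof.
move=> yI zI yz; have [P PE] := rank_perm yI.
have PE' : rank_of z P by move=> i j; rewrite PE yz.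
rewrite (holonomy_seg (v := 1%g) (rank_chart yI PE) (rank_chart zI PE')); last by left.
by rewrite (eq_lexsort yz) mulgV.
Qed.

(** With heights taken from the labels, the list is increasing except for the position of the
    puncture, which is at the bottom. *)
Lemma vertical_val_sorted y : sorted_cfg y -> injective y ->
  vertical_val 1 (lexsort y) = 1%g.
Proof.
move=> sy yI; have vE (l : seq 'I_4) : map (fun i => (1%g : 'S_4) i : nat) l = map val l.
  by apply: eq_map => i; rewrite perm1.
have pL : perm_eq (map val (lexsort y)) (iota 0 4).
  by rewrite -(val_enum_ord 4); apply: perm_map; exact: lexsort_perm.
rewrite /vertical_val perm1 vE; apply: over_checkP => //.
apply: (sorted_eq leq_trans anti_leq) => //.
  rewrite filter_map sorted_map.
  apply: (@sub_in_sorted _ (fun i : 'I_4 => i != ord0) (lexle y)).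
  - by move=> i j i0 j0 /=; rewrite /lexle sy // -leqNgt.
  - by apply/allP => i; rewrite mem_filter => /andP[].
  - apply: sorted_filter; first exact: lexle_trans.
    by apply: sort_sorted; exact: lexle_total.
by rewrite (perm_filter _ pL).
Qed.

Lemma holonomy_over y z : injective y -> injective z -> sorted_cfg y -> sorted_cfg z ->
  (forall i, i != ord0 -> (y ord0).2 < (y i).2 /\ (z ord0).2 < (z i).2) -> E y z = 1%g.
Proof.
move=> yI zI sy sz yz0.
have cy : chart over_chart y by apply: over_chart_sorted => // i /yz0[].
have cz : chart over_chart z by apply: over_chart_sorted => // i /yz0[].
rewrite (holonomy_seg (v := 1%g) cy cz).
  by rewrite !vertical_val_sorted // mulgV.
move=> a b _; rewrite /over_chart !perm1; case: ifP; [by right|by left].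
Qed.

Lemma lexsort_node H P : map (fun i => P i : nat) (lexsort (node H P)) = iota 0 4.
Proof.
have -> : lexsort (node H P) = map (P^-1)%g labels.
  apply/esym/lexsort_unique; first exact: node_inj.
    apply: uniq_perm; [|exact: enum_uniq|move=> i].
      by rewrite map_inj_uniq ?enum_uniq //; exact: perm_inj.
    rewrite mem_enum; apply/mapP; exists (P i); last by rewrite permK.
    by rewrite mem_enum.
  rewrite sorted_map.
  rewrite (@eq_sorted _ _ (relpre val ltn)) => [|i j]; last first.
    by rewrite /= -rank_node !permKV.
  by rewrite -sorted_map val_enum_ord.
by rewrite -map_comp -(val_enum_ord 4); apply: eq_map => i /=; rewrite permKV.
Qed.

(** Ranks and heights agree at the start, where the potential is therefore 1; only the end
    contributes. *)
Lemma holonomy_twist P (j : nat) : (j < 3)%N ->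
  E (node P P) (node P (P * sw j)%g) = ((sort_val (P ord0) (map (swn j) (iota 0 4)))^-1)%g.
Proof.
move=> j3; rewrite (holonomy_seg (v := P) (node_chart R P P) (node_chart R P _)).
  rewrite {1}/vertical_val lexsort_node.
  have -> : sort_val (P ord0) (iota 0 4) = 1%g.
    by have := ltn_ord (P ord0); case: (nat_of_ord (P ord0)) => [|[|[|[|]]]].
  rewrite mul1g /vertical_val -(lexsort_node P (P * sw j)%g) -map_comp.
  congr ((sort_val _ _)^-1)%g; apply: eq_map => i /=.
  rewrite permM swE //.
  have := swn_spec j (P i); have := swn_spec j (swn j (P i)); lia.
by move=> a b _; right.
Qed.

End HolonomyValues.

(** * Generators of the braid group and their images in the model *)

Section AnnularBraidGroup.
Variables (R : realType) (M : topologicalType) (h : M -> R * R) (k : R * R -> M).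
Hypotheses (h_continuous : continuous h) (h_neq0 : forall p, h p != 0)
  (hK : cancel h k) (kK : forall z : R * R, z != 0 -> h (k z) = z)
  (k_continuous : forall z : R * R, z != 0 -> {for z, continuous k}).
Local Notation X := (unordered_conf_space 3 M).
Local Notation I := (unit_interval R).
Variable w0 : conf_space 3 M.
Local Notation mk := (mk kK w0).
Local Notation node := (node R).
Local Notation hol := (holonomy h_continuous h_neq0 hK kK w0).
Variable b : X.
Local Notation pi1 := (fundamental_group R b).
Implicit Types (y z : cfg R) (P : 'S_4).

Lemma conf_path_connected (Q : X) : exists p : {path I from b to Q in X}, True.
Proof.
have conn0 (Q' : X) : exists p : {path I from mk (origin R) to Q' in X}, True.
  have [[y P] /= [yI <- sy PE]] := sorted_lift h_neq0 hK kK w0 Q'.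
  have p1 : exists c, chart c (origin R) /\ chart c (node 1 P).
    exists over_chart; split; apply: sorted_node => i j i0 j0; first by rewrite !perm1.
    exact: (sorted_rank sy PE).
  have p2 : exists c, chart c (node 1 P) /\ chart c y.
    exists (fun i j => (true, (P i < P j)%N)); split; apply: rank_chart => //.
      exact: node_inj.
    exact: rank_node.
  by exists (path_cat (seg kK k_continuous w0 p1) (seg kK k_continuous w0 p2)).
have [p _] := conn0 b; have [q _] := conn0 Q.
by exists (path_cat (path_rev p) q).
Qed.

Definition base_path Q : {path I from b to Q in X} := projT1 (cid (conf_path_connected Q)).

Definition raw_class := path_class_functor base_path.

Definition braid_class := trivialized h_neq0 hK kK k_continuous w0 raw_class.

Definition loop_hol (g : pi1) : model := hol _ _ (repr g).

Lemma loop_hol_pi (p : {path I from b to b in X}) : loop_hol (\pi_pi1 p) = hol _ _ p.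
Proof. by apply: pf_homotopic; apply/pi1_piP; rewrite reprK. Qed.

Lemma loop_holM (f g : pi1) : loop_hol (f * g)%g = (loop_hol f * loop_hol g)%g.
Proof.
rewrite -[f in LHS]reprK -[g in LHS]reprK.
rewrite -[(_ * _)%g]/(pi1_mul _ _) pi1_mulE loop_hol_pi.
exact: pf_cat.
Qed.

Lemma loop_hol_raw Q Q' (p : {path I from Q to Q' in X}) :
  loop_hol (raw_class _ _ p) =
    (hol _ _ (base_path Q) * hol _ _ p * (hol _ _ (base_path Q'))^-1)%g.
Proof. by rewrite loop_hol_pi !pf_cat pf_rev. Qed.

Lemma loop_hol1 : loop_hol 1%g = 1%g.
Proof. by apply: (mulgI (loop_hol 1%g)); rewrite -loop_holM !mulg1. Qed.

Lemma loop_holV g : loop_hol g^-1%g = ((loop_hol g)^-1)%g.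
Proof. by apply: (mulgI (loop_hol g)); rewrite -loop_holM !mulgV loop_hol1. Qed.

Local Notation E0 := (seg_val kK k_continuous w0 raw_class).
Local Notation Eh := (seg_val kK k_continuous w0 hol).

Lemma loop_hol_seg c y z : chart c y -> chart c z -> loop_hol (E0 y z) =
  (hol _ _ (base_path (mk y)) * Eh y z * (hol _ _ (base_path (mk z)))^-1)%g.
Proof.
move=> cy cz; have yz : exists c, chart c y /\ chart c z by exists c.
by rewrite (seg_valE kK k_continuous w0 raw_class yz) (seg_valE kK k_continuous w0 hol yz) loop_hol_raw.
Qed.

Definition base_hol : model := hol _ _ (base_path (mk (origin R))).

(** The gauge path from [origin] has trivial holonomy, so only the connecting paths remain. *)
Lemma loop_hol_base Q : loop_hol (base_val h_neq0 hK kK k_continuous w0 raw_class Q) =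
  (base_hol * (hol _ _ (base_path Q))^-1)%g.
Proof.
rewrite /base_val; case: cid => -[y P] /= [yI yQ sy PE].
rewrite /lift_val /= loop_holM.
have co : chart over_chart (origin R) by apply: sorted_node => i j; rewrite !perm1.
have cn : chart over_chart (node 1 P) by apply: sorted_node; exact: sorted_rank sy PE.
rewrite (loop_hol_seg co cn).
rewrite (loop_hol_seg (rank_chart (@node_inj R 1 P) (@rank_node R 1 P)) (rank_chart yI PE)).
rewrite holonomy_over.
- rewrite holonomy_chamber ?mulg1 //; [|exact: node_inj|by move=> i j; rewrite -rank_node PE].
  by rewrite !mulgA mulgVK yQ.
- exact: node_inj.
- exact: node_inj.
- by move=> i j i0 j0; rewrite -rank_node !perm1.
- by move=> i j i0 j0; rewrite -rank_node PE sy.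
- by move=> i i0; rewrite /= !perm1 ltr0n lt0n.
Qed.

(** The conjugation removes the holonomy of the connecting path to [origin]; by [braid_hol_class]
    the gauged class of a path is then sent exactly to its holonomy. *)
Definition braid_hol (g : pi1) : model := (base_hol^-1 * loop_hol g * base_hol)%g.

Lemma braid_holM f g : braid_hol (f * g)%g = (braid_hol f * braid_hol g)%g.
Proof. by rewrite /braid_hol loop_holM !mulgA mulgK. Qed.

Lemma braid_hol_class Q Q' (p : {path I from Q to Q' in X}) :
  braid_hol (braid_class _ _ p) = hol _ _ p.
Proof.
rewrite /braid_hol /braid_class /= /gauge_map 2!loop_holM loop_holV !loop_hol_base loop_hol_raw.
by rewrite invgM invgK !mulgA mulVg mul1g mulVg mul1g !mulgVK.
Qed.

Lemma braid_hol_seg c y z : chart c y -> chart c z ->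
  braid_hol (seg_val kK k_continuous w0 braid_class y z) = Eh y z.
Proof.
move=> cy cz; have yz : exists c, chart c y /\ chart c z by exists c.
by rewrite !(seg_valE _ _ _ _ yz) braid_hol_class.
Qed.

Local Notation chT := (@trivialized_chamber _ _ _ _ h_neq0 hK kK k_continuous w0 _ raw_class).
Local Notation ovT := (@trivialized_over _ _ _ _ h_neq0 hK kK k_continuous w0 _ raw_class).
Local Notation s1 := (s1 kK k_continuous w0 braid_class).
Local Notation s2 := (s2 kK k_continuous w0 braid_class).
Local Notation rho := (rho kK k_continuous w0 braid_class).

Lemma braid_hol_gen i j : (i < 4)%N -> (j < 3)%N ->
  braid_hol (gen kK k_continuous w0 braid_class i j) =
    ((sort_val i (map (swn j) (iota 0 4)))^-1)%g.
Proof.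
move=> i4 j3; rewrite /gen /twist (braid_hol_seg (node_chart R _ _) (node_chart R _ _)).
by rewrite holonomy_twist // tpermL inordK.
Qed.

Theorem annular_braid_group : exists (a1 a2 r : pi1) (f : pi1 -> model),
  [/\ (a1 * a2 * a1 = a2 * a1 * a2)%g, (r * a2 = a2 * r)%g &
      (a1 * r * a1 * r = r * a1 * r * a1)%g] /\
  (forall S : set pi1, is_subgroup S -> S a1 -> S a2 -> S r -> forall g, S g) /\
  [/\ {morph f : x y / (x * y)%g}, f a1 = m1, f a2 = m2 & f r = mr].
Proof.
exists s1, s2, rho, braid_hol; split; last split.
- split; [exact: (braid_s1_s2 chT)|exact: (braid_rho_s2 chT ovT)|exact: (braid_rho_s1 chT ovT)].
(* The gauge conjugates the class of a loop at [b] by [e]; the loop [p] is chosen to compensate for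
   this. *)
- move=> S sS S1 S2 Sr g; pose e := base_val h_neq0 hK kK k_continuous w0 raw_class b.
  have [p pE] := path_class_surj base_path (e^-1 * g * e)%g.
  have := pf_gen h_continuous h_neq0 hK chT ovT sS S1 S2 Sr p.
  rewrite -[X in S X]/(e * path_class base_path p / e)%g pE.
  by rewrite (mulgA e (e^-1 * g)%g e) mulVKg mulgK.
split.
- exact: braid_holM.
- by rewrite braid_hol_gen //; vm_compute.
- by rewrite braid_hol_gen //; vm_compute.
- by rewrite braid_hol_gen //; vm_compute.
Qed.

End AnnularBraidGroup.

(** * The quotient by the second derived subgroup *)

Section IntegerPowers.
Variable G : groupType.
Implicit Types (g h : G) (n m : int).

Definition zpow g n : G :=
  match n with Posz k => (g ^+ k)%g | Negz k => ((g ^+ k.+1)^-1)%g end.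

Lemma zpow0 g : zpow g 0 = 1%g. Proof. by []. Qed.

Lemma zpow1 g : zpow g 1 = g. Proof. by []. Qed.

Lemma zpowS g n : zpow g (n + 1) = (g * zpow g n)%g.
Proof.
case: n => [k|[|k]]; first by rewrite /= addn1 expgS.
  by rewrite /= mulgV.
rewrite (_ : Negz k.+1 + 1 = Negz k); last by rewrite !NegzE -addn1 PoszD opprD addrNK.
by rewrite /= [in RHS]expgSr invgM mulVKg.
Qed.

Lemma zpowD g n m : zpow g (n + m) = (zpow g n * zpow g m)%g.
Proof.
elim: n => [|n IHn|n IHn]; first by rewrite add0r mul1g.
  by rewrite -addn1 PoszD addrAC !zpowS IHn mulgA.
apply: (mulgI g); rewrite mulgA -!zpowS addrAC.
by rewrite -addn1 PoszD opprD addrNK.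
Qed.

Lemma commute_zpow g h n : (g * h = h * g)%g -> (g * zpow h n = zpow h n * g)%g.
Proof.
move=> gh; elim: n => [|n IHn|n IHn]; first by rewrite mulg1 mul1g.
  by rewrite -addn1 PoszD zpowS mulgA gh -mulgA IHn mulgA.
have E : zpow h (- n%:Z) = (h * zpow h (- n.+1%:Z))%g.
  by rewrite -zpowS -addn1 PoszD opprD addrNK.
apply: (mulgI h); rewrite mulgA -gh -mulgA -E mulgA -E.
exact: IHn.
Qed.

End IntegerPowers.

Lemma zpow_morph (G H : groupType) (f : G -> H) (g : G) n : {morph f : x y / (x * y)%g} ->
  f (zpow g n) = zpow (f g) n.
Proof.
move=> fM; have f1 : f 1%g = 1%g by apply: (mulgI (f 1%g)); rewrite -fM !mulg1.
elim: n => [|n IHn|n IHn] //; first by rewrite -addn1 PoszD !zpowS fM IHn.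
apply: (mulgI (f g)); rewrite -fM -!zpowS -addn1 PoszD opprD addrNK.
exact: IHn.
Qed.

Lemma int_hom_zpow (G : groupType) (f : int -> G) n :
  {morph f : x y / x + y >-> (x * y)%g} -> f n = zpow (f 1) n.
Proof.
move=> fD; have f0 : f 0 = 1%g by apply: (mulgI (f 0)); rewrite -fD addr0 mulg1.
elim: n => [|n IHn|n IHn] //; first by rewrite -addn1 PoszD zpowS addrC fD IHn.
apply: (mulgI (f 1)); rewrite -fD -!zpowS addrC -addn1 PoszD opprD addrNK.
exact: IHn.
Qed.

Section HomomorphismsFromN4.

Definition u_vec : N4 := ((0, 0), (1, 0)).
Definition v_vec : N4 := ((0, 0), (0, 1)).

Definition N4_hom (G : groupType) (f : N4 -> G) := {morph f : x y / x + y >-> (x * y)%g}.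

Variable G : groupType.

Lemma N4_hom0 (f : N4 -> G) : N4_hom f -> f 0 = 1%g.
Proof. by move=> fD; apply: (mulgI (f 0)); rewrite -fD addr0 mulg1. Qed.

Lemma N4_homN (f : N4 -> G) x : N4_hom f -> f (- x) = ((f x)^-1)%g.
Proof.
by move=> fD; apply: (mulgI (f x)); rewrite -fD subrr mulgV N4_hom0.
Qed.

Lemma N4_homMz (f : N4 -> G) x n : N4_hom f -> f (x *~ n) = zpow (f x) n.
Proof.
move=> fD; elim: n => [|n IHn|n IHn]; first by rewrite mulr0z N4_hom0.
  by rewrite -addn1 PoszD mulrzDr mulr1z addrC fD IHn -zpowS.
apply: (mulgI (f x)); rewrite -fD -zpowS -addn1 PoszD opprD addrNK -IHn.
by rewrite mulrzBr mulr1z addrC subrK.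
Qed.

Lemma N4_addE (a b c d a' b' c' d' : int) : ((a, b, (c, d)) : N4) + (a', b', (c', d')) =
  (a + a', b + b', (c + c', d + d')).
Proof. by []. Qed.

Lemma N4_oppE (a b c d : int) : - ((a, b, (c, d)) : N4) = (- a, - b, (- c, - d)).
Proof. by []. Qed.

Lemma N4_mulzE (a b c d n : int) : ((a, b, (c, d)) : N4) *~ n = (a * n, b * n, (c * n, d * n)).
Proof.
elim: n => [|n IHn|n IHn]; first by rewrite mulr0z !mulr0.
  by rewrite -addn1 PoszD mulrzDr IHn mulr1z N4_addE !mulrDr !mulr1.
by rewrite -addn1 PoszD opprD mulrzBr IHn mulr1z N4_oppE N4_addE !mulrBr !mulr1.
Qed.

(** Obtained by solving the formulas for rho_1 u and rho_1 v for alpha_0 and beta_0. In this basis a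
    homomorphism is prescribed by [U] and three of its conjugates. *)
Lemma N4_decomp (x : N4) : x = u_vec *~ (x.2.1 - x.1.1 - x.1.2) + v_vec *~ (x.2.2 + x.1.1)
  + rho_act u_vec *~ (- x.1.1) + rho_act v_vec *~ (- x.1.2).
Proof.
have -> : rho_act u_vec = ((-1, 0), (-1, 1)) by [].
have -> : rho_act v_vec = ((0, -1), (-1, 0)) by [].
case: x => [[a b] [c d]]; rewrite !N4_mulzE !N4_addE; cbn [fst snd].
by congr (_, _, (_, _)); ring.
Qed.

Lemma N4_hom_ext (f g : N4 -> G) : N4_hom f -> N4_hom g ->
  f u_vec = g u_vec -> f v_vec = g v_vec ->
  f (rho_act u_vec) = g (rho_act u_vec) -> f (rho_act v_vec) = g (rho_act v_vec) -> f =1 g.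
Proof.
by move=> fD gD fu fv fu' fv' x; rewrite (N4_decomp x) !(fD, gD) !N4_homMz // fu fv fu' fv'.
Qed.

Lemma N4_hom_ex (U V U' V' : G) :
  {in [:: U; V; U'; V'] &, forall g h, (g * h = h * g)%g} ->
  exists f : N4 -> G, N4_hom f /\
    [/\ f u_vec = U, f v_vec = V, f (rho_act u_vec) = U' & f (rho_act v_vec) = V'].
Proof.
move=> com; have comz g h n m : g \in [:: U; V; U'; V'] -> h \in [:: U; V; U'; V'] ->
    (zpow g n * zpow h m = zpow h m * zpow g n)%g.
  by move=> gi hi; apply: commute_zpow; apply/esym/commute_zpow; exact: com.
have swap (g1 g2 h1 h2 : G) : (g2 * h1 = h1 * g2)%g -> (g1 * h1 * (g2 * h2) = (g1 * g2) * (h1 * h2))%g.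
  by move=> gh; rewrite !mulgA -(mulgA g1 h1) -gh mulgA.
have comM (g h1 h2 : G) : (g * h1 = h1 * g)%g -> (g * h2 = h2 * g)%g ->
    (g * (h1 * h2) = (h1 * h2) * g)%g.
  by move=> g1 g2; rewrite mulgA g1 -mulgA g2 mulgA.
(* Coordinates in the basis of [N4_decomp]. *)
pose e (x : N4) := (x.2.1 - x.1.1 - x.1.2, x.2.2 + x.1.1, - x.1.1, - x.1.2).
pose f (e : int * int * int * int) :=
  (zpow U e.1.1.1 * zpow V e.1.1.2 * zpow U' e.1.2 * zpow V' e.2)%g.
have memU : U \in [:: U; V; U'; V'] by rewrite !inE eqxx.
have memV : V \in [:: U; V; U'; V'] by rewrite !inE eqxx !orbT.
have memU' : U' \in [:: U; V; U'; V'] by rewrite !inE eqxx !orbT.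
have memV' : V' \in [:: U; V; U'; V'] by rewrite !inE eqxx !orbT.
exists (f \o e); split; last first.
  by rewrite /f /e /=; split; rewrite ?zpow0 ?zpow1 ?mulg1 ?mul1g.
move=> x y; have -> : (f \o e) (x + y) =
    f ((e x).1.1.1 + (e y).1.1.1, (e x).1.1.2 + (e y).1.1.2, (e x).1.2 + (e y).1.2, (e x).2 + (e y).2).
  case: x y => [[a b] [c d]] [[a' b'] [c' d']]; rewrite N4_addE /= /e /=; congr f.
  by congr (_, _, _, _); ring.
rewrite [(f \o e) x]/= [(f \o e) y]/=; move: (e x) (e y) => ex ey; rewrite /f /= !zpowD.
rewrite [RHS]swap; last by apply/esym/comM; [apply: comM|]; exact: comz.
congr (_ * _)%g; rewrite [RHS]swap; last by apply/esym/comM; exact: comz.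
by congr (_ * _)%g; rewrite [RHS]swap //; exact: comz.
Qed.

End HomomorphismsFromN4.

Section MetabelianRelations.
Variables (K : groupType) (a1 a2 r : K) (D : set K).
Hypotheses (DM : forall g h, D g -> D h -> D (g * h)%g) (Dinv : forall g, D g -> D g^-1%g)
  (DJ : forall g h, D g -> D (h * g * h^-1)%g) (DC : forall g h, D g -> D h -> (g * h = h * g)%g).
Hypotheses (braid12 : (a1 * a2 * a1 = a2 * a1 * a2)%g) (braid_r2 : (r * a2 = a2 * r)%g)
  (braid_r1 : (a1 * r * a1 * r = r * a1 * r * a1)%g).

Definition cj (g h : K) := (g * h * g^-1)%g.

Lemma cjM g h h' : cj g (h * h')%g = (cj g h * cj g h')%g.
Proof. by rewrite /cj !mulgA mulgVK. Qed.

Lemma cjV g h : cj g h^-1%g = ((cj g h)^-1)%g.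
Proof. by rewrite /cj !invgM invgK mulgA. Qed.

Lemma cj_comp g h x : cj g (cj h x) = cj (g * h)%g x.
Proof. by rewrite /cj invgM !mulgA. Qed.

Lemma cj_swap g x : (g * x = cj g x * g)%g.
Proof. by rewrite /cj mulgVK. Qed.

Lemma cjK g x : cj g^-1%g (cj g x) = x.
Proof. by rewrite cj_comp mulVg /cj invg1 mul1g mulg1. Qed.

Lemma cj_a2_r x : cj a2 (cj r x) = cj r (cj a2 x).
Proof. by rewrite !cj_comp braid_r2. Qed.

Definition U := (a1 * a2^-1)%g.
Definition V := cj a2 U.
Definition U' := cj r U.
Definition V' := cj r V.

Hypothesis DU : D U.

Lemma DV : D V. Proof. exact: DJ. Qed.
Lemma DU' : D U'. Proof. exact: DJ. Qed.
Lemma DV' : D V'. Proof. by apply: DJ; exact: DV. Qed.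

(** The braid relation after substituting [a1 = U * a2]; additively, sigma sends v to v - u. *)
Lemma cj_a2_V : cj a2 V = (V * U^-1)%g.
Proof.
have a1E : a1 = (U * a2)%g by rewrite mulgVK.
have H : (U * cj a2 V = V)%g.
  apply: (mulIg (a2 * a2 * a2)%g); rewrite /V /cj !mulgA !mulgVK.
  by have := braid12; rewrite a1E -/U !mulgA !mulgVK.
apply: (mulgI U); rewrite H DC ?mulgVK //.
by apply: DM; [exact: DV|exact: Dinv].
Qed.

(** The relation between [a1] and [r] after substituting [a1 = U * a2]; additively, rho_1 applied
    twice to u is u - v + rho_1 v. *)
Lemma cj_r_U' : cj r U' = (U * V^-1 * V')%g.
Proof.
have a1E : a1 = (U * a2)%g by rewrite mulgVK.
have [dV dU' dV'] := And3 DV DU' DV'.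
have H : (U * V' = U' * cj a2 (cj r U'))%g.
  apply: (mulIg (a2 * r * a2 * r)%g).
  have -> : (U * V' * (a2 * r * a2 * r) = U * a2 * r * (U * a2) * r)%g.
    by rewrite /V' -cj_a2_r /cj !mulgA !mulgVK.
  rewrite -a1E braid_r1.
  have -> : cj a2 (cj r U') = cj (r * a2 * r)%g U by rewrite cj_a2_r /U' !cj_comp.
  have -> : (a2 * r * a2 * r = r * a2 * r * a2)%g by rewrite -braid_r2 -!mulgA braid_r2.
  rewrite /U' (mulgA _ (r * a2 * r)%g a2) -(mulgA (cj r U)) -cj_swap.
  by rewrite {1 2}a1E /cj !mulgA !mulgVK.
(* Conjugation by [a2] is injective and takes the expected value to [U'^-1 * U * V']. *)
have cancel x : D x -> cj a2 x = (U'^-1 * U * V')%g -> x = (U * V^-1 * V')%g.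
  move=> dx xE; rewrite -(cjK a2 x) -(cjK a2 (U * V^-1 * V')%g) xE; congr (cj _ _).
  rewrite (cjM a2 (U * V^-1)%g V') (cjM a2 U) (cjV a2 V) -/V cj_a2_V.
  rewrite (_ : cj a2 V' = V' * U'^-1)%g; last first.
    by rewrite cj_a2_r cj_a2_V (cjM r V) (cjV r U).
  have -> : (V * (V * U^-1)^-1 = U)%g by rewrite invgM invgK mulgA (DC dV DU) mulgK.
  by rewrite -mulgA (DC (Dinv dU') (DM DU dV')) -(mulgA U V').
apply: cancel; first exact: DJ.
by apply: (mulgI U'); rewrite -H !mulgA mulgV mul1g.
Qed.

Section NormalForm.
Variable Phi : N4 -> K.
Hypotheses (PhiD : N4_hom Phi) (Phi_u : Phi u_vec = U) (Phi_v : Phi v_vec = V)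
  (Phi_u' : Phi (rho_act u_vec) = U') (Phi_v' : Phi (rho_act v_vec) = V').

Lemma cj_hom g (f : N4 -> N4) : {morph f : x y / x + y} ->
  N4_hom (fun x => cj g (Phi x)) /\ N4_hom (fun x => Phi (f x)).
Proof. by move=> fD; split=> x y; rewrite ?fD PhiD // cjM. Qed.

Lemma sigma_actD : {morph sigma_act : x y / x + y}.
Proof.
move=> [[a b] [c d]] [[a' b'] [c' d']]; rewrite N4_addE /sigma_act /= N4_addE.
by congr (_, _, (_, _)); ring.
Qed.

Lemma rho_actD : {morph rho_act : x y / x + y}.
Proof.
move=> [[a b] [c d]] [[a' b'] [c' d']]; rewrite N4_addE /rho_act /= N4_addE.
by congr (_, _, (_, _)); ring.
Qed.

Lemma cj_a2_Phi x : cj a2 (Phi x) = Phi (sigma_act x).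
Proof.
have [h1 h2] := cj_hom a2 sigma_actD.
move: x; apply: (N4_hom_ext h1 h2).
- by rewrite Phi_u -/V -Phi_v.
- rewrite Phi_v cj_a2_V -Phi_u -Phi_v -(N4_homN _ PhiD) -PhiD.
  by congr Phi.
- by rewrite Phi_u' cj_a2_r -/V -/V' -Phi_v'.
- rewrite Phi_v' cj_a2_r cj_a2_V (cjM r V) (cjV r U) -/V' -/U' -Phi_u' -Phi_v' -(N4_homN _ PhiD) -PhiD.
  by congr Phi.
Qed.

(** On the basis of [N4_decomp]; the case of [rho_act v_vec] comes from that of [rho_act u_vec] by
    conjugating with [a2], which commutes with [r]. *)
Lemma cj_r_Phi x : cj r (Phi x) = Phi (rho_act x).
Proof.
have [h1 h2] := cj_hom r rho_actD.
have ru' : cj r (Phi (rho_act u_vec)) = Phi (rho_act (rho_act u_vec)).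
  rewrite Phi_u' cj_r_U' -Phi_u -Phi_v -Phi_v' -(N4_homN _ PhiD) -!PhiD.
  by congr Phi.
move: x; apply: (N4_hom_ext h1 h2) => //.
- by rewrite Phi_u -/U' -Phi_u'.
- by rewrite Phi_v -/V' -Phi_v'.
- have -> : rho_act v_vec = sigma_act (rho_act u_vec) by [].
  rewrite -cj_a2_Phi -cj_a2_r ru' cj_a2_Phi.
  by rewrite -!sigma_rho_act.
Qed.

Definition normal_form (x : N4) (q : Q2) : K := (Phi x * zpow a2 q.1 * zpow r q.2)%g.

Lemma normal_form_gen :
  (forall S : set K, is_subgroup S -> S a1 -> S a2 -> S r -> forall g, S g) ->
  forall g, exists x q, g = normal_form x q.
Proof.
move=> gen.
pose T := [set g | exists x q, g = normal_form x q].
have zpowSV (g : K) n : (g^-1 * zpow g n = zpow g (n - 1))%g.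
  by apply: (mulgI g); rewrite mulVKg -zpowS subrK.
have T2 g : T g -> T (a2 * g)%g.
  move=> [x [q ->]]; exists (sigma_act x), (q.1 + 1, q.2).
  by rewrite /normal_form !mulgA (cj_swap a2 (Phi _)) cj_a2_Phi /= zpowS !mulgA.
have T2V g : T g -> T (a2^-1 * g)%g.
  (* Five iterations invert [sigma_act], whose sixth power is the identity; likewise two for
     [rho_act] below. *)
  move=> [x [q ->]]; exists (iter 5 sigma_act x), (q.1 - 1, q.2).
  apply: (mulgI a2); rewrite mulVKg /normal_form !mulgA (cj_swap a2 (Phi _)) cj_a2_Phi -iterS sigma_act6.
  by rewrite -(mulgA _ a2) -zpowS subrK.
have rz n : (r * zpow a2 n = zpow a2 n * r)%g by apply: commute_zpow.
have Tr g : T g -> T (r * g)%g.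
  move=> [x [q ->]]; exists (rho_act x), (q.1, q.2 + 1).
  by rewrite /normal_form !mulgA (cj_swap r (Phi _)) cj_r_Phi -(mulgA _ r) rz /= zpowS !mulgA.
have TrV g : T g -> T (r^-1 * g)%g.
  move=> [x [q ->]]; exists (iter 2 rho_act x), (q.1, q.2 - 1).
  apply: (mulgI r); rewrite mulVKg /normal_form !mulgA (cj_swap r (Phi _)) cj_r_Phi -iterS rho_act3.
  by rewrite -(mulgA _ r) rz -!mulgA -zpowS subrK.
have TU g (b : int) : T g -> T (Phi (u_vec *~ b) * g)%g.
  move=> [x [q ->]]; exists (u_vec *~ b + x), q.
  by rewrite /normal_form PhiD !mulgA.
have a1E : a1 = (Phi (u_vec *~ 1) * a2)%g by rewrite mulr1z Phi_u mulgVK.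
have a1VE : (a1^-1 = a2^-1 * Phi (u_vec *~ (- 1)))%g.
  by rewrite mulrN1z (N4_homN _ PhiD) Phi_u /U !invgM invgK mulKg.
(* [T] is not visibly closed under products; the elements that preserve [T] by left multiplication,
   together with their inverses, do form a subgroup. *)
pose S := [set g | forall t, T t -> T (g * t)%g /\ T (g^-1 * t)%g].
have T1 : T 1%g by exists 0, 0; rewrite /normal_form (N4_hom0 PhiD) !mul1g.
suff SE : forall g, S g by move=> g; have [] := SE g _ T1; rewrite mulg1.
apply: gen.
- split=> [t|g h Sg Sh t Tt|g Sg t Tt]; first by rewrite invg1 mul1g.
    split; first by rewrite -mulgA; apply: (Sg _ _).1; apply: (Sh _ _).1.
    by rewrite invgM -mulgA; apply: (Sh _ _).2; apply: (Sg _ _).2.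
  by rewrite invgK; have [] := Sg _ Tt.
- move=> t Tt; rewrite a1VE [X in T (X * t)%g]a1E -!mulgA; split; first exact/TU/T2.
  exact/T2V/TU.
- by move=> t Tt; split; [exact: T2|exact: T2V].
- by move=> t Tt; split; [exact: Tr|exact: TrV].
Qed.

End NormalForm.

End MetabelianRelations.

Section MetabelianQuotient.
Variables (G : groupType) (a1 a2 r : G) (f : G -> model).
Hypotheses (braid12 : (a1 * a2 * a1 = a2 * a1 * a2)%g) (braid_r2 : (r * a2 = a2 * r)%g)
  (braid_r1 : (a1 * r * a1 * r = r * a1 * r * a1)%g)
  (generated : forall S : set G, is_subgroup S -> S a1 -> S a2 -> S r -> forall g, S g)
  (fM : {morph f : x y / (x * y)%g}) (f1 : f a1 = m1) (f2 : f a2 = m2) (fr : f r = mr).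

Local Notation N := (derived_normal G 2).
Local Notation Q := (quotient_group N).
Local Notation pi x := (\pi_Q x : Q).

Lemma model_morph1 : f 1%g = 1%g.
Proof. by apply: (mulgI (f 1%g)); rewrite -fM !mulg1. Qed.

Lemma model_morphV x : f x^-1%g = ((f x)^-1)%g.
Proof. by apply: (mulgI (f x)); rewrite -fM !mulgV model_morph1. Qed.

(** The model is metabelian: commutators have trivial component in [Q2], and elements with trivial
    component there commute. *)
Lemma f_derived x : @derived_series G 2 x -> f x = 1%g.
Proof.
have model_comm (m n : model) : m.2 = 0 -> n.2 = 0 -> (m * n = n * m)%g.
  case: m n => [m q] [n s] /= -> ->.
  by rewrite -[LHS]/(sd_mul _ _) -[RHS]/(sd_mul _ _) /sd_mul /= !group_act0 !addr0 addrC.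
have D1 y : @derived_series G 1 y -> (f y).2 = 0.
  move=> /= Dy; apply: (Dy [set y | (f y).2 = 0]); split.
    split=> [|a b|a] /=; first by rewrite model_morph1.
      by rewrite fM /= => -> ->; rewrite addr0.
    by rewrite model_morphV /= => ->; rewrite oppr0.
  move=> _ [a _ [b _ <-]] /=; rewrite /commg /conjg !fM !model_morphV /=.
  by rewrite [(f a).2 + _]addrC addKr addNr.
move=> /= Dx; apply: (Dx [set y | f y = 1%g]); split.
  split=> [|a b|a] /=; first exact: model_morph1.
    by rewrite fM => -> ->; rewrite mulg1.
  by rewrite model_morphV => ->; rewrite invg1.
move=> _ [a Da [b Db <-]] /=; rewrite /commg /conjg !fM !model_morphV.
rewrite (model_comm (f a) (f b)) ?D1 //.
by rewrite mulKg mulVg.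
Qed.

Definition quotient_hol (g : Q) : model := f (repr g).

Lemma quotient_holE x : quotient_hol (pi x) = f x.
Proof.
rewrite /quotient_hol; have /quotient_piP/f_derived := reprK (pi x : Q).
rewrite fM model_morphV => /(congr1 (fun y => f (repr (pi x : Q)) * y)%g).
by rewrite mulVKg mulg1.
Qed.

Lemma quotient_piM x y : pi (x * y)%g = (pi x * pi y)%g.
Proof. by rewrite -[RHS]/(quotient_mul _ _) quotient_mulE. Qed.

Lemma quotient_piV x : pi x^-1%g = ((pi x)^-1)%g.
Proof. by rewrite -[RHS]/(quotient_inv _) quotient_invE. Qed.

Lemma quotient_holM : {morph quotient_hol : g h / (g * h)%g}.
Proof.
move=> g h; case: (quotient_pi g) (quotient_pi h) => x -> [y ->].
by rewrite -quotient_piM !quotient_holE fM.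
Qed.

Lemma quotient_holV g : quotient_hol g^-1%g = ((quotient_hol g)^-1)%g.
Proof. by case: (quotient_pi g) => x ->; rewrite -quotient_piV !quotient_holE model_morphV. Qed.

Definition in_derived (g : Q) := exists2 x, @derived_series G 1 x & g = pi x.

Lemma in_derivedM g h : in_derived g -> in_derived h -> in_derived (g * h)%g.
Proof.
case: (derived_subgroup G 1) => _ DM _ [x Dx ->] [y Dy ->].
by exists (x * y)%g; [exact: DM|rewrite quotient_piM].
Qed.

Lemma in_derivedV g : in_derived g -> in_derived g^-1%g.
Proof.
case: (derived_subgroup G 1) => _ _ DV [x Dx ->].
by exists (x^-1)%g; [exact: DV|rewrite quotient_piV].
Qed.

Lemma in_derivedJ g h : in_derived g -> in_derived (h * g * h^-1)%g.
Proof.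
move=> [x Dx ->]; have [y ->] := quotient_pi h.
exists (x ^ y^-1)%g; first exact: derived_normal_subproof.
by rewrite /conjg invgK mulgA !quotient_piM quotient_piV.
Qed.

Lemma in_derived_comm g h : in_derived g -> in_derived h -> (g * h = h * g)%g.
Proof.
move=> [x Dx ->] [y Dy ->]; rewrite -!quotient_piM; apply/esym/quotient_piP.
move=> S [sS SD]; have : [set [~ a, b]%g | a in @derived_series G 1 & b in @derived_series G 1]
    [~ x, y]%g by exists x => //; exists y.
by move/SD; rewrite /commg /conjg invgM !mulgA.
Qed.

(** By the braid relation [a1 * a2] conjugates [a1] to [a2], so [a1 * a2^-1] is a commutator. *)
Lemma in_derivedU : in_derived (U (pi a1) (pi a2)).
Proof.
exists (a1 * a2^-1)%g; last by rewrite quotient_piM quotient_piV.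
have -> : (a1 * a2^-1 = [~ a1^-1, (a1 * a2)^-1])%g.
  rewrite /commg /conjg !invgK -(invgM (a1 * a2)%g a1) braid12 !invgM.
  by rewrite (mulgA (a1 * a2)%g) mulgK mulVKg.
by move=> S [_ SD]; apply: SD; exists (a1^-1)%g => //; exists ((a1 * a2)^-1)%g.
Qed.

(** Normal forms exhaust the quotient and [normal_form x q] is sent to [(x, q)], so taking normal
    forms is the inverse map. *)
Theorem quotient_model : bijective quotient_hol.
Proof.
have b12 : (pi a1 * pi a2 * pi a1 = pi a2 * pi a1 * pi a2)%g by rewrite -!quotient_piM braid12.
have br2 : (pi r * pi a2 = pi a2 * pi r)%g by rewrite -!quotient_piM braid_r2.
have br1 : (pi a1 * pi r * pi a1 * pi r = pi r * pi a1 * pi r * pi a1)%g.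
  by rewrite -!quotient_piM braid_r1.
pose dJ g h (dg : in_derived g) := in_derivedJ h dg.
have dU := in_derivedU.
have [|Phi [PhiD [Pu Pv Pu' Pv']]] := @N4_hom_ex _ (U (pi a1) (pi a2)) (V (pi a1) (pi a2))
  (U' (pi a1) (pi a2) (pi r)) (V' (pi a1) (pi a2) (pi r)).
  have all_d g : g \in [:: U (pi a1) (pi a2); V (pi a1) (pi a2);
      U' (pi a1) (pi a2) (pi r); V' (pi a1) (pi a2) (pi r)] -> in_derived g.
    by rewrite !inE => /or4P[] /eqP -> //; do ?apply: in_derivedJ.
  by move=> g h /all_d dg /all_d dh; exact: in_derived_comm.
have gen (S : set Q) : is_subgroup S -> S (pi a1) -> S (pi a2) -> S (pi r) -> forall g, S g.
  move=> [S1 SM SV] Sa1 Sa2 Sr g; have [x ->] := quotient_pi g.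
  apply: (generated (S := [set x | S (pi x)])) => //; split=> //=.
  - by move=> y z Sy Sz; rewrite quotient_piM; exact: SM.
  - by move=> y Sy; rewrite quotient_piV; exact: SV.
have nf := normal_form_gen in_derivedM in_derivedV dJ in_derived_comm b12 br2 br1 dU
  PhiD Pu Pv Pu' Pv' gen.
have hPhi x : quotient_hol (Phi x) = mk_model x 0.
  move: x; apply: N4_hom_ext.
  - by move=> x y; rewrite PhiD quotient_holM.
  - by move=> x y; rewrite -[RHS]/(sd_mul _ _) /sd_mul /= group_act0 addr0.
  - by rewrite Pu /U !(quotient_holM, quotient_holV) !quotient_holE f1 f2; vm_compute.
  - by rewrite Pv /V /cj /U !(quotient_holM, quotient_holV) !quotient_holE f1 f2; vm_compute.
  - by rewrite Pu' /U' /cj /U !(quotient_holM, quotient_holV) !quotient_holE f1 f2 fr; vm_compute.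
  - by rewrite Pv' /V' /V /cj /U !(quotient_holM, quotient_holV) !quotient_holE f1 f2 fr; vm_compute.
have act0 q : group_act q 0 = 0 := zact_0r model_action q.
have h2 n : quotient_hol (zpow (pi a2) n) = mk_model 0 (n, 0).
  rewrite (zpow_morph _ _ quotient_holM) quotient_holE f2.
  rewrite [RHS](@int_hom_zpow _ (fun n => mk_model 0 (n, 0))) // => x y.
  by rewrite -[RHS]/(sd_mul _ _) /sd_mul /= act0 addr0.
have hr n : quotient_hol (zpow (pi r) n) = mk_model 0 (0, n).
  rewrite (zpow_morph _ _ quotient_holM) quotient_holE fr.
  rewrite [RHS](@int_hom_zpow _ (fun n => mk_model 0 (0, n))) // => x y.
  by rewrite -[RHS]/(sd_mul _ _) /sd_mul /= act0 addr0.
have hnf x q : quotient_hol (normal_form (pi a2) (pi r) Phi x q) = (x, q).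
  case: q => i j; rewrite /normal_form !quotient_holM hPhi h2 hr.
  have pairD (a b c d : int) : ((a, b) : Q2) + (c, d) = (a + c, b + d) by [].
  by rewrite -[LHS]/(sd_mul (sd_mul _ _) _) /sd_mul /= !act0 !addr0 !pairD !addr0 !add0r.
apply: (@Bijective _ _ _ (fun xq : model => normal_form (pi a2) (pi r) Phi xq.1 xq.2)).
- by move=> g; have [x [q ->]] := nf g; rewrite hnf.
- by case=> x q; rewrite hnf.
Qed.

End MetabelianQuotient.

(** * Transfer of the model to integer row vectors *)

Lemma group_isomorphicI (G H : groupType) (f : G -> H) :
  {morph f : x y / (x * y)%g} -> bijective f -> group_isomorphic G H.
Proof.
move=> fM fB; pose mixin := isMultiplicative.Build G H f fM.
pose F : {multiplicative G -> H} := HB.pack f mixin.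
by exists F.
Qed.

Definition row4_coords (x : 'rV[int]_4) : N4 :=
  ((x 0 (inord 0), x 0 (inord 1)), (x 0 (inord 2), x 0 (inord 3))).

Definition row4 (x : N4) : 'rV[int]_4 :=
  \row_i nth 0 [:: x.1.1; x.1.2; x.2.1; x.2.2] i.

Definition row2_coords (q : 'rV[int]_2) : Q2 := (q 0 (inord 0), q 0 (inord 1)).

Definition row2 (q : Q2) : 'rV[int]_2 := \row_i nth 0 [:: q.1; q.2] i.

Lemma row4K : cancel row4 row4_coords.
Proof. by case=> [[a b] [c d]]; rewrite /row4_coords !mxE !inordK. Qed.

Lemma row4_coordsK : cancel row4_coords row4.
Proof.
move=> x; apply/rowP => i; rewrite mxE.
by case: i => [[|[|[|[|//]]]] i4] /=; congr (x _ _); apply: val_inj; rewrite /= inordK.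
Qed.

Lemma row2K : cancel row2 row2_coords.
Proof. by case=> [a b]; rewrite /row2_coords !mxE !inordK. Qed.

Lemma row2_coordsK : cancel row2_coords row2.
Proof.
move=> x; apply/rowP => i; rewrite mxE.
by case: i => [[|[|//]] i2] /=; congr (x _ _); apply: val_inj; rewrite /= inordK.
Qed.

Lemma row4_coordsD : {morph row4_coords : x y / x + y}.
Proof. by move=> x y; rewrite /row4_coords !mxE. Qed.

Lemma row2_coordsD : {morph row2_coords : x y / x + y}.
Proof. by move=> x y; rewrite /row2_coords !mxE. Qed.

Lemma row4_coordsN : {morph row4_coords : x / - x}.
Proof. by move=> x; rewrite /row4_coords !mxE. Qed.

Lemma row4D : {morph row4 : x y / x + y}.
Proof. by move=> x y; apply: (can_inj row4_coordsK); rewrite row4_coordsD !row4K. Qed.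

Definition row_act (q : 'rV[int]_2) (x : 'rV[int]_4) : 'rV[int]_4 :=
  row4 (group_act (row2_coords q) (row4_coords x)).

Lemma row_act0 x : row_act 0 x = x.
Proof. by rewrite /row_act /row2_coords !mxE group_act0 row4_coordsK. Qed.

Lemma row_actD q r x : row_act (q + r) x = row_act q (row_act r x).
Proof. by rewrite /row_act row4K row2_coordsD group_actD. Qed.

Lemma row_actDr q x y : row_act q (x + y) = row_act q x + row_act q y.
Proof. by rewrite /row_act row4_coordsD group_actDr row4D. Qed.

Definition row_action : zmod_action 'rV[int]_2 'rV[int]_4 :=
  ZmodAction row_act0 row_actD row_actDr.

Definition model_row (g : model) : semidirect_product row_action := (row4 g.1, row2 g.2).

Lemma model_rowM : {morph model_row : g h / (g * h)%g}.
Proof.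
move=> [x q] [y s]; rewrite -[LHS]/(row4 (x + group_act q y), row2 (q + s)).
rewrite -[RHS]/(row4 x + row_act (row2 q) (row4 y), row2 q + row2 s).
congr (_, _); first by rewrite row4D /row_act row2K row4K.
by apply: (can_inj row2_coordsK); rewrite row2_coordsD !row2K.
Qed.

Lemma model_row_bij : bijective model_row.
Proof.
exists (fun g => (row4_coords g.1, row2_coords g.2)).
- by case=> x q; rewrite /model_row /= row4K row2K.
- by case=> x q; rewrite /model_row /= row4_coordsK row2_coordsK.
Qed.

Lemma row4_coords_delta (k : nat) : (k < 4)%N ->
  row4_coords (delta_mx 0 (inord k)) =
    (((k == 0%N)%:R, (k == 1%N)%:R), ((k == 2%N)%:R, (k == 3%N)%:R)).
Proof.
move=> k4; rewrite /row4_coords !mxE eqxx /= -!val_eqE /= !inordK //.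
by rewrite ![_ == k]eq_sym.
Qed.

Lemma row2_coords_delta (k : nat) : (k < 2)%N ->
  row2_coords (delta_mx 0 (inord k)) = ((k == 0%N)%:R, (k == 1%N)%:R).
Proof.
move=> k2; rewrite /row2_coords !mxE eqxx /= -!val_eqE /= !inordK //.
by rewrite ![_ == k]eq_sym.
Qed.

Lemma row_action_formulas :
  let alpha0 : 'rV[int]_4 := delta_mx 0 (inord 0) in
  let beta0 : 'rV[int]_4 := delta_mx 0 (inord 1) in
  let u : 'rV[int]_4 := delta_mx 0 (inord 2) in
  let v : 'rV[int]_4 := delta_mx 0 (inord 3) in
  let sigma : 'rV[int]_2 := delta_mx 0 (inord 0) in
  let rho1 : 'rV[int]_2 := delta_mx 0 (inord 1) in
  [/\ row_action sigma u = v, row_action sigma v = - u + v,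
      row_action sigma alpha0 = beta0 & row_action sigma beta0 = beta0 - alpha0] /\
  [/\ row_action rho1 alpha0 = alpha0, row_action rho1 beta0 = beta0,
      row_action rho1 u = - alpha0 - u + v & row_action rho1 v = - beta0 - u].
Proof.
by split; split; apply: (can_inj row4_coordsK);
  rewrite row4K ?(row4_coordsD, row4_coordsN) !row4_coords_delta // row2_coords_delta.
Qed.

(** * Stereographic projection of the twice punctured sphere *)

Section Stereographic.
Variable R : realType.

Definition stereo (a b c : R) : R * R := (a / (1 - c), b / (1 - c)).

Definition inv_stereo (w : R * R) : R * R * R :=
  let d := w.1 ^+ 2 + w.2 ^+ 2 in
  (2 * w.1 / (d + 1), 2 * w.2 / (d + 1), (d - 1) / (d + 1)).

Lemma inv_stereo_den (w : R * R) : w.1 ^+ 2 + w.2 ^+ 2 + 1 != 0.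
Proof. by rewrite gt_eqF // ltr_wpDl // addr_ge0 // sqr_ge0. Qed.

Lemma inv_stereo_sphere (w : R * R) : let y := inv_stereo w in
  y.1.1 ^+ 2 + y.1.2 ^+ 2 + y.2 ^+ 2 = 1.
Proof.
rewrite /inv_stereo /=; have := inv_stereo_den w; move: (w.1) (w.2) => a b d0.
by field.
Qed.

Lemma inv_stereo_neq1 (w : R * R) : (inv_stereo w).2 != 1.
Proof.
rewrite /inv_stereo /= -subr_eq0.
have -> : (w.1 ^+ 2 + w.2 ^+ 2 - 1) / (w.1 ^+ 2 + w.2 ^+ 2 + 1) - 1
    = - 2 / (w.1 ^+ 2 + w.2 ^+ 2 + 1).
  by have := inv_stereo_den w; move: (w.1) (w.2) => a b d0; field.
by rewrite mulf_neq0 ?invr_eq0 ?inv_stereo_den // oppr_eq0 pnatr_eq0.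
Qed.

Lemma inv_stereoK (w : R * R) : let y := inv_stereo w in stereo y.1.1 y.1.2 y.2 = w.
Proof.
case: w => a b; rewrite /stereo /inv_stereo /=.
have d0 := inv_stereo_den (a, b); rewrite /= in d0.
by congr (_, _); field; rewrite d0 /=; apply/eqP => h; lra.
Qed.

Lemma stereoK (a b c : R) : a ^+ 2 + b ^+ 2 + c ^+ 2 = 1 -> c != 1 ->
  inv_stereo (stereo a b c) = (a, b, c).
Proof.
move=> abc c1; have c0 : 1 - c != 0 by rewrite subr_eq0 eq_sym.
rewrite /inv_stereo /stereo /=.
have -> : (a / (1 - c)) ^+ 2 + (b / (1 - c)) ^+ 2 = (1 + c) / (1 - c).
  have -> : (a / (1 - c)) ^+ 2 + (b / (1 - c)) ^+ 2 = (a ^+ 2 + b ^+ 2) / (1 - c) ^+ 2 by field.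
  by rewrite (_ : a ^+ 2 + b ^+ 2 = 1 - c ^+ 2); [field|lra].
by congr (_, _, _); field; rewrite c0 /=; apply/eqP => h; lra.
Qed.

(** Householder reflection in the hyperplane orthogonal to [n - e], which exchanges the two unit
    vectors; for [n = e] this vector vanishes and the identity serves. *)
Lemma reflection_ex (n : 'rV[R]_3) (k : 'I_3) : n *m n^T = 1 ->
  exists O : 'M[R]_3, [/\ O *m O = 1%:M, O^T = O & n *m O = delta_mx 0 k].
Proof.
move=> nn; pose e : 'rV[R]_3 := delta_mx 0 k.
have [->|ne] := eqVneq n e.
  by exists 1%:M; rewrite trmx1 !mulmx1.
pose w := n - e; pose s := (w *m w^T) 0 0.
have ee : e *m e^T = 1.
  by rewrite trmx_delta mul_delta_mx; apply/matrixP => i j; rewrite !mxE !ord1.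
have wwE : w *m w^T = s%:M by apply/matrixP => i j; rewrite !ord1 [RHS]mxE.
have s0 : s != 0.
  apply: contra_neq ne => s0; apply/eqP; rewrite -subr_eq0; apply/eqP/rowP => i.
  have : \sum_j w 0 j ^+ 2 = 0.
    by rewrite -[RHS]s0 /s mxE; apply: eq_bigr => j _; rewrite [w^T _ _]mxE expr2.
  move/eqP; rewrite psumr_eq0 => [/allP/(_ i)|j _]; last exact: sqr_ge0.
  by rewrite mem_index_enum /= sqrf_eq0 -/w => /(_ isT)/eqP ->; rewrite mxE.
pose P := w^T *m w; pose c := 2 / s.
have PP : P *m P = s *: P.
  by rewrite /P mulmxA -(mulmxA w^T) wwE mul_mx_scalar -scalemxAl.
have cs : c * (c * s) = c + c by rewrite /c; field.
exists (1%:M - c *: P); split.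
- rewrite mulmxBl mul1mx mulmxBr mulmx1 -scalemxAl -scalemxAr PP !scalerA.
  by rewrite -mulrA cs scalerDl opprB addrK subrK.
- by rewrite linearB /= linearZ /= trmx1 /P trmx_mul trmxK.
pose a := (n *m e^T) 0 0.
have neE : n *m e^T = a%:M by apply/matrixP => i j; rewrite !ord1 [RHS]mxE.
have enE : e *m n^T = a%:M by rewrite -[LHS]trmxK trmx_mul trmxK neE tr_scalar_mx.
have wTE : w^T = n^T - e^T by rewrite /w linearB.
have nw : n *m w^T = (1 - a)%:M.
  by rewrite wTE mulmxBr nn neE raddfB.
(* The squared length of a difference of unit vectors with inner product [a]; hence the coefficient
   of [w] below is 1. *)
have sE : s = 2 * (1 - a).
  have : s%:M = (2 * (1 - a))%:M :> 'M[R]_1.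
    rewrite -wwE {1}/w mulmxBl nw wTE mulmxBr enE ee -!raddfB /=.
    by congr _%:M; ring.
  by move/matrixP/(_ 0 0); rewrite !mxE eqxx !mulr1n.
rewrite mulmxBr mulmx1 -scalemxAr /P mulmxA nw mul_scalar_mx scalerA.
rewrite (_ : c * (1 - a) = 1); last first.
  by rewrite /c sE; move: s0; rewrite sE mulf_eq0 negb_or => /andP[_ a0]; field.
by rewrite scale1r /w opprB addrC subrK.
Qed.

Lemma row_continuous_at (T : topologicalType) (n : nat) (f : T -> 'rV[R]_n) t :
  (forall i, {for t, continuous (fun t => f t 0 i)}) -> {for t, continuous f}.
Proof.
move=> cf A [P ftP PA]; rewrite /=.
apply: (@filterS _ _ _ [set s | forall i, P 0 i (f s 0 i)]).
  by move=> s Ps; apply: PA => i j; rewrite ord1.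
apply: (@filter_forall _ _ (fun i s => P 0 i (f s 0 i)) (nbhs t)) => i.
exact: cf (ftP 0 i).
Qed.

Lemma mulmx_row_continuous (T : topologicalType) (m n : nat) (f : T -> 'rV[R]_m)
    (A : 'M[R]_(m, n)) j t :
  (forall i, {for t, continuous (fun t => f t 0 i)}) ->
  {for t, continuous (fun t => (f t *m A) 0 j)}.
Proof.
move=> cf; rewrite (_ : (fun _ => _) = (fun t => \sum_i f t 0 i * A i j)); last first.
  by apply/funext => s; rewrite mxE.
apply: cvg_big => [|i _]; first exact: add_continuous.
by apply: cvgM; [exact: cf|exact: cvg_cst].
Qed.

End Stereographic.

Section ContinuousAt.
Variables (R : realType) (X : topologicalType) (x : X).

Lemma continuous_at_cst (Y : topologicalType) (c : Y) : {for x, continuous (fun=> c)}.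
Proof. exact: cvg_cst. Qed.

Lemma continuous_at_add (V : normedModType R) (f g : X -> V) :
  {for x, continuous f} -> {for x, continuous g} -> {for x, continuous (fun y => f y + g y)}.
Proof. by move=> cf cg; apply: cvgD. Qed.

Lemma continuous_at_sub (V : normedModType R) (f g : X -> V) :
  {for x, continuous f} -> {for x, continuous g} -> {for x, continuous (fun y => f y - g y)}.
Proof. by move=> cf cg; apply: cvgB. Qed.

Lemma continuous_at_mul (f g : X -> R) :
  {for x, continuous f} -> {for x, continuous g} -> {for x, continuous (fun y => f y * g y)}.
Proof. by move=> cf cg; apply: cvgM. Qed.

Lemma continuous_at_inv (f : X -> R) : f x != 0 ->
  {for x, continuous f} -> {for x, continuous (fun y => (f y)^-1)}.
Proof. by move=> f0 cf; apply: cvgV. Qed.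

End ContinuousAt.

Section PuncturedSphere.
Variables (R : realType) (x1 x2 : 'rV[R]_3).
Hypotheses (hx1 : sphere2 x1) (hx12 : x1 <> x2).
Local Notation M := (sphere2_minus x1 x2).
Local Notation i0 := (inord 0 : 'I_3).
Local Notation i1 := (inord 1 : 'I_3).
Local Notation i2 := (inord 2 : 'I_3).
Variables (O : 'M[R]_3) (m0 : M).
Hypotheses (OO : O *m O = 1%:M) (OT : O^T = O) (x2O : x2 *m O = delta_mx 0 i2).
Implicit Types (x y : 'rV[R]_3).

Lemma sum3 (F : 'I_3 -> R) : \sum_(i < 3) F i = F i0 + F i1 + F i2.
Proof.
rewrite !big_ord_recr big_ord0 /= add0r.
by congr (F _ + F _ + F _); apply: val_inj; rewrite /= inordK.
Qed.

Definition row3 (a b c : R) : 'rV[R]_3 := \row_i nth 0 [:: a; b; c] i.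

Lemma row3E a b c : (row3 a b c 0 i0 = a) * (row3 a b c 0 i1 = b) * (row3 a b c 0 i2 = c).
Proof. by rewrite !mxE !inordK. Qed.

Lemma row3_eta x : row3 (x 0 i0) (x 0 i1) (x 0 i2) = x.
Proof.
apply/rowP => i; rewrite mxE.
by case: i => [[|[|[|//]]] i3] /=; congr (x _ _); apply: val_inj; rewrite /= inordK.
Qed.

Lemma sphere2P x : sphere2 x <-> x *m x^T = 1.
Proof.
rewrite /sphere2 /=; have E : (x *m x^T) 0 0 = \sum_(i < 3) x ord0 i ^+ 2.
  by rewrite mxE; apply: eq_bigr => i _; rewrite mxE expr2.
split=> [xs|xx]; last by rewrite -E xx mxE eqxx.
by apply/matrixP => i j; rewrite !ord1 E xs mxE eqxx.
Qed.

Lemma sphere2_reflect x : sphere2 x -> sphere2 (x *m O).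
Proof.
by move=> /sphere2P xx; apply/sphere2P; rewrite trmx_mul OT mulmxA -(mulmxA x) OO mulmx1.
Qed.

Lemma reflectK x : x *m O *m O = x. Proof. by rewrite -mulmxA OO mulmx1. Qed.

Lemma sphere2_coords x : sphere2 x -> (x 0 i0) ^+ 2 + (x 0 i1) ^+ 2 + (x 0 i2) ^+ 2 = 1.
Proof. by rewrite /sphere2 /= sum3. Qed.

Lemma north_neq1 x : sphere2 x -> x <> x2 -> (x *m O) 0 i2 != 1.
Proof.
move=> xs xx2; apply/eqP => x1'; apply: xx2; rewrite -(reflectK x) -(reflectK x2); congr (_ *m _).
have := sphere2_coords (sphere2_reflect xs); rewrite x1' expr1n => /eqP.
rewrite -subr_eq0 addrK paddr_eq0 ?sqr_ge0 // !sqrf_eq0 => /andP[/eqP a0 /eqP b0].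
rewrite x2O -(row3_eta (x *m O)) a0 b0 x1' -[RHS]row3_eta !mxE eqxx /= -!val_eqE /= !inordK //.
Qed.

(** [O] carries [x2] to the north pole, which is the centre of projection. *)
Definition plane_of x : R * R :=
  stereo ((x *m O) 0 i0) ((x *m O) 0 i1) ((x *m O) 0 i2).

Definition sphere_of (w : R * R) : 'rV[R]_3 :=
  let y := inv_stereo w in row3 y.1.1 y.1.2 y.2 *m O.

Lemma plane_ofK x : sphere2 x -> x <> x2 -> sphere_of (plane_of x) = x.
Proof.
move=> xs xx2; rewrite /sphere_of /plane_of stereoK /=; last exact: north_neq1.
  by rewrite row3_eta reflectK.
exact: sphere2_coords (sphere2_reflect xs).
Qed.

Lemma sphere_ofK w : plane_of (sphere_of w) = w.
Proof. by rewrite /sphere_of /plane_of reflectK !row3E inv_stereoK. Qed.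

Lemma sphere_of_sphere w : sphere2 (sphere_of w).
Proof.
apply: sphere2_reflect; rewrite /sphere2 /= sum3 !row3E.
exact: inv_stereo_sphere.
Qed.

Lemma sphere_of_neq w : sphere_of w <> x2.
Proof.
move=> /(congr1 (fun x => (x *m O) 0 i2)); rewrite reflectK row3E x2O mxE !eqxx /=.
by apply/eqP; exact: inv_stereo_neq1.
Qed.

(** The translation puts the image of [x1] at the origin, where the plane is punctured. *)
Definition punctured_plane_of (p : M) : R * R := plane_of (set_val p) - plane_of x1.

(** The default [m0] is taken only at [z = 0], which corresponds to [x1]. *)
Definition punctured_sphere_of (z : R * R) : M :=
  if pselect ((sphere2 (R := R) `\` [set x1; x2]) (sphere_of (z + plane_of x1))) is left zs
  then exist (fun x => x \in sphere2 (R := R) `\` [set x1; x2]) _ (mem_set zs) else m0.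

Lemma punctured_sphere_ofE z : z != 0 ->
  set_val (punctured_sphere_of z) = sphere_of (z + plane_of x1).
Proof.
move=> z0; rewrite /punctured_sphere_of; case: pselect => // nz; exfalso; apply: nz.
split; first exact: sphere_of_sphere.
move=> [] /= E; last exact: (@sphere_of_neq (z + plane_of x1)).
have := congr1 plane_of E; rewrite sphere_ofK => /eqP.
by rewrite -subr_eq0 addrK (negbTE z0).
Qed.

Lemma punctured_valP (p : M) :
  [/\ sphere2 (set_val p), set_val p <> x1 & set_val p <> x2].
Proof.
have [ps pn] : (sphere2 (R := R) `\` [set x1; x2]) (set_val p) := set_valP p.
by split=> // px; apply: pn; rewrite px; [left|right].
Qed.

Lemma punctured_plane_of_neq0 p : punctured_plane_of p != 0.
Proof.
have [ps p1 p2] := punctured_valP p; rewrite /punctured_plane_of subr_eq0; apply/eqP => E.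
by apply: p1; rewrite -(plane_ofK ps p2) E plane_ofK.
Qed.

Lemma punctured_plane_ofK : cancel punctured_plane_of punctured_sphere_of.
Proof.
move=> p; apply: val_inj; have [ps _ p2] := punctured_valP p.
rewrite -[LHS]/(set_val _) punctured_sphere_ofE; last exact: punctured_plane_of_neq0.
by rewrite /punctured_plane_of subrK plane_ofK.
Qed.

Lemma punctured_sphere_ofK z : z != 0 -> punctured_plane_of (punctured_sphere_of z) = z.
Proof.
by move=> z0; rewrite /punctured_plane_of punctured_sphere_ofE // sphere_ofK addrK.
Qed.

Lemma punctured_plane_of_continuous : continuous punctured_plane_of.
Proof.
move=> p; have [ps _ p2] := punctured_valP p.
have cO j : {for p, continuous (fun p : M => (set_val p *m O) 0 j)}.
  apply: mulmx_row_continuous => i.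
  apply: (@continuous_comp _ _ _ (set_val : M -> 'rV[R]_3) (fun x => x 0 i)).
    exact: initial_continuous.
  exact: coord_continuous.
have c1 : 1 - (set_val p *m O) 0 i2 != 0.
  by rewrite subr_eq0 eq_sym; exact: north_neq1.
have cV : {for p, continuous (fun p : M => (1 - (set_val p *m O) 0 i2)^-1)}.
  apply: (@continuous_at_inv _ _ _ (fun p : M => 1 - (set_val p *m O) 0 i2) c1).
  apply: (@continuous_at_sub _ _ _ R^o (fun=> 1) (fun p : M => (set_val p *m O) 0 i2)).
    exact: continuous_at_cst.
  exact: cO.
have cl : {for p, continuous (fun p : M => (set_val p *m O) 0 i0 / (1 - (set_val p *m O) 0 i2))}.
  exact: (cvgM (cO i0) cV).
have cr : {for p, continuous (fun p : M => (set_val p *m O) 0 i1 / (1 - (set_val p *m O) 0 i2))}.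
  exact: (cvgM (cO i1) cV).
have cp : {for p, continuous (fun p : M => plane_of (set_val p))} by exact: (cvg_pair cl cr).
apply: (@continuous_at_sub _ _ _ (R^o * R^o)%type (fun p : M => plane_of (set_val p))
  (fun=> plane_of x1)); first exact: cp.
exact: continuous_at_cst.
Qed.

Lemma punctured_sphere_of_continuous (z : R * R) : z != 0 -> {for z, continuous punctured_sphere_of}.
Proof.
move=> z0; apply: initial_cvg.
(* Near [z] the default does not intervene, and the map agrees with a rational formula. *)
have near0 : \forall s \near z, s != 0.
  have z0' : 0 < `|z| by rewrite normr_gt0.
  apply: filterS (nbhsx_ballx z _ z0') => s; rewrite -ball_normE /= => zs.
  by apply: contraTneq zs => ->; rewrite subr0 ltxx.
rewrite [X in _ --> X]punctured_sphere_ofE //.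
have E : \forall s \near z, sphere_of (s + plane_of x1) = set_val (punctured_sphere_of s).
  by apply: filterS near0 => s s0; rewrite punctured_sphere_ofE.
apply: (cvg_trans (near_eq_cvg E)).
suff : {for z, continuous (fun s : R * R => sphere_of (s + plane_of x1))} by [].
apply: row_continuous_at => j; rewrite /sphere_of; apply: mulmx_row_continuous => i.
have cx : {for z, continuous (fun s : R * R => s.1 + (plane_of x1).1)}.
  apply: (@continuous_at_add _ _ _ R^o fst (fun=> (plane_of x1).1)); first exact: cvg_fst.
  exact: continuous_at_cst.
have cy : {for z, continuous (fun s : R * R => s.2 + (plane_of x1).2)}.
  apply: (@continuous_at_add _ _ _ R^o snd (fun=> (plane_of x1).2)); first exact: cvg_snd.
  exact: continuous_at_cst.
pose d (s : R * R) := (s.1 + (plane_of x1).1) ^+ 2 + (s.2 + (plane_of x1).2) ^+ 2.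
have cd : {for z, continuous d}.
  by apply: (@continuous_at_add _ _ _ R^o); apply: continuous_at_mul.
have d1 : d z + 1 != 0 by exact: (inv_stereo_den (z + plane_of x1)).
have cV : {for z, continuous (fun s => (d s + 1)^-1)}.
  apply: (@continuous_at_inv _ _ _ (fun s => d s + 1) d1).
  by apply: (@continuous_at_add _ _ _ R^o d (fun=> 1)) => //; exact: continuous_at_cst.
have c2 : {for z, continuous (fun=> 2 : R)} by exact: continuous_at_cst.
have -> : (fun s : R * R => row3 (inv_stereo (s + plane_of x1)).1.1
    (inv_stereo (s + plane_of x1)).1.2 (inv_stereo (s + plane_of x1)).2 0 i) =
  (fun s => nth 0 [:: 2 * (s.1 + (plane_of x1).1) / (d s + 1);
     2 * (s.2 + (plane_of x1).2) / (d s + 1); (d s - 1) / (d s + 1)] i).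
  by apply/funext => s; rewrite mxE.
case: i => [[|[|[|//]]] i3] /=.
- by do 2![apply: continuous_at_mul => //].
- by do 2![apply: continuous_at_mul => //].
- apply: continuous_at_mul => //.
  by apply: (@continuous_at_sub _ _ _ R^o d (fun=> 1)) => //; exact: continuous_at_cst.
Qed.

End PuncturedSphere.

Theorem proposition12 (R : realType) (x1 x2 : 'rV[R]_3)
    (hx1 : sphere2 x1) (hx2 : sphere2 x2) (hx12 : x1 <> x2)
    (b : unordered_conf_space 3 (sphere2_minus x1 x2)) :
  let G : groupType := braid_group R b in
  let alpha0 : 'rV[int]_4 := delta_mx 0 (inord 0) in
  let beta0 : 'rV[int]_4 := delta_mx 0 (inord 1) in
  let u : 'rV[int]_4 := delta_mx 0 (inord 2) in
  let v : 'rV[int]_4 := delta_mx 0 (inord 3) in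
  let sigma : 'rV[int]_2 := delta_mx 0 (inord 0) in
  let rho1 : 'rV[int]_2 := delta_mx 0 (inord 1) in
  exists theta : zmod_action 'rV[int]_2 'rV[int]_4,
    [/\ theta sigma u = v,
        theta sigma v = - u + v,
        theta sigma alpha0 = beta0
      & theta sigma beta0 = beta0 - alpha0] /\
    [/\ theta rho1 alpha0 = alpha0,
        theta rho1 beta0 = beta0,
        theta rho1 u = - alpha0 - u + v
      & theta rho1 v = - beta0 - u] /\
    group_isomorphic (quotient_group (derived_normal G 2))
                     (semidirect_product theta).
Proof.
(* A representative of the base point supplies the default configuration, and one of its points the
   default point of the sphere. *)
rewrite /braid_group; have w0 : conf_space 3 (sphere2_minus x1 x2) := repr b.
have [A [OO OT x2O]] := reflection_ex (inord 2) ((sphere2P x2).1 hx2).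
have m0 : sphere2_minus x1 x2 := set_val w0 ord0.
have [a1 [a2 [r [f [ [e12 er2 er1] [gen_f [fM f1 f2 fr] ] ] ] ] ] ] :=
  annular_braid_group (@punctured_plane_of_continuous _ _ _ _ OO OT x2O)
    (punctured_plane_of_neq0 hx1 hx12 OO OT x2O) (punctured_plane_ofK hx1 hx12 m0 OO OT x2O)
    (punctured_sphere_ofK m0 OO OT x2O) (@punctured_sphere_of_continuous _ _ _ _ m0 OO OT x2O) w0 b.
exists row_action; have [A1 A2] := row_action_formulas; split; first exact: A1.
split; first exact: A2.
apply: (@group_isomorphicI _ _ (model_row \o quotient_hol f)).
  by move=> g h /=; rewrite (quotient_holM fM) model_rowM.
exact: bij_comp model_row_bij (quotient_model e12 er2 er1 gen_f fM f1 f2 fr).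
Qed.
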